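(* Let $1<p<\infty$ and let $T(a)+H(b)\in\mathcal F_{TH}^p(-2,2)$, with subordinated pair $(c,d)$, be invertible on $H^p$. With $d=\boldsymbol\sigma(d)d_+t^{-2}\tilde d_+^{-1}$ the Wiener–Hopf factorization of $d$ in $L^p$, $\omega^{a,b,+}:=T^{-1}(ct^{-2})T(\tilde a^{-1}t^{-1})\big(d_+^{-1}(1+\boldsymbol\sigma(d)t)\big)$ and $\hat\omega_0^{a,b,+}\neq0$ its zeroth Fourier coefficient, and $T_r^{-1}(d)$ any right inverse of $T(d)$, one has $$(T(a)+H(b))^{-1}=T(t^{-1})\Big(I-\tfrac{1}{\hat\omega_0^{a,b,+}}\,\omega^{a,b,+}\,tQt^{-1}\Big)\Big((I-H(t^2\tilde c))T^{-1}(t^{-2}c)T(\tilde a^{-1}t^{-1})T_r^{-1}(d)+H(a^{-1}t)T_r^{-1}(d)\Big),$$ where $\omega^{a,b,+}tQt^{-1}$ is the operator $f\mapsto \omega^{a,b,+}\cdot tQ(t^{-1}f)$, which on $f\in H^p$ equals $f\mapsto\hat f_0\,\omega^{a,b,+}$.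
   Context: $\mathbb T$ is the unit circle, $1<p<\infty$, $1/p+1/q=1$; $H^p=\{f\in L^p(\mathbb T):\hat f_n=0\ \forall n<0\}$, $\overline{H^p}=\{f\in L^p:\hat f_n=0\ \forall n>0\}$; $P$ is the Riesz projection onto $H^p$, $Q=I-P$, $(Jf)(t)=t^{-1}f(t^{-1})$, $\tilde a(t)=a(1/t)$; $t$ denotes $t\mapsto t$; functions as operators denote multiplication. On $H^p$: $T(a)f=P(af)$, $H(a)f=P(aQJf)$. A pair $(a,b)$ with $a\in GL^\infty(\mathbb T)$ (invertible in $L^\infty$) and $b\in L^\infty(\mathbb T)$ is a matching pair if $a\tilde a=b\tilde b$; the subordinated pair is $(c,d)$, $c:=a/b$, $d:=a/\tilde b$, with $c\tilde c=d\tilde d=1$. We write $T(a)+H(b)\in\mathcal F_{TH}^p(\kappa_1,\kappa_2)$ if $(a,b)$ is a matching pair whose subordinated operators $T(c),T(d)$ are Fredholm on $H^p$ with $\operatorname{ind}T(c)=\kappa_1$, $\operatorname{ind}T(d)=\kappa_2$. A Wiener–Hopf factorization of $a\in L^\infty$ in $L^p$ is $a=a_-t^ma_+$ with $m\in\mathbb Z$, $a_+\in H^q$, $a_+^{-1}\in H^p$, $a_-\in\overline{H^p}$, $a_-^{-1}\in\overline{H^q}$, and $\|a_+^{-1}P(a_+\varphi)\|_p\le c_p\|\varphi\|_p$ for all trigonometric polynomials $\varphi$. If $g$ satisfies $g\tilde g=1$ and $T(g)$ is Fredholm on $H^p$ with index $n$, its Wiener–Hopf factorization normalized by $g_-(\infty)=1$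 has the form $g=\boldsymbol\sigma(g)g_+t^{-n}\tilde g_+^{-1}$ with $\boldsymbol\sigma(g)=g_+(0)\in\{-1,1\}$ (the factorization signature) and plus factor $g_+$. *)

(* Defs.v *)
(* Functions on the unit circle T are
   represented as functions  R[i] -> R[i]  (R : realType, R[i] the complex
   numbers of mathcomp-real-closed), of which only the values on the circle
   { circ θ | θ ∈ [0, 2π] } matter; the measure on T is (normalised)
   Lebesgue measure in the angle θ, and all equalities between elements of
   L^p(T) are equalities almost everywhere ([aeeq]). *)
From Stdlib Require Import ClassicalEpsilon.
From mathcomp Require Import all_boot all_algebra.
From mathcomp Require Import all_classical all_reals all_analysis.
From mathcomp Require Import complex.
Import GRing.Theory Num.Theory.
Local Open Scope ring_scope.
Local Open Scope classical_set_scope.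

Set Implicit Arguments.
Unset Strict Implicit.
Unset Printing Implicit Defensive.

Definition fn (R : realType) := R[i] -> R[i].

Definition circ (R : realType) (th : R) : R[i] := (cos th +i* sin th)%C.

Definition I02 (R : realType) : set R := `[0, 2 * pi]%classic.

Definition cmod (R : realType) (z : R[i]) : R :=
  Num.sqrt (complex.Re z ^+ 2 + complex.Im z ^+ 2).

Definition fadd (R : realType) (f g : fn R) : fn R := fun z => f z + g z.
Definition fminus (R : realType) (f g : fn R) : fn R := fun z => f z - g z.
Definition fmul (R : realType) (f g : fn R) : fn R := fun z => f z * g z.
Definition fscal (R : realType) (l : R[i]) (f : fn R) : fn R := fun z => l * f z.
Definition frecip (R : realType) (f : fn R) : fn R := fun z => (f z)^-1.
Definition fcst (R : realType) (c : R[i]) : fn R := fun _ => c.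
Definition tpow (R : realType) (k : int) : fn R := fun z => z ^ k.
Definition tilde (R : realType) (a : fn R) : fn R := fun z => a (z^-1).
Definition Jop (R : realType) (f : fn R) : fn R := fun z => z^-1 * f (z^-1).

Definition cmeas (R : realType) (f : fn R) : Prop :=
  measurable_fun (@I02 R) (fun th => complex.Re (f (circ th))) /\
  measurable_fun (@I02 R) (fun th => complex.Im (f (circ th))).

Definition aeeq (R : realType) (f g : fn R) : Prop :=
  (@lebesgue_measure R).-negligible
    [set th | @I02 R th /\ f (circ th) <> g (circ th)].

Definition Lp (R : realType) (p : R) (f : fn R) : Prop :=
  cmeas f /\
  (\int[@lebesgue_measure R]_(th in @I02 R) ((cmod (f (circ th))) `^ p)%:E < +oo)%E.

(* L^p norm (up to the harmless normalising constant of the measure) *)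
Definition lpnorm (R : realType) (p : R) (f : fn R) : R :=
  (Rintegral (@lebesgue_measure R) (@I02 R) (fun th => (cmod (f (circ th))) `^ p))
    `^ p^-1.

Definition Linf (R : realType) (f : fn R) : Prop :=
  cmeas f /\ exists M : R,
    (@lebesgue_measure R).-negligible [set th | @I02 R th /\ M < cmod (f (circ th))].

Definition GLinf (R : realType) (a : fn R) : Prop :=
  Linf a /\ exists a' : fn R, Linf a' /\ aeeq (fmul a a') (fcst 1).

Definition fc (R : realType) (f : fn R) (n : int) : R[i] :=
  let h := fun th : R => f (circ th) * (circ th) ^ (- n) in
  (((2 * pi)^-1 * Rintegral (@lebesgue_measure R) (@I02 R) (fun th => complex.Re (h th)))
   +i* ((2 * pi)^-1 * Rintegral (@lebesgue_measure R) (@I02 R) (fun th => complex.Im (h th))))%C.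

Definition Hp (R : realType) (p : R) (f : fn R) : Prop :=
  Lp p f /\ forall n : int, n < 0 -> fc f n = 0.
Definition Hpbar (R : realType) (p : R) (f : fn R) : Prop :=
  Lp p f /\ forall n : int, 0 < n -> fc f n = 0.

(* Riesz projection: P f is the (a.e. unique) integrable function whose
   Fourier coefficients are those of f for n >= 0 and 0 for n < 0. *)
Definition Proj (R : realType) (f : fn R) : fn R :=
  epsilon (inhabits (fcst 0))
    (fun g => Lp 1 g /\ forall n : int, fc g n = if 0 <= n then fc f n else 0).
Definition Qproj (R : realType) (f : fn R) : fn R := fminus f (Proj f).

Definition Toep (R : realType) (a : fn R) (f : fn R) : fn R := Proj (fmul a f).
Definition Hank (R : realType) (a : fn R) (f : fn R) : fn R :=
  Proj (fmul a (Qproj (Jop f))).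

(* the operator inverse on H^p (meaningful when the operator is invertible) *)
Definition opinv (R : realType) (p : R) (A : fn R -> fn R) (g : fn R) : fn R :=
  epsilon (inhabits (fcst 0)) (fun f => Hp p f /\ aeeq (A f) g).

Definition invertible_on (R : realType) (p : R) (A : fn R -> fn R) : Prop :=
  (forall f, Hp p f -> Hp p (A f)) /\
  (forall g, Hp p g -> exists f, Hp p f /\ aeeq (A f) g) /\
  (forall f1 f2, Hp p f1 -> Hp p f2 -> aeeq (A f1) (A f2) -> aeeq f1 f2).

Definition right_inverse_on (R : realType) (p : R) (A B : fn R -> fn R) : Prop :=
  (forall g, Hp p g -> Hp p (B g) /\ aeeq (A (B g)) g) /\
  (forall f g, Hp p f -> Hp p g -> aeeq f g -> aeeq (B f) (B g)) /\
  (forall f g (l : R[i]), Hp p f -> Hp p g ->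
     aeeq (B (fadd f (fscal l g))) (fadd (B f) (fscal l (B g)))) /\
  (exists C : R, forall g, Hp p g -> lpnorm p (B g) <= C * lpnorm p g).

Definition lincomb (R : realType) (n : nat) (l : 'I_n -> R[i]) (g : 'I_n -> fn R)
  : fn R := fun z => \sum_(i < n) l i * g i z.

Definition indep_mod (R : realType) (n : nat) (g : 'I_n -> fn R) (V : set (fn R))
  : Prop :=
  forall l : 'I_n -> R[i], (exists v, V v /\ aeeq (lincomb l g) v) -> forall i, l i = 0.

(* A is Fredholm on H^p with index k: its kernel in H^p has a finite basis
   g_0..g_{n-1}, the range A(H^p) has a finite algebraic complement in H^p
   with basis h_0..h_{m-1}, and k = n - m. *)
Definition Fredholm_index (R : realType) (p : R) (A : fn R -> fn R) (k : int) : Prop :=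
  (forall f, Hp p f -> Hp p (A f)) /\
  exists (n m : nat) (g : 'I_n -> fn R) (h : 'I_m -> fn R),
    (forall i, Hp p (g i) /\ aeeq (A (g i)) (fcst 0)) /\
    indep_mod g (fun v => aeeq v (fcst 0)) /\
    (forall f, Hp p f -> aeeq (A f) (fcst 0) -> exists l, aeeq f (lincomb l g)) /\
    (forall j, Hp p (h j)) /\
    indep_mod h (fun v => exists f, Hp p f /\ aeeq (A f) v) /\
    (forall u, Hp p u -> exists f l, Hp p f /\ aeeq u (fadd (A f) (lincomb l h))) /\
    k = n%:Z - m%:Z.

Definition matching_pair (R : realType) (a b : fn R) : Prop :=
  GLinf a /\ Linf b /\ aeeq (fmul a (tilde a)) (fmul b (tilde b)).
Definition sub_c (R : realType) (a b : fn R) : fn R := fmul a (frecip b).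
Definition sub_d (R : realType) (a b : fn R) : fn R := fmul a (frecip (tilde b)).

Definition F_TH (R : realType) (p : R) (a b : fn R) (k1 k2 : int) : Prop :=
  matching_pair a b /\
  Fredholm_index p (Toep (sub_c a b)) k1 /\
  Fredholm_index p (Toep (sub_d a b)) k2.

Definition trigpoly (R : realType) (phi : fn R) : Prop :=
  exists (N : nat) (al : int -> R[i]), forall th : R,
    phi (circ th) = \sum_(k < (2 * N).+1) al (k%:Z - N%:Z) * (circ th) ^ (k%:Z - N%:Z).

Definition WH_factorization (R : realType) (p : R) (a am ap : fn R) (m : int) : Prop :=
  let q := p / (p - 1) in
  Hpbar p am /\ Hpbar q (frecip am) /\ Hp q ap /\ Hp p (frecip ap) /\
  aeeq a (fmul am (fmul (tpow m) ap)) /\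
  exists cp : R, forall phi, trigpoly phi ->
    lpnorm p (fmul (frecip ap) (Proj (fmul ap phi))) <= cp * lpnorm p phi.

(* g = σ g_+ t^{-n} g~_+^{-1} is the Wiener-Hopf factorization of g normalised by
   g_-(∞) = 1, with signature σ = g_+(0) ∈ {-1,1} and plus factor g_+ *)
Definition normalized_WH (R : realType) (p : R) (g : fn R) (n : int)
    (sigma : R[i]) (gp : fn R) : Prop :=
  WH_factorization p g (fscal sigma (frecip (tilde gp))) gp (- n) /\
  fc (fscal sigma (frecip (tilde gp))) 0 = 1 /\
  fc gp 0 = sigma /\ (sigma = 1 \/ sigma = -1).

(* Main.v *)
(* The inverse is found by hand. Writing [u] for a right inverse of [T(d)] applied to [g]
   and [y := d u + J u = g + J(...)], the relation [c ~c = 1] turns any solution [v] of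
   [T(c t^-2) v = T(~a^-1 t^-1) u] into [x := v - s], with
   [s := H(t^2 ~c) v - H(a^-1 t) u], satisfying [a (t^-1 x) + b J(t^-1 x) = y].
   This would say [(T(a) + H(b))(t^-1 x) = g] if [x] vanished at the origin. The kernel
   element [k := d_+^-1 (1 + sigma t)] of [d k = J k] gives in the same way [omega] with
   [a (t^-1 omega) + b J(t^-1 omega) = J k], so a multiple of [omega] can be subtracted
   from [x] without changing the right-hand side modulo antianalytic functions; and
   [omega] does not vanish at the origin because [T(a) + H(b)] is injective.

   [T(c t^-2)] is invertible by Coburn's argument: if it has a kernel, then
   [ran T(c) + span(1, t)] contains all analytic polynomials, hence, being of finite
   codimension, is everything by the open mapping theorem, and a dimension count gives a
   contradiction; without kernel the same count gives surjectivity.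

   The Riesz projection is defined by its Fourier coefficients, so that all of this rests
   on the theorem of M. Riesz. For a nonnegative trigonometric polynomial [u] with
   analytic completion [A = u + i v], the mean of [A^2 / (A + s)] is [A(0)^2 / (A(0) + s)];
   its real part being nonnegative bounds the measure of [{|v| > s}] by the mean of
   [min(u, u^2 / s)], and summing over dyadic [s] bounds [v] in [L^p] for [1 < p < 2]
   (for [p = 2] the mean of [A^2] suffices). Approximating positive and negative parts by
   squares of moduli of polynomials removes the sign condition; duality and density give
   all [p > 1]. *)
Require Import Defs.
From HB Require Import structures.
From Stdlib Require Import ClassicalEpsilon.
From mathcomp Require Import all_boot all_algebra all_order.
From mathcomp Require Import all_classical all_reals all_analysis.
From mathcomp Require Import measurable_realfun complex.
From mathcomp Require Import ring lra zify.
Import Order.TTheory GRing.Theory Num.Theory.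
Import numFieldNormedType.Exports.
Local Open Scope classical_set_scope.
Local Open Scope ring_scope.
Set Implicit Arguments.
Unset Strict Implicit.
Unset Printing Implicit Defensive.

(** Fredholmness is given in purely algebraic form, by finite bases of the kernel and of a
    complement of the range. Density of the polynomials alone would therefore not put all of [H^p]
    into [ran T(c) + span(1, t)], since a subspace of finite codimension can be dense and proper;
    this is why a complete norm and a Baire argument have to be available. The operators are values
    of [epsilon] and are linear only up to a.e. equality. Identities in [H^p] are therefore tested
    on Fourier coefficients, which determine an integrable function almost everywhere, and the
    Banach space arguments are run on representatives, with relations in place of maps. In the
    theorem of M. Riesz, [A^2 / (A + s)] is chosen because the real part of [z^2 / (z + s)] at
    [z = i v] is [- s v^2 / (s^2 + v^2)], which is below [- s / 2] once [|v| > s], whereas at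
    [z = u + i v] with [u >= 0] it never exceeds a multiple of [min(u, u^2 / s)]. A nonnegative mean
    thus limits the size of the set where the negative values occur. *)

HB.lock Definition Int {R : realType} (u : R -> R) : Prop :=
  (@lebesgue_measure R).-integrable (@I02 R) (EFin \o u).
HB.lock Definition intg {R : realType} (u : R -> R) : R :=
  Rintegral (@lebesgue_measure R) (@I02 R) u.
HB.lock Definition aeD {R : realType} (P : R -> Prop) : Prop :=
  {ae (@lebesgue_measure R), forall th, I02 th -> P th}.

(** * Integrals over [[0, 2 * pi]], almost everywhere statements, reflection of the angle *)

Section integrals.
Context {R : realType}.
Local Notation mu := (@lebesgue_measure R).
Local Notation D := (@I02 R).
Implicit Types u v w : R -> R.

Lemma IntE u : Int u = mu.-integrable D (EFin \o u) :> Prop.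
Proof. by rewrite Int.unlock. Qed.

Lemma intgE u : intg u = Rintegral mu D u.
Proof. by rewrite intg.unlock. Qed.

Lemma aeDE P : aeD P = {ae mu, forall th, D th -> P th}.
Proof. by rewrite aeD.unlock. Qed.

#[local] Instance ae_mu_filter : Filter (nbhs (almost_everywhere mu)) :=
  ae_filter_ringOfSetsType _.

Lemma pi2_gt0 : 0 < 2 * pi :> R.
Proof. by rewrite mulr_gt0// pi_gt0. Qed.

Lemma measurable_D : measurable (D : set (measurableTypeR R)).
Proof. exact: measurable_itv. Qed.

Lemma mu_D : mu (D : set (measurableTypeR R)) = (2 * pi)%:E.
Proof. by rewrite lebesgue_measure_itv/= lte_fin pi2_gt0 oppr0 adde0. Qed.

Lemma Int_meas u : Int u -> measurable_fun D u.
Proof. by rewrite IntE => /measurable_int/measurable_EFinP. Qed.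

Lemma eq_Int u v : (forall th, D th -> u th = v th) -> Int u -> Int v.
Proof.
rewrite !IntE => uv; apply: eq_integrable; first exact: measurable_D.
by move=> th /set_mem Dth /=; rewrite uv.
Qed.

Lemma eq_intg u v : (forall th, D th -> u th = v th) -> intg u = intg v.
Proof. by move=> uv; rewrite !intgE; apply: eq_Rintegral => th /set_mem; exact: uv. Qed.

Lemma Int_le u v : measurable_fun D u -> Int v ->
  (forall th, D th -> `|u th| <= v th) -> Int u.
Proof.
rewrite !IntE => mu_ iv uv; apply: (le_integrable _ _ _ iv); first exact: measurable_D.
  exact/measurable_EFinP.
by move=> th Dth /=; rewrite lee_fin (le_trans (uv _ Dth))// ler_norm.
Qed.

Lemma IntD u v : Int u -> Int v -> Int (fun th => u th + v th).
Proof. by rewrite !IntE => iu iv; have := integrableD measurable_D iu iv. Qed.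

Lemma IntZ k u : Int u -> Int (fun th => k * u th).
Proof. by rewrite !IntE => iu; have := integrableZl measurable_D k iu. Qed.

Lemma IntN u : Int u -> Int (fun th => - u th).
Proof. by rewrite !IntE => iu; have := integrableN iu. Qed.

Lemma IntB u v : Int u -> Int v -> Int (fun th => u th - v th).
Proof. by move=> iu iv; apply: IntD => //; exact: IntN. Qed.

Lemma Int_abs u : Int u -> Int (fun th => `|u th|).
Proof. by rewrite !IntE => iu; have := integrable_abse iu. Qed.

Lemma Int_cst k : Int (fun _ : R => k).
Proof.
rewrite !IntE; apply/integrableP; split.
  by apply/measurable_EFinP; exact: measurable_cst.
rewrite /= integral_cst; last exact: measurable_D.
by rewrite [X in (_ * X)%E]mu_D ltry.
Qed.

Lemma Int_bounded u k : measurable_fun D u -> (forall th, D th -> `|u th| <= k) ->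
  Int u.
Proof. by move=> mu_ uk; apply: (Int_le mu_ (Int_cst k)). Qed.

Lemma Int_sum (I : Type) (s : seq I) (u : I -> R -> R) :
  (forall i, Int (u i)) -> Int (fun th => \sum_(i <- s) u i th).
Proof.
move=> iu; elim: s => [|i s IH].
  by apply: eq_Int (Int_cst 0) => th _; rewrite big_nil.
by apply: eq_Int (IntD (iu i) IH) => th _; rewrite big_cons.
Qed.

Lemma intgD u v : Int u -> Int v ->
  intg (fun th => u th + v th) = intg u + intg v.
Proof. by rewrite !IntE !intgE => iu iv; apply: RintegralD => //; exact: measurable_D. Qed.

Lemma intgB u v : Int u -> Int v ->
  intg (fun th => u th - v th) = intg u - intg v.
Proof. by rewrite !IntE !intgE => iu iv; apply: RintegralB => //; exact: measurable_D. Qed.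

Lemma intgZ k u : Int u -> intg (fun th => k * u th) = k * intg u.
Proof. by rewrite !IntE !intgE => iu; apply: RintegralZl => //; exact: measurable_D. Qed.

Lemma intg_cst k : intg (fun _ : R => k) = k * (2 * pi).
Proof.
rewrite !intgE Rintegral_cst; last exact: measurable_D.
by rewrite [X in fine X]mu_D.
Qed.

Lemma intg_ge0 u : (forall th, D th -> 0 <= u th) -> 0 <= intg u.
Proof. by move=> u0; rewrite !intgE; apply: Rintegral_ge0. Qed.

Lemma le_intg u v : Int u -> Int v -> (forall th, D th -> u th <= v th) ->
  intg u <= intg v.
Proof. by rewrite !IntE !intgE => iu iv uv; apply: le_Rintegral => //; exact: measurable_D. Qed.

Lemma le_norm_intg u : Int u -> `|intg u| <= intg (fun th => `|u th|).
Proof. by rewrite !IntE !intgE => iu; apply: le_normr_Rintegral => //; exact: measurable_D. Qed.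

Lemma intg_sum (I : Type) (s : seq I) (u : I -> R -> R) :
  (forall i, Int (u i)) ->
  intg (fun th => \sum_(i <- s) u i th) = \sum_(i <- s) intg (u i).
Proof.
move=> iu; elim: s => [|i s IH].
  rewrite big_nil (@eq_intg _ (fun=> 0)); first by rewrite intg_cst mul0r.
  by move=> th _; rewrite big_nil.
rewrite big_cons -IH -intgD//; last exact: Int_sum.
by apply: eq_intg => th _; rewrite big_cons.
Qed.

Lemma intg_EFin u : Int u -> (\int[mu]_(th in D) (u th)%:E)%E = (intg u)%:E.
Proof.
by rewrite IntE => iu; rewrite intgE /Rintegral fineK//; apply: integrable_fin_num => //;
  exact: measurable_D.
Qed.

Lemma Int_ge0P u : measurable_fun D u -> (forall th, D th -> 0 <= u th) ->
  Int u <-> (\int[mu]_(th in D) (u th)%:E < +oo)%E.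
Proof.
move=> mu_ u0; have e : (\int[mu]_(th in D) `|(u th)%:E| =
    \int[mu]_(th in D) (u th)%:E)%E.
  by apply: eq_integral => th /set_mem Dth /=; rewrite ger0_norm ?u0.
rewrite IntE; split=> [/integrableP[_]|oo]; first by rewrite /= e.
by apply/integrableP; split; [exact/measurable_EFinP|rewrite /= e].
Qed.

Lemma aeD_and (P Q : R -> Prop) : aeD P -> aeD Q -> aeD (fun th => P th /\ Q th).
Proof. by rewrite !aeDE; apply: filterS2 => th p q Dth; split; [exact: p|exact: q]. Qed.

Lemma aeDW (P Q : R -> Prop) : (forall th, D th -> P th -> Q th) -> aeD P -> aeD Q.
Proof. by move=> PQ; rewrite !aeDE; apply: filterS => th p Dth; exact: PQ (p Dth). Qed.

Lemma aeD_all (P : R -> Prop) : (forall th, D th -> P th) -> aeD P.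
Proof. by move=> h; rewrite aeDE; apply: nearW. Qed.

Lemma ae_eq_intg u v : measurable_fun D u -> measurable_fun D v ->
  aeD (fun th => u th = v th) -> intg u = intg v.
Proof.
move=> mu_ mv uv; rewrite !intgE; congr fine; apply: ae_eq_integral.
- exact: measurable_D.
- exact/measurable_EFinP.
- exact/measurable_EFinP.
- by move: uv; rewrite !aeDE; apply: filterS => th h Dth; rewrite h.
Qed.

Lemma ae_Int u v : measurable_fun D v ->
  aeD (fun th => u th = v th) -> Int u -> Int v.
Proof.
move=> mv uv iu; have mu_ := Int_meas iu.
move: iu; rewrite !IntE => iu; apply/integrableP; split; first exact/measurable_EFinP.
rewrite (_ : (\int[mu]_(x in D) _ = \int[mu]_(x in D) (`|u x|)%:E)%E).
  by move/integrableP : iu => [].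
apply: ge0_ae_eq_integral => //.
- exact: measurable_D.
- by apply/measurable_EFinP; apply: measurableT_comp.
- by apply/measurable_EFinP; apply: measurableT_comp.
- by move: uv; rewrite !aeDE; apply: filterS => th h Dth /=; rewrite h.
Qed.

Lemma intg_eq0 u : Int u -> (forall th, D th -> 0 <= u th) -> intg u = 0 ->
  aeD (fun th => u th = 0).
Proof.
move=> iu u0 e.
have : (\int[mu]_(th in D) `|(u th)%:E| = 0)%E.
  rewrite (_ : 0%E = (intg u)%:E); last by rewrite e.
  rewrite -intg_EFin//; apply: eq_integral => th /set_mem Dth /=.
  by rewrite ger0_norm ?u0.
move/ae_eq_integral_abs => -/(_ measurable_D) h.
have /h : measurable_fun D (fun th => (u th)%:E).
  by apply/measurable_EFinP; exact: Int_meas.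
by rewrite aeDE; apply: filterS => th + Dth => -/(_ Dth) [].
Qed.

(** The minimum of [|u|] and [|v|] is dominated by [|v|] everywhere and agrees with [|u|] almost
    everywhere; this reduces the a.e. bound to the pointwise comparison [Int_le]. *)
Lemma ae_Int_le (u v : R -> R) : measurable_fun D u -> Int v ->
  aeD (fun th => `|u th| <= v th) -> Int u.
Proof.
move=> mu_ iv h; have mv := Int_meas iv.
have iw : Int (fun th => Num.min `|u th| `|v th|).
  apply: Int_le (Int_abs iv) _.
    by apply: measurable_minr; apply: measurableT_comp.
  by move=> th _; rewrite ger0_norm ?le_min ?normr_ge0// ge_min lexx orbT.
have ia : Int (fun th => `|u th|).
  apply: ae_Int iw; first exact: measurableT_comp.
  by apply: aeDW h => th _ h; apply/min_idPl; rewrite (le_trans h)// ler_norm.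
by apply: Int_le ia _.
Qed.

Lemma ae_intg_dominated (u_ : nat -> R -> R) u g :
  (forall n, measurable_fun D (u_ n)) -> measurable_fun D u ->
  aeD (fun th => u_ n th @[n --> \oo] --> u th) -> Int g ->
  aeD (fun th => forall n, `|u_ n th| <= g th) ->
  [/\ Int u, intg (fun th => `|u_ n th - u th|) @[n --> \oo] --> 0 &
      intg (u_ n) @[n --> \oo] --> intg u].
Proof.
move=> mu_ mlim cvu ig dom.
have mu_E n : measurable_fun D (EFin \o u_ n) by exact/measurable_EFinP.
have muE : measurable_fun D (EFin \o u) by exact/measurable_EFinP.
have cvuE : {ae mu, forall th, D th -> (EFin \o u_ n) th @[n --> \oo] --> (EFin \o u) th}.
  move: cvu; rewrite !aeDE; apply: filterS => th h Dth.
  by apply: (@cvg_EFin _ _ \oo); [exact: nearW|exact: (h Dth)].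
have domE : {ae mu, forall th n, D th -> (`|(EFin \o u_ n) th| <= (EFin \o g) th)%E}.
  by move: dom; rewrite aeDE; apply: filterS => th h n Dth /=; rewrite lee_fin; exact: h.
have ig' := ig; rewrite IntE in ig'.
have [iu c0 c1] := dominated_convergence measurable_D mu_E muE cvuE ig' domE.
move: iu; rewrite -IntE => iu.
have iun n : Int (u_ n) by apply: ae_Int_le ig _ => //; apply: aeDW dom.
split => //.
- have /fine_cvgP[_] : (intg (fun th => `|u_ n th - u th|))%:E @[n --> \oo] --> 0%:E.
    apply: cvg_trans c0; apply: near_eq_cvg; apply: nearW => n.
    rewrite -intg_EFin//; apply: Int_abs; exact: IntB.
  exact.
- have /fine_cvgP[_] : (intg (u_ n))%:E @[n --> \oo] --> (intg u)%:E.
    rewrite -intg_EFin//.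
    apply: cvg_trans c1; apply: near_eq_cvg; apply: nearW => n.
    by rewrite -intg_EFin.
  exact.
Qed.

Lemma intg_dominated (u_ : nat -> R -> R) u g :
  (forall n, measurable_fun D (u_ n)) -> measurable_fun D u ->
  aeD (fun th => u_ n th @[n --> \oo] --> u th) -> Int g ->
  (forall n th, D th -> `|u_ n th| <= g th) ->
  [/\ Int u, intg (fun th => `|u_ n th - u th|) @[n --> \oo] --> 0 &
      intg (u_ n) @[n --> \oo] --> intg u].
Proof.
move=> mu_ mlim cvu ig dom; apply: (ae_intg_dominated mu_ mlim cvu ig).
by apply: aeD_all => th Dth n; exact: dom.
Qed.

(** The lift to angles of the inversion of the circle, through which [tilde] and [Jop] act. *)
Definition refl (th : R) : R := 2 * pi - th.

Lemma reflK : involutive refl.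
Proof. by move=> th; rewrite /refl opprB addrC subrK. Qed.

Lemma refl_D th : D th -> D (refl th).
Proof. by rewrite /I02 /= /refl !in_itv /= => /andP[? ?]; apply/andP; split; lra. Qed.

Lemma measurable_refl : measurable_fun setT refl.
Proof.
by apply: measurable_funB => //; exact: measurable_cst.
Qed.

Lemma preimage_refl_D : refl @^-1` D = D.
Proof.
apply/seteqP; split => th /=; last exact: refl_D.
by move/refl_D; rewrite reflK.
Qed.

(** Lebesgue measure is determined by its values on intervals, and the preimage of []a, b]] is [[2
    pi - b, 2 pi - a[], of the same length. *)
Lemma pushforward_refl (A : set (measurableTypeR R)) : measurable A ->
  pushforward mu (refl : measurableTypeR R -> measurableTypeR R) A = mu A.
Proof.
move=> mA; apply/esym.
have mr : measurable_fun setT (refl : measurableTypeR R -> measurableTypeR R).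
  exact: measurable_refl.
pose f : {mfun measurableTypeR R >-> measurableTypeR R} :=
  HB.pack (refl : measurableTypeR R -> measurableTypeR R)
    (isMeasurableFun.Build _ _ _ _ _ mr).
change (mu A = pushforward mu f A).
apply: lebesgue_measure_unique => // X [[a b] _ <-] /=.
rewrite /pushforward.
rewrite (_ : _ @^-1` _ = `[2 * pi - b, 2 * pi - a[%classic); last first.
  apply/seteqP; split => x /=; rewrite /f /= /refl !in_itv /= => /andP[? ?];
  by apply/andP; split; lra.
rewrite !lebesgue_measure_itv /= !lte_fin.
rewrite (_ : (2 * pi - b < 2 * pi - a) = (a < b)); last by rewrite ltrD2l ltrN2.
by case: ifP => // _; rewrite -!EFinD; congr EFin; lra.
Qed.

Lemma meas_refl u : measurable_fun D u -> measurable_fun D (fun th => u (refl th)).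
Proof.
move=> mu_; apply: (@measurable_comp _ _ _ _ _ _ D) mu_ _ => //.
- exact: measurable_D.
- by move=> _ [th Dth <-]; exact: refl_D.
- by apply: measurable_funS measurable_refl.
Qed.

Lemma ge0_integral_refl (f : R -> \bar R) : measurable_fun D f ->
  (forall th, D th -> 0 <= f th)%E ->
  (\int[mu]_(th in D) f (refl th) = \int[mu]_(th in D) f th)%E.
Proof.
move=> mf f0.
have mr : measurable_fun setT (refl : measurableTypeR R -> measurableTypeR R).
  exact: measurable_refl.
have := @ge0_integral_pushforward _ _ _ _ _ (refl : measurableTypeR R -> measurableTypeR R)
  mr mu D f measurable_D mf.
rewrite preimage_refl_D => <-; last by move=> th /set_mem; exact: f0.
by apply: eq_measure_integral => A mA AD; exact: pushforward_refl.
Qed.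

Lemma Int_refl u : Int u -> Int (fun th => u (refl th)).
Proof.
move=> iu; rewrite IntE; apply/integrableP; split.
  by apply/measurable_EFinP; apply: meas_refl; exact: Int_meas.
rewrite /= (@ge0_integral_refl (fun th => `|u th|%:E)); first by move: iu; rewrite IntE => /integrableP[].
  by apply/measurable_EFinP; apply: measurableT_comp => //; exact: Int_meas.
by move=> th _; rewrite lee_fin.
Qed.

(** The change of variables is at hand for nonnegative integrands, so [u] is split as [|u|] minus
    [|u| - u]. *)
Lemma intg_refl u : Int u -> intg (fun th => u (refl th)) = intg u.
Proof.
move=> iu.
have h v : Int v -> (forall th, 0 <= v th) -> intg (fun th => v (refl th)) = intg v.
  move=> iv v0; rewrite !intgE /Rintegral; congr fine.
  apply: (@ge0_integral_refl (EFin \o v)); last by move=> th _; rewrite /= lee_fin.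
  by move: iv; rewrite IntE; exact: measurable_int.
pose v th := `|u th|; pose w th := `|u th| - u th.
have iv : Int v by exact: Int_abs.
have iw : Int w by exact: IntB.
rewrite (@eq_intg (fun th => u (refl th)) (fun th => v (refl th) - w (refl th))).
  rewrite intgB; [|exact: Int_refl|exact: Int_refl].
  have v0 th : 0 <= v th by rewrite /v.
  have w0 th : 0 <= w th by rewrite /w subr_ge0 ler_norm.
  rewrite (h _ iv v0) (h _ iw w0) -intgB//.
  by apply: eq_intg => th _; rewrite /v /w opprB addrC subrK.
by move=> th _; rewrite /v /w opprB addrC subrK.
Qed.

Lemma aeD_refl (P : R -> Prop) : aeD P -> aeD (fun th => P (refl th)).
Proof.
rewrite !aeDE => -[N [mN N0 sub]].
have mr : measurable_fun setT (refl : measurableTypeR R -> measurableTypeR R).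
  exact: measurable_refl.
exists (refl @^-1` N); split.
- by rewrite -[X in measurable X]setTI; apply: mr.
- by rewrite -N0; exact: (pushforward_refl mN).
- by move=> th /= h; apply: sub => /= h'; apply: h => Dth; apply: h'; exact: refl_D.
Qed.

End integrals.

(** * Functions on the circle: moduli, a.e. equality, measurability, [L^p] classes *)

HB.lock Definition measC {R : realType} (f : fn R) : Prop := cmeas f.
HB.lock Definition LL {R : realType} (p : R) (f : fn R) : Prop := Lp p f.

Section circle.
Context {R : realType}.
Local Notation mu := (@lebesgue_measure R).
Local Notation D := (@I02 R).
Local Notation C := R[i].
Implicit Types f g h : fn R.

Lemma cmodE (z : C) : (cmod z)%:C%C = `|z|.
Proof. by rewrite normc_def. Qed.

Lemma cmod_ge0 (z : C) : 0 <= cmod z.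
Proof. exact: sqrtr_ge0. Qed.

Lemma cmod_eq0 (z : C) : (cmod z == 0) = (z == 0).
Proof. by rewrite -(inj_eq (@complexI R)) cmodE normr_eq0. Qed.

Lemma cmod0 : cmod (0 : C) = 0.
Proof. by apply/eqP; rewrite cmod_eq0. Qed.

Lemma cmodM (z w : C) : cmod (z * w) = cmod z * cmod w.
Proof. by apply: complexI; rewrite rmorphM /= !cmodE normrM. Qed.

Lemma cmodN (z : C) : cmod (- z) = cmod z.
Proof. by apply: complexI; rewrite !cmodE normrN. Qed.

Lemma cmod1 : cmod (1 : C) = 1.
Proof. by apply: complexI; rewrite !cmodE normr1. Qed.

Lemma cmodV (z : C) : cmod z^-1 = (cmod z)^-1.
Proof. by apply: complexI; rewrite fmorphV /= !cmodE normfV. Qed.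

Lemma cmodX (z : C) n : cmod (z ^+ n) = cmod z ^+ n.
Proof. by apply: complexI; rewrite rmorphXn /= !cmodE normrX. Qed.

Lemma cmodD (z w : C) : cmod (z + w) <= cmod z + cmod w.
Proof. by rewrite -lecR rmorphD /= !cmodE ler_normD. Qed.

Lemma cmodB (z w : C) : cmod (z - w) <= cmod z + cmod w.
Proof. by rewrite (le_trans (cmodD _ _))// cmodN. Qed.

Lemma cmod_real (x : R) : cmod x%:C%C = `|x|.
Proof. by rewrite /cmod /= expr0n /= addr0 sqrtr_sqr. Qed.

Lemma cmod_conj (z : C) : cmod (conjc z) = cmod z.
Proof. by apply: complexI; rewrite !cmodE normcJ. Qed.

Lemma cmod_sum (I : Type) (s : seq I) (z : I -> C) :
  cmod (\sum_(i <- s) z i) <= \sum_(i <- s) cmod (z i).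
Proof.
elim/big_ind2 : _ => //; first by rewrite cmod0.
by move=> z1 x1 z2 x2 h1 h2; rewrite (le_trans (cmodD _ _))// lerD.
Qed.

Lemma sqr_cmod (z : C) : cmod z ^+ 2 = complex.Re z ^+ 2 + complex.Im z ^+ 2.
Proof. by rewrite sqr_sqrtr// addr_ge0// sqr_ge0. Qed.

Lemma Re_cmod (z : C) : `|complex.Re z| <= cmod z.
Proof. by rewrite -sqrtr_sqr ler_wsqrtr// lerDl sqr_ge0. Qed.

Lemma Im_cmod (z : C) : `|complex.Im z| <= cmod z.
Proof. by rewrite -sqrtr_sqr ler_wsqrtr// lerDr sqr_ge0. Qed.

Lemma cmod_ReIm (z : C) : cmod z <= `|complex.Re z| + `|complex.Im z|.
Proof.
rewrite -[leRHS]ger0_norm ?addr_ge0// -sqrtr_sqr ler_wsqrtr//.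
rewrite sqrrD !real_normK ?num_real// -addrA lerD2l lerDr.
by rewrite mulrn_wge0// mulr_ge0.
Qed.

Lemma cReD (z w : C) : @complex.Re R (z + w) = @complex.Re R z + @complex.Re R w.
Proof. by case: z; case: w. Qed.
Lemma cImD (z w : C) : @complex.Im R (z + w) = @complex.Im R z + @complex.Im R w.
Proof. by case: z; case: w. Qed.
Lemma cReM (z w : C) : @complex.Re R (z * w) =
  @complex.Re R z * @complex.Re R w - @complex.Im R z * @complex.Im R w.
Proof. by case: z; case: w. Qed.
Lemma cImM (z w : C) : @complex.Im R (z * w) =
  @complex.Re R z * @complex.Im R w + @complex.Im R z * @complex.Re R w.
Proof. by case: z; case: w. Qed.
Lemma cReN (z : C) : @complex.Re R (- z) = - @complex.Re R z.
Proof. by case: z. Qed.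
Lemma cImN (z : C) : @complex.Im R (- z) = - @complex.Im R z.
Proof. by case: z. Qed.

Lemma complex_eq (z w : C) : complex.Re z = complex.Re w ->
  complex.Im z = complex.Im w -> z = w.
Proof. by case: z => a b; case: w => c d /= -> ->. Qed.

Lemma cmod_circ (th : R) : cmod (circ th) = 1.
Proof. by rewrite /cmod /= cos2Dsin2 sqrtr1. Qed.

Lemma circ_neq0 (th : R) : circ th != 0.
Proof. by rewrite -cmod_eq0 cmod_circ oner_eq0. Qed.

Lemma circD (x y : R) : circ (x + y) = circ x * circ y.
Proof. by apply: complex_eq; rewrite /= ?cosD ?sinD//; ring. Qed.

Lemma circ0 : circ 0 = 1 :> C.
Proof. by rewrite /circ cos0 sin0. Qed.

Lemma circN (x : R) : circ (- x) = (circ x)^-1.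
Proof.
by apply: (mulIf (circ_neq0 x)); rewrite mulVf ?circ_neq0// -circD addNr circ0.
Qed.

Lemma conj_circ (x : R) : conjc (circ x) = (circ x)^-1.
Proof. by rewrite -circN /circ cosN sinN. Qed.

Lemma circ_refl (x : R) : circ (refl x) = (circ x)^-1.
Proof.
rewrite /refl circD circN (_ : circ (2 * pi) = 1) ?mul1r//.
by rewrite /circ mulr_natl cos2pi sin2pi.
Qed.

Lemma circX (x : R) n : circ x ^+ n = circ (n%:R * x).
Proof.
elim: n => [|n IH]; first by rewrite mul0r circ0.
by rewrite exprS IH -circD; congr circ; rewrite -natr1; ring.
Qed.

Lemma circXz (x : R) (n : int) : circ x ^ n = circ (n%:~R * x).
Proof.
case: n => n; first exact: circX.
by rewrite NegzE -exprnN circX -circN; congr circ; rewrite mulrNz mulNr.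
Qed.

Lemma cmod_circXz (x : R) (n : int) : cmod (circ x ^ n) = 1.
Proof. by rewrite circXz cmod_circ. Qed.

Definition AE (P : C -> Prop) : Prop := aeD (fun th => P (circ th)).

(** The implication may assume [z != 0], which holds on the whole circle and which identities with
    negative powers of [z] require. *)
Lemma AEW (P Q : C -> Prop) : (forall z, z != 0 -> P z -> Q z) -> AE P -> AE Q.
Proof. by move=> PQ; apply: aeDW => th _; exact: PQ (circ_neq0 th). Qed.

Lemma AE_and (P Q : C -> Prop) : AE P -> AE Q -> AE (fun z => P z /\ Q z).
Proof. exact: aeD_and. Qed.

Lemma AE_all (P : C -> Prop) : (forall z, z != 0 -> P z) -> AE P.
Proof. by move=> h; apply: aeD_all => th _; exact: h (circ_neq0 th). Qed.

Lemma AE_inv (P : C -> Prop) : AE P -> AE (fun z => P z^-1).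
Proof. by move=> /aeD_refl; apply: aeDW => th _; rewrite circ_refl. Qed.

Lemma aeeqP f g : aeeq f g <-> AE (fun z => f z = g z).
Proof.
rewrite /aeeq /AE aeDE.
rewrite (_ : [set th | _ /\ _] = ~` [set th | D th -> f (circ th) = g (circ th)])//.
by apply/seteqP; split => th /=; [case=> ? h /(_ _)/h; exact|move=> /not_implyP].
Qed.

Lemma aeeq_refl f : aeeq f f.
Proof. by apply/aeeqP; exact: AE_all. Qed.

Lemma aeeq_sym f g : aeeq f g -> aeeq g f.
Proof. by move=> /aeeqP h; apply/aeeqP; apply: AEW h => z _ ->. Qed.

Lemma aeeq_trans f g h : aeeq f g -> aeeq g h -> aeeq f h.
Proof.
move=> /aeeqP h1 /aeeqP h2; apply/aeeqP.
by apply: AEW (AE_and h1 h2) => z _ [-> ->].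
Qed.

Lemma measCE f : measC f = cmeas f.
Proof. by rewrite measC.unlock. Qed.

Lemma LLE p f : LL p f = Lp p f.
Proof. by rewrite LL.unlock. Qed.

Lemma measC_add f g : measC f -> measC g -> measC (fadd f g).
Proof.
rewrite !measCE => -[f1 f2] [g1 g2]; split; rewrite /fadd.
  rewrite (_ : (fun th => _) = (fun th => complex.Re (f (circ th))) \+
    (fun th => complex.Re (g (circ th)))); first exact: measurable_funD.
  by apply/funext => th /=; rewrite cReD.
rewrite (_ : (fun th => _) = (fun th => complex.Im (f (circ th))) \+
  (fun th => complex.Im (g (circ th)))); first exact: measurable_funD.
by apply/funext => th /=; rewrite cImD.
Qed.

Lemma measC_mul f g : measC f -> measC g -> measC (fmul f g).
Proof.
rewrite !measCE => -[f1 f2] [g1 g2]; split; rewrite /fmul.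
  rewrite (_ : (fun th => _) = ((fun th => complex.Re (f (circ th))) \*
    (fun th => complex.Re (g (circ th)))) \- ((fun th => complex.Im (f (circ th))) \*
    (fun th => complex.Im (g (circ th))))).
    by apply: measurable_funB; apply: measurable_funM.
  by apply/funext => th /=; rewrite cReM.
rewrite (_ : (fun th => _) = ((fun th => complex.Re (f (circ th))) \*
  (fun th => complex.Im (g (circ th)))) \+ ((fun th => complex.Im (f (circ th))) \*
  (fun th => complex.Re (g (circ th))))).
  by apply: measurable_funD; apply: measurable_funM.
by apply/funext => th /=; rewrite cImM.
Qed.

Lemma measC_cst (k : C) : measC (fcst k).
Proof. by rewrite measCE; split; exact: measurable_cst. Qed.

Lemma measC_tpow (n : int) : measC (@tpow R n).
Proof.
rewrite measCE; split; rewrite /tpow; apply: measurable_funTS; apply: continuous_measurable_fun.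
  rewrite (_ : (fun th => _) = (fun th => cos (n%:~R * th))).
    move=> x; apply: (@continuous_comp R R R (fun y : R => n%:~R * y) (@cos R)).
      by apply: cvgM; [exact: cvg_cst|exact: cvg_id].
    exact: continuous_cos.
  by apply/funext => th; rewrite circXz.
rewrite (_ : (fun th => _) = (fun th => sin (n%:~R * th))).
  move=> x; apply: (@continuous_comp R R R (fun y : R => n%:~R * y) (@sin R)).
    by apply: cvgM; [exact: cvg_cst|exact: cvg_id].
  exact: continuous_sin.
by apply/funext => th; rewrite circXz.
Qed.

Lemma measC_eq f g : (forall th, f (circ th) = g (circ th)) -> measC f -> measC g.
Proof.
by rewrite !measCE => fg [f1 f2]; split; [move: f1|move: f2];
  congr (measurable_fun _ _); apply/funext => th; rewrite fg.
Qed.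

Lemma measC_scal k f : measC f -> measC (fscal k f).
Proof. by move=> mf; exact: (measC_mul (measC_cst k) mf). Qed.

Lemma measC_minus f g : measC f -> measC g -> measC (fminus f g).
Proof.
move=> mf mg; apply: (measC_eq _ (measC_add mf (measC_scal (-1) mg))) => th.
by rewrite /fadd /fminus /fscal mulN1r.
Qed.

Lemma measC_tilde f : measC f -> measC (tilde f).
Proof.
rewrite !measCE => -[f1 f2]; split; [move/meas_refl: f1|move/meas_refl: f2];
  by congr (measurable_fun _ _); apply/funext => th; rewrite circ_refl.
Qed.

Lemma meas_cmod f : measC f -> measurable_fun D (fun th => cmod (f (circ th))).
Proof.
rewrite measCE => -[f1 f2]; apply: (@measurableT_comp _ _ _ _ _ _ (@Num.sqrt R)).
  by apply: continuous_measurable_fun; exact: sqrt_continuous.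
apply: measurable_funD; exact: measurable_funX.
Qed.

Lemma meas_pow p (u : R -> R) : measurable_fun D u ->
  measurable_fun D (fun th => u th `^ p).
Proof. by move=> h; apply: (measurableT_comp (measurable_powR p) h). Qed.

Lemma meas_powcmod p f : measC f -> measurable_fun D (fun th => cmod (f (circ th)) `^ p).
Proof. by move=> mf; apply: meas_pow; exact: meas_cmod. Qed.

Lemma measC_frecip f : measC f -> measC (frecip f).
Proof.
move=> mf; have := mf; rewrite measCE => -[f1 f2].
have m2 := meas_powcmod (-2) mf.
(* The reciprocal becomes a product of measurable factors. The formula also covers the zeros of [f],
   where both sides are 0 because [0^-1 = 0]. *)
have e th : (f (circ th))^-1 = conjc (f (circ th)) * ((cmod (f (circ th)) `^ (-2))%:C)%C.
  have [->|nz] := eqVneq (f (circ th)) 0; first by rewrite invr0 conjc0 mul0r.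
  rewrite invc_norm -cmodE mulrC; congr (_ * _).
  rewrite powRN (powR_mulrn 2) ?cmod_ge0//.
  by rewrite fmorphV rmorphXn.
rewrite measCE; split; rewrite /frecip.
  rewrite (_ : (fun th => _) = (fun th => complex.Re (f (circ th))) \*
     (fun th => cmod (f (circ th)) `^ (-2))); first exact: measurable_funM.
  by apply/funext => th /=; rewrite e; case: (f _) => a b /=; rewrite mulr0 subr0.
rewrite (_ : (fun th => _) = (fun th => - complex.Im (f (circ th))) \*
   (fun th => cmod (f (circ th)) `^ (-2))).
  apply: measurable_funM => //; exact: measurable_funN.
by apply/funext => th /=; rewrite e; case: (f _) => a b /=; rewrite mulr0 add0r.
Qed.

Lemma LpP p f : LL p f <-> measC f /\ Int (fun th => cmod (f (circ th)) `^ p).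
Proof.
rewrite LLE /Lp -measCE; split=> -[mf h]; split=> //.
  apply/Int_ge0P => //; first exact: meas_powcmod.
  by move=> th _; exact: powR_ge0.
apply/Int_ge0P => //; first exact: meas_powcmod.
by move=> th _; exact: powR_ge0.
Qed.

Lemma Lp1P f : LL 1 f <-> Int (fun th => complex.Re (f (circ th))) /\
  Int (fun th => complex.Im (f (circ th))).
Proof.
split=> [/LpP[mf h]|[h1 h2]].
  have h' : Int (fun th => cmod (f (circ th))).
    by apply: eq_Int h => th _; rewrite powRr1// cmod_ge0.
  move: mf; rewrite measCE => -[m1 m2]; split; apply: Int_le h' _ => // th _.
    exact: Re_cmod.
  exact: Im_cmod.
have mf : measC f by rewrite measCE; split; exact: Int_meas.
apply/LpP; split => //.
apply: Int_le (IntD (Int_abs h1) (Int_abs h2)) _; first exact: meas_powcmod.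
by move=> th _; rewrite ger0_norm ?powR_ge0// powRr1 ?cmod_ge0// cmod_ReIm.
Qed.

Lemma L1_cmod f : LL 1 f -> Int (fun th => cmod (f (circ th))).
Proof. by move=> /LpP[_]; apply: eq_Int => th _; rewrite powRr1// cmod_ge0. Qed.

Lemma cmod_L1 f : measC f -> Int (fun th => cmod (f (circ th))) -> LL 1 f.
Proof.
by move=> mf h; apply/LpP; split=> //; apply: eq_Int h => th _; rewrite powRr1// cmod_ge0.
Qed.

Lemma powR_leD1 (p x : R) : 1 <= p -> 0 <= x -> x <= 1 + x `^ p.
Proof.
move=> p1 x0; have [x1|x1] := leP x 1.
  by rewrite (le_trans x1)// lerDl powR_ge0.
rewrite (@le_trans _ _ (x `^ p))//; last by rewrite lerDr.
by rewrite -{1}(powRr1 x0) ler_powR// ltW.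
Qed.

Lemma Lp_Lp1 p f : 1 <= p -> LL p f -> LL 1 f.
Proof.
move=> p1 /LpP[mf h]; apply: cmod_L1 => //.
apply: Int_le (IntD (Int_cst 1) h) _; first exact: meas_cmod.
by move=> th _; rewrite ger0_norm ?cmod_ge0// powR_leD1// cmod_ge0.
Qed.

(** The sum is at most twice the larger number. This crude substitute for the triangle inequality is
    enough for membership in [L^p] and for smallness. *)
Lemma powR_addle (p x y : R) : 0 <= p -> 0 <= x -> 0 <= y ->
  (x + y) `^ p <= 2 `^ p * (x `^ p + y `^ p).
Proof.
move=> p0 x0 y0; wlog xy : x y x0 y0 / x <= y.
  move=> H; have [xy|yx] := leP x y; first exact: H.
  by rewrite addrC [_ `^ _ + _]addrC; apply: H => //; exact: ltW.
apply: (@le_trans _ _ ((2 * y) `^ p)).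
  rewrite ge0_ler_powR ?nnegrE ?addr_ge0 ?mulr_ge0//.
  by rewrite mulr_natl mulr2n lerD2r.
by rewrite powRM// ler_wpM2l ?powR_ge0// lerDr powR_ge0.
Qed.

Lemma Lp_add p f g : 0 <= p -> LL p f -> LL p g -> LL p (fadd f g).
Proof.
move=> p0 /LpP[mf hf] /LpP[mg hg]; have m := measC_add mf mg.
apply/LpP; split=> //; apply: Int_le (IntZ (2 `^ p) (IntD hf hg)) _.
  exact: meas_powcmod.
move=> th _; rewrite ger0_norm ?powR_ge0//.
apply: le_trans (powR_addle _ _ _); rewrite ?cmod_ge0//.
by rewrite ge0_ler_powR ?nnegrE ?addr_ge0 ?cmod_ge0// cmodD.
Qed.

Lemma Lp_scal p k f : LL p f -> LL p (fscal k f).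
Proof.
move=> /LpP[mf hf]; apply/LpP; split; first exact: measC_scal.
apply: eq_Int (IntZ (cmod k `^ p) hf) => th _.
by rewrite /fscal cmodM powRM// cmod_ge0.
Qed.

Lemma Lp_minus p f g : 0 <= p -> LL p f -> LL p g -> LL p (fminus f g).
Proof.
move=> p0 hf hg; rewrite (_ : fminus f g = fadd f (fscal (-1) g)).
  by apply: Lp_add => //; exact: Lp_scal.
by apply/funext => z; rewrite /fadd /fscal /fminus mulN1r.
Qed.

Lemma Linf_cmod f M : measC f -> AE (fun z => cmod (f z) <= M) -> Linf f.
Proof.
rewrite measCE => mf; rewrite /AE aeDE => h; split=> //; exists M.
rewrite (_ : [set _ | _] = ~` [set th | D th -> cmod (f (circ th)) <= M]); first by [].
apply/seteqP; split => th /=; first by case=> Dth lt /(_ Dth); rewrite leNgt lt.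
by move=> /not_implyP[? /negP]; rewrite -ltNge.
Qed.

Lemma Linf_bound f : Linf f -> exists2 M, 0 <= M & AE (fun z => cmod (f z) <= M).
Proof.
move=> [mf [M h]]; exists `|M| => //.
apply: (@AEW (fun z => cmod (f z) <= M)).
  by move=> z _ /le_trans; apply; exact: ler_norm.
rewrite /AE aeDE.
move: h; rewrite (_ : [set _ | _] = ~` [set th | D th -> cmod (f (circ th)) <= M]); first by [].
apply/seteqP; split => th /=; first by case=> Dth lt /(_ Dth); rewrite leNgt lt.
by move=> /not_implyP[? /negP]; rewrite -ltNge.
Qed.

Lemma Lp_mulinf p f g : 0 <= p -> Linf f -> LL p g -> LL p (fmul f g).
Proof.
move=> p0 hf /LpP[mg hg]; have [M M0 hM] := Linf_bound hf; case: hf; rewrite -measCE => mf _.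
have m := measC_mul mf mg.
apply/LpP; split=> //; apply: (ae_Int_le _ (IntZ (M `^ p) hg)).
  exact: meas_powcmod.
apply: aeDW hM => th _ hM; rewrite ger0_norm ?powR_ge0// /fmul cmodM powRM ?cmod_ge0//.
by rewrite ler_wpM2r ?powR_ge0// ge0_ler_powR ?nnegrE ?cmod_ge0.
Qed.

Lemma aeeq_Lp p f g : measC g -> aeeq f g -> LL p f -> LL p g.
Proof.
move=> mg /aeeqP e /LpP[mf hf]; apply/LpP; split=> //.
by apply: ae_Int hf; [exact: meas_powcmod|apply: aeDW e => th _ ->].
Qed.

Lemma Linf_tpow n : Linf (@tpow R n).
Proof.
apply: (@Linf_cmod _ 1); first exact: measC_tpow.
by apply: aeD_all => th _; rewrite cmod_circXz.
Qed.

Lemma Linf_mul f g : Linf f -> Linf g -> Linf (fmul f g).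
Proof.
move=> hf hg; have [M M0 hM] := Linf_bound hf; have [N N0 hN] := Linf_bound hg.
apply: (@Linf_cmod _ (M * N)); first by apply: measC_mul; rewrite measCE; [case: hf|case: hg].
apply: AEW (AE_and hM hN) => z _ [h1 h2].
by rewrite cmodM ler_pM// cmod_ge0.
Qed.

Lemma Linf_tilde f : Linf f -> Linf (tilde f).
Proof.
move=> hf; have [M M0 hM] := Linf_bound hf.
apply: (@Linf_cmod _ M); first by apply: measC_tilde; rewrite measCE; case: hf.
exact: (AE_inv hM).
Qed.

Lemma Linf_aeeq f g : measC g -> aeeq f g -> Linf f -> Linf g.
Proof.
move=> mg /aeeqP e hf; have [M M0 hM] := Linf_bound hf.
by apply: (@Linf_cmod _ M) => //; apply: AEW (AE_and hM e) => z _ [+ <-].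
Qed.

Lemma Lp_tilde p f : LL p f -> LL p (tilde f).
Proof.
move=> /LpP[mf hf]; apply/LpP; split; first exact: measC_tilde.
by apply: eq_Int (Int_refl hf) => th _; rewrite circ_refl.
Qed.

Lemma JopE f : Jop f = fmul (tpow (-1)) (tilde f).
Proof. by apply/funext => z; rewrite /Jop /fmul /tpow exprN1. Qed.

Lemma Lp_J p f : 0 <= p -> LL p f -> LL p (Jop f).
Proof.
move=> p0 hf; rewrite JopE; apply: Lp_mulinf => //; first exact: Linf_tpow.
exact: Lp_tilde.
Qed.

Lemma Linf_Lp p f : 0 <= p -> Linf f -> LL p f.
Proof.
move=> p0 hf; rewrite (_ : f = fmul f (fcst 1)).
  apply: Lp_mulinf => //; apply/LpP; split; first exact: measC_cst.
  by apply: eq_Int (Int_cst (cmod (1 : C) `^ p)).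
by apply/funext => z; rewrite /fmul /fcst mulr1.
Qed.

End circle.

(** * Means and Fourier coefficients *)

HB.lock Definition cmean {R : realType} (f : fn R) : R[i] :=
  (((2 * pi)^-1 * intg (fun th => complex.Re (f (circ th)))) +i*
   ((2 * pi)^-1 * intg (fun th => complex.Im (f (circ th)))))%C.

Definition coef {R : realType} (f : fn R) (n : int) : R[i] :=
  cmean (fmul f (tpow (- n))).

Section fourier.
Context {R : realType}.
Local Notation mu := (@lebesgue_measure R).
Local Notation D := (@I02 R).
Local Notation C := R[i].
Implicit Types f g h : fn R.

Lemma cmeanE f : cmean f =
  (((2 * pi)^-1 * intg (fun th => complex.Re (f (circ th)))) +i*
   ((2 * pi)^-1 * intg (fun th => complex.Im (f (circ th)))))%C.
Proof. by rewrite cmean.unlock. Qed.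

Lemma fcE f n : fc f n = coef f n.
Proof. by rewrite /coef cmeanE !intgE. Qed.

Lemma cmeanD f g : LL 1 f -> LL 1 g -> cmean (fadd f g) = cmean f + cmean g.
Proof.
move=> /Lp1P[f1 f2] /Lp1P[g1 g2]; rewrite !cmeanE; apply: complex_eq => /=.
  rewrite -mulrDr -intgD//; congr (_ * _); apply: eq_intg => th _.
  by rewrite /fadd cReD.
rewrite -mulrDr -intgD//; congr (_ * _); apply: eq_intg => th _.
by rewrite /fadd cImD.
Qed.

Lemma cmeanZ k f : LL 1 f -> cmean (fscal k f) = k * cmean f.
Proof.
move=> /Lp1P[f1 f2]; rewrite !cmeanE; apply: complex_eq.
  rewrite [RHS]cReM /= 2!(mulrCA _ (2 * pi)^-1) -mulrBr -(intgZ (complex.Re k) f1) -(intgZ (complex.Im k) f2) -intgB//; [|exact: IntZ..].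
  by congr (_ * _); apply: eq_intg => th _; rewrite /fscal cReM.
rewrite [RHS]cImM /= 2!(mulrCA _ (2 * pi)^-1) -mulrDr -(intgZ (complex.Re k) f2) -(intgZ (complex.Im k) f1) -intgD//; [|exact: IntZ..].
by congr (_ * _); apply: eq_intg => th _; rewrite /fscal cImM.
Qed.

Lemma cmean_aeeq f g : measC f -> measC g -> aeeq f g -> cmean f = cmean g.
Proof.
rewrite !measCE => -[f1 f2] [g1 g2] /aeeqP e.
rewrite !cmeanE; congr ((_ * _) +i* (_ * _))%C; apply: ae_eq_intg => //;
  by apply: aeDW e => th _ ->.
Qed.

Lemma cmean_eq f g : (forall th, f (circ th) = g (circ th)) -> cmean f = cmean g.
Proof.
by move=> fg; rewrite !cmeanE; congr ((_ * _) +i* (_ * _))%C;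
  apply: eq_intg => th _; rewrite fg.
Qed.

Lemma cmean_tilde f : LL 1 f -> cmean (tilde f) = cmean f.
Proof.
move=> /Lp1P[f1 f2]; rewrite !cmeanE -(intg_refl f1) -(intg_refl f2).
by congr ((_ * _) +i* (_ * _))%C; apply: eq_intg => th _; rewrite circ_refl.
Qed.

(** Real and imaginary parts are bounded separately, hence [pi^-1] in place of the sharp
    [(2 * pi)^-1]. The factor 2 reappears in several later constants. *)
Lemma cmean_norm f : LL 1 f ->
  cmod (cmean f) <= pi^-1 * intg (fun th => cmod (f (circ th))).
Proof.
move=> Lf; have ic := L1_cmod Lf; have /Lp1P[f1 f2] := Lf.
rewrite cmeanE; apply: le_trans (cmod_ReIm _) _ => /=.
have h u : Int u -> (forall th, `|u th| <= cmod (f (circ th))) ->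
    `|(2 * pi)^-1 * intg u| <= (2 * pi)^-1 * intg (fun th => cmod (f (circ th))).
  move=> iu uf; rewrite normrM gtr0_norm ?invr_gt0 ?pi2_gt0//.
  rewrite ler_pM2l ?invr_gt0 ?pi2_gt0// (le_trans (le_norm_intg iu))//.
  by apply: le_intg => //; exact: Int_abs.
apply: le_trans (lerD (h _ f1 _) (h _ f2 _)) _.
- by move=> th; exact: Re_cmod.
- by move=> th; exact: Im_cmod.
- rewrite -mulrDl ler_wpM2r//; first by apply: intg_ge0 => th _; exact: cmod_ge0.
  by rewrite -mulr2n -[_ *+ 2]mulr_natl invfM mulrA mulfV// mul1r.
Qed.

Lemma cmean_cst k : cmean (fcst k) = k :> C.
Proof.
rewrite cmeanE /fcst; case: k => a b; rewrite !intg_cst.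
by congr (_ +i* _)%C => /=; rewrite mulrC mulfK ?gt_eqF ?pi2_gt0.
Qed.

Lemma intg_FTC (F G : R -> R) : (forall x : R, is_derive x 1 F (G x)) ->
  continuous G -> intg G = F (2 * pi) - F 0.
Proof.
move=> dF cG; rewrite intgE /Rintegral.
have cF : continuous F.
  by move=> x; apply: differentiable_continuous; apply/derivable1_diffP; case: (dF x).
rewrite (@continuous_FTC2 _ G F 0 (2 * pi))//; first exact: pi2_gt0.
- exact: continuous_subspaceT.
- split.
  + by move=> x _; case: (dF x).
  + by apply: cvg_at_right_filter; exact: cF.
  + by apply: cvg_at_left_filter; exact: cF.
- by move=> x _; rewrite derive1E; case: (dF x).
Qed.

(** For [n != 0] the antiderivatives [sin (n x) / n] and [- cos (n x) / n] take equal values at 0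
    and [2 * pi]. *)
Lemma cmean_tpow (n : int) : cmean (@tpow R n) = (n == 0)%:R.
Proof.
have [->|n0] := eqVneq n 0.
  rewrite (_ : tpow 0 = fcst 1); first exact: cmean_cst.
  by apply/funext => z; rewrite /tpow expr0z.
have nR : (n%:~R : R) != 0 by rewrite intr_eq0.
have s2 : sin (n%:~R * (2 * pi)) = 0 :> R.
  have : circ (n%:~R * (2 * pi)) = 1 :> C.
    by rewrite -circXz {1}/circ mulr_natl cos2pi sin2pi exp1rz.
  by case.
have c2 : cos (n%:~R * (2 * pi)) = 1 :> R.
  have : circ (n%:~R * (2 * pi)) = 1 :> C.
    by rewrite -circXz {1}/circ mulr_natl cos2pi sin2pi exp1rz.
  by case.
have cl : continuous (fun x : R => n%:~R * x).
  by move=> x; apply: cvgM; [exact: cvg_cst|exact: cvg_id].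
have dl (x : R) : is_derive x 1 (fun x : R => n%:~R * x) n%:~R.
  by apply: is_derive_eq; rewrite /GRing.scale /= mulr1.
rewrite cmeanE.
rewrite (_ : intg (fun th => complex.Re (tpow n (circ th))) = 0); last first.
  rewrite (@eq_intg _ _ (fun th => cos (n%:~R * th))); last first.
    by move=> th _; rewrite /tpow circXz.
  have hd (x : R) : is_derive x 1 (fun x => n%:~R^-1 * sin (n%:~R * x)) (cos (n%:~R * x)).
    have h := @is_derive1_comp _ sin (fun x : R => n%:~R * x) x _ _ (is_derive_sin _) (dl x).
    apply: (is_derive_eq (is_deriveZ _ h)).
    by rewrite /GRing.scale /= mulrCA mulVf ?mulr1.
  rewrite (intg_FTC hd).
  - by rewrite s2 !mulr0 sin0 mulr0 subrr.
  - by move=> x; apply: (@continuous_comp R R R (fun y : R => n%:~R * y) (@cos R)); [exact: cl|exact: continuous_cos].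
rewrite (_ : intg (fun th => complex.Im (tpow n (circ th))) = 0); last first.
  rewrite (@eq_intg _ _ (fun th => sin (n%:~R * th))); last first.
    by move=> th _; rewrite /tpow circXz.
  have hd (x : R) : is_derive x 1 (fun x => - n%:~R^-1 * cos (n%:~R * x)) (sin (n%:~R * x)).
    have h := @is_derive1_comp _ cos (fun x : R => n%:~R * x) x _ _ (is_derive_cos _) (dl x).
    apply: (is_derive_eq (is_deriveZ _ h)).
    by rewrite /GRing.scale /=; field.
  rewrite (intg_FTC hd).
  - by rewrite c2 mulr0 cos0 subrr.
  - by move=> x; apply: (@continuous_comp R R R (fun y : R => n%:~R * y) (@sin R)); [exact: cl|exact: continuous_sin].
by rewrite mulr0.
Qed.

Lemma LL1_mul_tpow f n : LL 1 f -> LL 1 (fmul f (tpow n)).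
Proof.
move=> hf; rewrite (_ : fmul f (tpow n) = fmul (tpow n) f).
  by apply: Lp_mulinf => //; exact: Linf_tpow.
by apply/funext => z; rewrite /fmul mulrC.
Qed.

Lemma fcoefD f g n : LL 1 f -> LL 1 g -> coef (fadd f g) n = coef f n + coef g n.
Proof.
move=> hf hg; rewrite /coef -cmeanD; [|exact: LL1_mul_tpow..].
by congr cmean; apply/funext => z; rewrite /fadd /fmul mulrDl.
Qed.

Lemma fcoefZ k f n : LL 1 f -> coef (fscal k f) n = k * coef f n.
Proof.
move=> hf; rewrite /coef -cmeanZ; last exact: LL1_mul_tpow.
by congr cmean; apply/funext => z; rewrite /fscal /fmul mulrA.
Qed.

Lemma fcoefB f g n : LL 1 f -> LL 1 g -> coef (fminus f g) n = coef f n - coef g n.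
Proof.
move=> hf hg; rewrite (_ : fminus f g = fadd f (fscal (-1) g)).
  by rewrite fcoefD ?fcoefZ ?mulN1r//; exact: Lp_scal.
by apply/funext => z; rewrite /fadd /fscal /fminus mulN1r.
Qed.

Lemma coef_eq f g n : (forall th, f (circ th) = g (circ th)) -> coef f n = coef g n.
Proof. by move=> fg; apply: cmean_eq => th; rewrite /fmul fg. Qed.

Lemma coef_aeeq f g n : measC f -> measC g -> aeeq f g -> coef f n = coef g n.
Proof.
move=> mf mg /aeeqP e; apply: cmean_aeeq.
- by apply: measC_mul => //; exact: measC_tpow.
- by apply: measC_mul => //; exact: measC_tpow.
- by apply/aeeqP; apply: AEW e => z _; rewrite /fmul => ->.
Qed.

Lemma coef_shift k f n : coef (fmul (tpow k) f) n = coef f (n - k).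
Proof.
apply: cmean_eq => th; rewrite /fmul /tpow mulrAC mulrC; congr (_ * _).
by rewrite -expfzDr ?circ_neq0//; congr exprz; lia.
Qed.

Lemma coef_tilde f n : LL 1 f -> coef (tilde f) n = coef f (- n).
Proof.
move=> hf; rewrite /coef opprK -cmean_tilde; last first.
  by apply: LL1_mul_tpow; exact: Lp_tilde.
by apply: cmean_eq => th; rewrite /tilde /fmul /tpow invrK exprz_inv opprK.
Qed.

Lemma coef_J f n : LL 1 f -> coef (Jop f) n = coef f (-1 - n).
Proof.
by move=> hf; rewrite JopE coef_shift coef_tilde//; congr coef; lia.
Qed.

Lemma coef_tpow k n : coef (@tpow R k) n = (k == n)%:R.
Proof.
rewrite -subr_eq0 -cmean_tpow; apply: cmean_eq => th.
by rewrite /fmul /tpow -expfzDr ?circ_neq0.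
Qed.

Lemma coef_norm f n : LL 1 f ->
  cmod (coef f n) <= pi^-1 * intg (fun th => cmod (f (circ th))).
Proof.
move=> hf; rewrite /coef (le_trans (cmean_norm _))//; first exact: LL1_mul_tpow.
rewrite le_eqVlt; apply/orP; left; apply/eqP; congr (_ * _); apply: eq_intg => th _.
by rewrite /fmul cmodM cmod_circXz mulr1.
Qed.

End fourier.

(** * Trigonometric polynomials, as lists of pairs of a coefficient and an exponent *)

Definition tpoly {R : realType} (s : seq (R[i] * int)) : fn R :=
  fun z => \sum_(x <- s) x.1 * z ^ x.2.

Definition TP {R : realType} (f : fn R) : Prop :=
  exists s, forall th, f (circ th) = tpoly s (circ th).

Section trigpoly.
Context {R : realType}.
Local Notation mu := (@lebesgue_measure R).
Local Notation D := (@I02 R).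
Local Notation C := R[i].
Implicit Types f g h : fn R.

Lemma TP_eq f g : (forall th, f (circ th) = g (circ th)) -> TP f -> TP g.
Proof. by move=> fg [s hs]; exists s => th; rewrite -fg. Qed.

Lemma TP_tpow k : TP (@tpow R k).
Proof. by exists [:: (1, k)] => th; rewrite /tpoly big_seq1 mul1r. Qed.

Lemma TP_cst k : TP (@fcst R k).
Proof. by exists [:: (k, 0)] => th; rewrite /tpoly big_seq1 expr0z mulr1. Qed.

Lemma TP_add f g : TP f -> TP g -> TP (fadd f g).
Proof.
by move=> [s hs] [t ht]; exists (s ++ t) => th; rewrite /fadd hs ht /tpoly big_cat.
Qed.

Lemma TP_mul f g : TP f -> TP g -> TP (fmul f g).
Proof.
move=> [s hs] [t ht].
exists [seq (x.1 * y.1, x.2 + y.2) | x <- s, y <- t] => th.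
rewrite /fmul hs ht /tpoly big_allpairs_dep /= mulr_suml; apply: eq_bigr => x _.
rewrite mulr_sumr; apply: eq_bigr => y _ /=.
by rewrite expfzDr ?circ_neq0// mulrACA.
Qed.

Lemma TP_scal k f : TP f -> TP (fscal k f).
Proof. by move=> hf; exact: (TP_mul (TP_cst k) hf). Qed.

Lemma TP_minus f g : TP f -> TP g -> TP (fminus f g).
Proof.
move=> hf hg; apply: TP_eq (TP_add hf (TP_scal (-1) hg)) => th.
by rewrite /fadd /fscal /fminus mulN1r.
Qed.

Lemma TP_exp f n : TP f -> TP (fun z => f z ^+ n).
Proof.
move=> hf; elim: n => [|n IH]; first exact: (TP_cst 1).
by apply: TP_eq (TP_mul hf IH) => th; rewrite /fmul exprS.
Qed.

Lemma TP_conj f : TP f -> TP (fun z => conjc (f z)).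
Proof.
move=> [s hs]; exists [seq (conjc x.1, - x.2) | x <- s] => th.
rewrite hs /tpoly big_map rmorph_sum; apply: eq_bigr => x _ /=.
by rewrite rmorphM /= circXz conj_circ -circN circXz mulrNz mulNr.
Qed.

Lemma TP_ind (P : fn R -> Prop) :
  (forall f g, (forall th, f (circ th) = g (circ th)) -> P f -> P g) ->
  P (fcst 0) -> (forall k n f, P f -> TP f -> P (fadd (fscal k (tpow n)) f)) ->
  forall f, TP f -> P f.
Proof.
move=> Peq P0 Padd f [s]; elim: s f => [|[k n] s IH] f hs.
  by apply: Peq P0 => th; rewrite hs /tpoly big_nil.
apply: (Peq (fadd (fscal k (tpow n)) (tpoly s))).
  by move=> th; rewrite hs /tpoly big_cons.
by apply: Padd; [exact: IH|exists s].
Qed.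

Lemma TP_bounded f : TP f -> exists2 M, 0 <= M & forall th, cmod (f (circ th)) <= M.
Proof.
elim/TP_ind => [{}f g fg [M M0 hM]||k n {}f [M M0 hM] _].
- by exists M => // th; rewrite -fg.
- by exists 0 => // th; rewrite /fcst cmod0.
exists (cmod k + M) => [|th]; first by rewrite addr_ge0// cmod_ge0.
rewrite /fadd (le_trans (cmodD _ _))// lerD// /fscal cmodM cmod_circXz mulr1//.
Qed.

Lemma TP_meas f : TP f -> measC f.
Proof.
elim/TP_ind => [{}f g fg|| k n {}f mf _]; first exact: measC_eq.
  exact: measC_cst.
by apply: measC_add => //; apply: measC_scal; exact: measC_tpow.
Qed.

Lemma TP_Linf f : TP f -> Linf f.
Proof.
move=> hf; have [M M0 hM] := TP_bounded hf; apply: (@Linf_cmod _ _ M).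
  exact: TP_meas.
by apply: aeD_all => th _; exact: hM.
Qed.

Lemma TP_Lp p f : 0 <= p -> TP f -> LL p f.
Proof. by move=> p0 /TP_Linf; exact: Linf_Lp. Qed.

Lemma cmean_TP0 f phi : LL 1 f -> (forall n, coef f n = 0) -> TP phi ->
  cmean (fmul f phi) = 0.
Proof.
move=> Lf cf; elim/TP_ind => [g1 g2 e <-||k n g IH Tg].
- by apply: cmean_eq => th; rewrite /fmul e.
- rewrite -[RHS](@cmean_cst R 0); apply: cmean_eq => th.
  by rewrite /fmul /fcst mulr0.
rewrite (_ : fmul _ _ = fadd (fscal k (fmul f (tpow n))) (fmul f g)).
  rewrite cmeanD.
  - rewrite IH addr0 cmeanZ; last exact: LL1_mul_tpow.
    by have := cf (- n); rewrite /coef opprK => ->; rewrite mulr0.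
  - by apply: Lp_scal; exact: LL1_mul_tpow.
  - rewrite (_ : fmul f g = fmul g f).
      by apply: Lp_mulinf => //; exact: TP_Linf.
    by apply/funext => z; rewrite /fmul mulrC.
by apply/funext => z; rewrite /fmul /fadd /fscal mulrDr mulrCA.
Qed.

End trigpoly.

(** * Trigonometric polynomials that approximate indicators of arcs *)

Section step.
Context {R : realType}.
Local Notation mu := (@lebesgue_measure R).
Local Notation D := (@I02 R).
Local Notation C := R[i].

(** On [[0, 1]] these polynomials tend to 1 below [1/2] and to 0 above it: with the outer exponent
    [2 ^ n], Bernoulli's inequality compares them with [1 - (2 s)^n] from below and with [(2 s)^-n]
    from above. *)
Definition stepq (n : nat) (s : R) : R := (1 - s ^+ n) ^+ (2 ^ n).

Lemma stepq_itv n s : 0 <= s <= 1 -> 0 <= stepq n s <= 1.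
Proof.
move=> /andP[s0 s1]; have h : 0 <= 1 - s ^+ n <= 1.
  by rewrite subr_ge0 exprn_ile1//= gerBl exprn_ge0.
by case/andP: h => h0 h1; rewrite exprn_ge0//= exprn_ile1.
Qed.

Lemma bernoulli_ge (x : R) n : 0 <= x <= 1 -> 1 - n%:R * x <= (1 - x) ^+ n.
Proof.
move=> /andP[x0 x1]; elim: n => [|n IH]; first by rewrite mul0r subr0.
rewrite exprS; apply: (@le_trans _ _ ((1 - x) * (1 - n%:R * x))).
  rewrite -natr1; have := mulr_ge0 (ler0n R n) (mulr_ge0 x0 x0).
  set m := n%:R => h; nra.
by rewrite ler_wpM2l// subr_ge0.
Qed.

Lemma bernoulli_le (x : R) n : 0 <= x <= 1 -> (1 + n%:R * x) * (1 - x) ^+ n <= 1.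
Proof.
move=> /andP[x0 x1]; elim: n => [|n IH]; first by rewrite mul0r addr0 mulr1.
apply: le_trans IH; rewrite exprS mulrA ler_wpM2r// ?exprn_ge0 ?subr_ge0//.
rewrite -natr1; have := mulr_ge0 (ler0n R n) (mulr_ge0 x0 x0).
set m := n%:R => h; nra.
Qed.

Lemma stepq_cvg1 (s : R) : 0 <= s < 2^-1 -> stepq n s @[n --> \oo] --> (1 : R).
Proof.
move=> /andP[s0 s1].
have h1 : `|2 * s| < 1 by rewrite ger0_norm; lra.
have c : (1 - (2 * s) ^+ n) @[n --> \oo] --> (1 : R).
  rewrite -[X in _ --> X]subr0; apply: cvgB; first exact: cvg_cst.
  exact: cvg_expr.
apply: (@squeeze_cvgr _ _ _ _ (fun n => 1 - (2 * s) ^+ n) (fun=> 1)); last 2 first.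
- exact: c.
- exact: cvg_cst.
apply: nearW => n.
have hs : 0 <= s <= 1 by apply/andP; split; lra.
have /andP[_ ->] := stepq_itv n hs; rewrite andbT /stepq.
have hx : 0 <= s ^+ n <= 1.
  by rewrite exprn_ge0// exprn_ile1//; lra.
by apply: le_trans (bernoulli_ge _ hx); rewrite exprMn natrX.
Qed.

Lemma stepq_cvg0 (s : R) : 2^-1 < s <= 1 -> stepq n s @[n --> \oo] --> (0 : R).
Proof.
move=> /andP[s0 s1].
have s2 : 1 < 2 * s by lra.
have h1 : `|(2 * s)^-1| < 1.
  by rewrite ger0_norm ?invf_lt1 ?invr_ge0//; lra.
apply: (@squeeze_cvgr _ _ _ _ (fun=> 0) (fun n => (2 * s)^-1 ^+ n)); last 2 first.
- exact: cvg_cst.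
- exact: cvg_expr.
apply: nearW => n.
have hs : 0 <= s <= 1 by apply/andP; split; lra.
have /andP[-> _] /= := stepq_itv n hs.
have hx : 0 <= s ^+ n <= 1.
  by rewrite exprn_ge0 ?exprn_ile1//; lra.
have := bernoulli_le (2 ^ n) hx; rewrite natrX -exprMn -/(stepq n s) => h.
have p0 : 0 < (2 * s) ^+ n by rewrite exprn_gt0//; lra.
rewrite exprVn -[leRHS]mul1r ler_pdivlMr//.
apply: le_trans h; rewrite mulrC ler_wpM2r//; last by rewrite lerDr.
by have /andP[] := stepq_itv n hs.
Qed.

(** Below the threshold [1/2] of [stepq] exactly when [cos (th - al) > c], that is, on an arc
    centred at [al]; the division by 4 keeps the values in [[0, 1]] for [|c| <= 1]. *)
Definition arcs (al c th : R) : R := 2^-1 + (c - cos (th - al)) / 4.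

(** On the circle, [cos (th - al)] is half the sum of [z / circ al] and its inverse; this exhibits
    [stepq] of [arcs] as a trigonometric polynomial. *)
Definition arcpoly (al c : R) (n : nat) : fn R :=
  fun z => (1 - ((2^-1)%:C%C +
     (c%:C%C - (z * (circ al)^-1 + z^-1 * circ al) / 2) / 4) ^+ n) ^+ (2 ^ n).

Lemma arcpoly_circ al c n th :
  arcpoly al c n (circ th) = (stepq n (arcs al c th))%:C%C.
Proof.
rewrite /arcpoly /stepq; set w := _ + _ / 4.
suff -> : w = (arcs al c th)%:C%C by rewrite rmorphXn /= rmorphB /= rmorph1 rmorphXn.
rewrite /w /arcs rmorphD /=; congr (_ + _).
rewrite rmorphM /= rmorphB /= fmorphV /= rmorph_nat; congr ((_ - _) / _).
rewrite -!circN -!circD [- th + al]addrC -[al - th]opprB circN -conj_circ addcJ.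
by rewrite mulrAC mulfV ?mul1r// pnatr_eq0.
Qed.

Lemma TP_arcpoly al c n : TP (arcpoly al c n).
Proof.
have h : TP (fun z : C => (2^-1)%:C%C +
     (c%:C%C - (z * (circ al)^-1 + z^-1 * circ al) / 2) / 4).
  pose f1 := fscal ((circ al)^-1) (@tpow R 1).
  pose f2 := fscal (circ al) (@tpow R (-1)).
  apply: TP_eq (TP_add (TP_cst (2^-1)%:C%C)
     (TP_scal 4^-1 (TP_minus (TP_cst c%:C%C) (TP_scal 2^-1 (TP_add (TP_scal ((circ al)^-1) (TP_tpow 1))
       (TP_scal (circ al) (TP_tpow (-1)))))))) => th.
  rewrite /fadd /fscal /fminus /fcst /tpow expr1z exprN1; congr (_ + _).
  rewrite mulrC; congr ((_ - _) * _); rewrite mulrC; congr (_ * _).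
  by rewrite mulrC [_ * circ al]mulrC.
apply: (TP_exp (2 ^ n)); apply: TP_eq (TP_minus (TP_cst 1) (TP_exp n h)) => th.
by [].
Qed.

Lemma arcs_itv al c th : -1 <= c <= 1 -> 0 <= arcs al c th <= 1.
Proof.
move=> /andP[c1 c2]; rewrite /arcs.
by have := cos_geN1 (th - al); have := cos_le1 (th - al) => ? ?; apply/andP; split; lra.
Qed.

Lemma cos_lt_arc (x d : R) : 0 <= d <= pi -> d < x < 2 * pi - d -> cos x < cos d.
Proof.
move=> /andP[d0 dpi] /andP[dx xd].
have [xpi|xpi] := leP x pi.
  by rewrite ltr_cos// in_itv/= ?d0//; apply/andP; split => //; lra.
have -> : cos x = cos (2 * pi - x).
  by have := circ_refl x; rewrite -conj_circ /refl => -[-> _].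
by rewrite ltr_cos ?in_itv/=; [lra|apply/andP; split => //; lra|apply/andP; split; lra].
Qed.

End step.

Lemma cvg_dist0 {R : realType} (u v : nat -> R) (l : R) :
  (forall n, `|l - u n| <= v n) -> v n @[n --> \oo] --> (0 : R) -> u n @[n --> \oo] --> l.
Proof.
move=> uv v0; apply/cvgrPdist_lt => e e0.
have /cvgr0_norm_lt/(_ e e0) := v0; apply: filterS => n; apply: le_lt_trans.
by rewrite (le_trans (uv n))// ler_norm.
Qed.

(** * Functional monotone class theorem generated by the arc polynomials *)

Section monotone_class.
Context {R : realType}.
Local Notation mu := (@lebesgue_measure R).
Local Notation D := (@I02 R).
Local Notation C := R[i].

Lemma aeD_neq (x : R) : aeD (fun th => th != x).
Proof.
rewrite aeDE; exists ([set x] : set (measurableTypeR R)); split.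
- exact: measurable_set1.
- exact: lebesgue_measure_set1.
- by move=> th /= /not_implyP[_ /negP]; rewrite negbK => /eqP.
Qed.

(** The arc has centre [(x + y) / 2] and half-width [(y - x) / 2]. The endpoints are excluded
    because [arcs] equals [1/2] there, and the angles 0 and [2 * pi] because they are one point of
    the circle, possibly an endpoint. *)
Lemma arc_cvg (x y : R) : 0 <= x -> x < y -> y <= 2 * pi ->
  aeD (fun th => stepq n (arcs ((x + y) / 2) (cos ((y - x) / 2)) th) @[n --> \oo] -->
    (\1_(`]x, y]%classic) th : R)).
Proof.
move=> x0 xy y2.
have h := aeD_and (aeD_and (aeD_neq x) (aeD_neq y)) (aeD_and (aeD_neq 0) (aeD_neq (2 * pi))).
apply: aeDW h => th; rewrite /I02 /= in_itv /= => /andP[t0 t2] [[tx ty] [tn0 tn2]].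
have t0' : 0 < th by rewrite lt_def tn0 t0.
have t2' : th < 2 * pi by rewrite lt_def eq_sym tn2 t2.
set c := cos _; set al := (x + y) / 2.
have hc : -1 <= c <= 1 by rewrite cos_geN1 cos_le1.
have /andP[a0 a1] := arcs_itv al th hc.
rewrite indicE mem_setE in_itv /=.
have dpi : 0 <= (y - x) / 2 <= pi by apply/andP; split; lra.
have cN : cos (th - al) = cos `|th - al|.
  by have [/ger0_norm->//|/ltr0_norm->] := leP 0 (th - al); rewrite cosN.
have [lt1|ge1] := ltP x th; have [lt2|ge2] := leP th y => /=.
- apply: stepq_cvg1; rewrite a0 /= /arcs.
  suff : c < cos (th - al) by lra.
  have tly : th < y by rewrite lt_neqAle ty lt2.
  have nlt : `|th - al| < (y - x) / 2 by rewrite ltr_norml /al; apply/andP; split; lra.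
  case/andP: dpi => d0 d1.
  by rewrite cN /c ltr_cos ?in_itv /= ?normr_ge0 ?d0 ?d1//= (le_trans (ltW nlt)).
- apply: stepq_cvg0; rewrite a1 andbT /arcs.
  suff : cos (th - al) < c by lra.
  rewrite cN /c; apply: cos_lt_arc => //.
  by rewrite ger0_norm /al; [apply/andP; split; lra|lra].
- apply: stepq_cvg0; rewrite a1 andbT /arcs.
  suff : cos (th - al) < c by lra.
  have tlx : th < x by rewrite lt_neqAle tx ge1.
  rewrite cN /c; apply: cos_lt_arc => //.
  by rewrite ler0_norm /al; [apply/andP; split; lra|lra].
- by exfalso; lra.
Qed.

Lemma meas_indic (A : set (measurableTypeR R)) : measurable A ->
  measurable_fun D (\1_A : R -> R).
Proof. by move=> mA; apply: measurable_funTS; exact: measurable_indic. Qed.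

Lemma meas_arc al c n : measurable_fun D (fun th : R => stepq n (arcs al c th)).
Proof.
have := TP_meas (TP_arcpoly al c n); rewrite measCE => -[+ _].
by congr (measurable_fun _ _); apply/funext => th; rewrite arcpoly_circ.
Qed.

Variable K : (R -> R) -> Prop.
Hypothesis K1 : K (fun=> 1).
Hypothesis Karc : forall (al c : R) n, -1 <= c <= 1 -> K (fun th => stepq n (arcs al c th)).
Hypothesis Klin : forall (a b : R) (h g : R -> R), measurable_fun D h -> measurable_fun D g ->
  K h -> K g -> K (fun th => a * h th + b * g th).
Hypothesis Klim : forall (M : R) (h_ : nat -> R -> R) (h : R -> R), (forall n : nat, measurable_fun D (h_ n)) ->
  measurable_fun D h -> (forall n th, D th -> `|h_ n th| <= M) ->
  aeD (fun th => h_ n th @[n --> \oo] --> h th) -> (forall n, K (h_ n)) -> K h.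

Let meas1 : measurable_fun D (fun _ : R => 1 : R).
Proof. exact: measurable_cst. Qed.

Let Kae (h g : R -> R) : measurable_fun D h -> measurable_fun D g -> (exists M, forall th, D th -> `|h th| <= M) ->
  aeD (fun th => h th = g th) -> K h -> K g.
Proof.
move=> mh mg [M hM] e Kh; apply: (@Klim M (fun=> h)) => //.
by apply: aeDW e => th _ ->; exact: cvg_cst.
Qed.

Let Kitv (x y : R) : 0 <= x -> x < y -> y <= 2 * pi -> K (\1_(`]x, y]%classic)).
Proof.
move=> x0 xy y2.
have hc : (-1 : R) <= cos ((y - x) / 2) <= 1 by rewrite cos_geN1 cos_le1.
apply: (@Klim 1 (fun n th => stepq n (arcs ((x + y) / 2) (cos ((y - x) / 2)) th))).
- by move=> n; exact: meas_arc.
- by apply: meas_indic; exact: measurable_itv.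
- move=> n th _; have /andP[h0 h1] := stepq_itv n (arcs_itv ((x + y) / 2) th hc).
  by rewrite ger0_norm.
- exact: arc_cvg.
- by move=> n; exact: Karc.
Qed.

Let Kindic0 : K (\1_(set0 : set R)).
Proof.
apply: (@Kae (fun th => 0 * 1 + 0 * 1)).
- exact: measurable_cst.
- by apply: meas_indic; exact: measurable0.
- by exists 0 => th _; rewrite !mul0r addr0 normr0.
- by apply: aeD_all => th _; rewrite indicE in_set0 !mul0r addr0.
- exact: Klin.
Qed.

Let indic_bound (A : set R) : exists M : R, forall th, D th -> `|\1_A th| <= M.
Proof. by exists 1 => th _; rewrite indicE; case: (_ \in _); rewrite ?normr1 ?normr0. Qed.

(** Dynkin induction: half-open intervals are stable under intersection and generate the Borel sets,
    complements come from [K1] and [Klin], and disjoint unions from [Klim] applied to partial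
    sums. *)
Let Kindic (A : set (measurableTypeR R)) : measurable A -> K (\1_A).
Proof.
move=> mA; suff H : forall S : set (measurableTypeR R), <<s @ocitv R >> S -> K (\1_S) by exact: H.
apply: (@dynkin_induction _ (measurableTypeR R) (@ocitv R) (fun A => K (\1_A))) => //.
- exact: ocitvI.
- apply: (@Kae (fun=> 1)) => //.
  + by exists 1 => th _; rewrite normr1.
  + by apply: aeD_all => th _; rewrite indicE in_setT.
- move=> X [[a b] _ <-] /=.
  (* Up to the null set [{0}] only angles in []0, 2 * pi]] count, so []a, b]] may be replaced by
     []x, y]], or by the empty set if [y <= x]. *)
  pose x := Num.max a 0; pose y := Num.min b (2 * pi).
  have key (B : set (measurableTypeR R)) : measurable B -> K (\1_B) ->
      (forall th : R, 0 < th <= 2 * pi -> (th \in `]a, b]%classic) = (th \in B)) ->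
      K (\1_(`]a, b]%classic)).
    move=> mB KB hB; apply: (Kae _ _ (indic_bound B) _ KB).
    + exact: meas_indic.
    + by apply: meas_indic; exact: measurable_itv.
    + apply: aeDW (aeD_neq 0) => th; rewrite /I02 /= in_itv /= => /andP[t0 t2] tn0.
      by rewrite !indicE hB// lt_def tn0 t0.
  have [xy|yx] := ltP x y.
    apply: (key (`]x, y]%classic)); first exact: measurable_itv.
      apply: Kitv => //; first by rewrite /x le_max lexx orbT.
      by rewrite /y ge_min lexx orbT.
    move=> th /andP[t0 t2]; rewrite !mem_setE !in_itv /= /x /y.
    by rewrite gt_max le_min t0 t2 !andbT.
  apply: (key set0); [exact: measurable0|exact: Kindic0|].
  move=> th /andP[t0 t2]; rewrite mem_setE in_itv in_set0 /=; apply/negbTE/negP => /andP[at_ tb].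
  have : x < y by rewrite /x /y lt_min !gt_max (lt_le_trans at_ tb) (lt_le_trans t0 t2)
     (lt_le_trans at_ t2) (lt_le_trans t0 tb).
  by rewrite ltNge yx.
- move=> S mS KS; apply: (@Kae (fun th => 1 * 1 + (-1) * \1_S th)).
  + apply: measurable_funD; first exact: measurable_cst.
    by apply: measurable_funM; [exact: measurable_cst|exact: meas_indic].
  + by apply: meas_indic; exact: measurableC.
  + exists 2 => th _; rewrite indicE; case: (_ \in _).
      by rewrite mulr1 mulN1r subrr normr0.
    by rewrite mulr1 mulr0 addr0 normr1 ler1n.
  + apply: aeD_all => th _; rewrite indicC indicE; case: (_ \in _) => /=.
      by rewrite mulr1 mulN1r subrr.
    by rewrite mulr1 mulr0 addr0.
  + by apply: Klin => //; exact: meas_indic.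
- move=> F mF tF KF.
  (* Disjointness turns the partial sums into indicators, so they are bounded by 1 as [Klim]
     demands. *)
  have s01 n th : \sum_(k < n) \1_(F k) th = (th \in \bigcup_(k in [set k | (k < n)%N]) F k)%:R :> R.
    elim: n => [|n IH].
      by rewrite big_ord0 (_ : [set k | _] = set0) ?bigcup_set0 ?in_set0//; apply/seteqP; split.
    rewrite big_ord_recr /= IH indicE -natrD; congr (_%:R).
    have [/set_mem[k kn Fk]|n1] := boolP (th \in \bigcup_(k in [set k | (k < n)%N]) F k).
      rewrite (_ : th \in F n = false) ?addn0; last first.
        apply/negbTE/negP => /set_mem Fn; move/trivIsetP : tF => /(_ k n I I).
        rewrite ltn_eqF// => /(_ isT) e0.
        by have : (F k `&` F n) th by []; rewrite e0.
      by rewrite mem_set//; exists k => //=; exact: (ltn_trans kn).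
    rewrite add0n; congr nat_of_bool; apply/idP/idP => [/set_mem Fn|/set_mem[k /= kn Fk]].
      by rewrite mem_set//; exists n => /=.
    rewrite mem_set//; move: kn; rewrite ltnS leq_eqVlt => /orP[/eqP <-//|kn].
    by exfalso; move/negP : n1; apply; rewrite mem_set//; exists k.
  apply: (@Klim 1 (fun n th => \sum_(k < n) \1_(F k) th)).
  + move=> n; apply: measurable_sum => k; exact: meas_indic.
  + by apply: meas_indic; exact: bigcupT_measurable.
  + by move=> n th _; rewrite s01; case: (_ \in _); rewrite ?normr1 ?normr0.
  + apply: aeD_all => th _; rewrite indicE.
    have [/set_mem[k _ Fk]|nF] := boolP (th \in \bigcup_k F k).
      apply: cvg_near_cst; exists k.+1 => // n /= kn.
      by rewrite s01 mem_set//; exists k.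
    apply: cvg_near_cst; apply: nearW => n /=.
    rewrite s01 memNset// => -[k _ Fk]; move/negP : nF; apply.
    by rewrite mem_set//; exists k.
  + elim=> [|n IH].
      apply: (Kae _ _ (indic_bound set0) _ Kindic0).
        by apply: meas_indic; exact: measurable0.
        by apply: measurable_sum => k; exact: meas_indic.
      by apply: aeD_all => th _; rewrite big_ord0 indicE in_set0.
    have mn : measurable_fun D (fun th => \sum_(k < n) \1_(F k) th : R).
      by apply: measurable_sum => k; exact: meas_indic.
    apply: (@Kae (fun th => 1 * (\sum_(k < n) \1_(F k) th) + 1 * \1_(F n) th)).
    * by apply: measurable_funD; apply: measurable_funM => //; exact: meas_indic.
    * by apply: measurable_sum => k; exact: meas_indic.
    * exists 1 => th _; rewrite !mul1r -(big_ord_recr n (fun k => \1_(F k) th)) /= s01.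
      by case: (_ \in _); rewrite ?normr1 ?normr0.
    * by apply: aeD_all => th _; rewrite big_ord_recr /= !mul1r.
    * by apply: Klin => //; exact: meas_indic.
Qed.

(** Binary expansion: the indicator of [h >= 1/2] is the leading digit, and [h' = 2 h - \1_A] has
    the remaining digits and still takes values in [[0, 1]]. *)
Let Kdyadic n : forall h : R -> R, measurable_fun D h -> (forall th, D th -> 0 <= h th <= 1) ->
  exists g, [/\ measurable_fun D g, K g & forall th, D th -> `|h th - g th| <= 2^-1 ^+ n].
Proof.
elim: n => [|n IH] h mh h01.
  exists (\1_(set0 : set R)); split.
    by apply: meas_indic; exact: measurable0.
    exact: Kindic0.
  move=> th Dth; have /andP[h0 h1] := h01 _ Dth.
  by rewrite indicE in_set0 subr0 ger0_norm.
pose A : set R := D `&` h @^-1` `[2^-1, +oo[.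
have mA : measurable A by apply: mh; [exact: measurable_D|exact: measurable_itv].
pose h' th := 2 * h th - \1_A th.
have A_E th : D th -> \1_A th = (2^-1 <= h th)%R%:R :> R.
  move=> Dth; rewrite indicE; congr ((_ : bool)%:R); apply/idP/idP => [/set_mem[_]|hh].
    by rewrite /= in_itv /= andbT.
  by rewrite mem_set//; split=> //; rewrite /= in_itv /= andbT.
have mh' : measurable_fun D h'.
  apply: measurable_funB; last exact: meas_indic.
  by apply: measurable_funM => //; exact: measurable_cst.
have h'01 th : D th -> 0 <= h' th <= 1.
  move=> Dth; have /andP[h0 h1] := h01 _ Dth; rewrite /h' A_E//.
  by have [h2|h2] /= := leP 2^-1 (h th); apply/andP; split; lra.
have [g [mg Kg hg]] := IH _ mh' h'01.
exists (fun th => 2^-1 * \1_A th + 2^-1 * g th); split.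
- apply: measurable_funD; apply: measurable_funM; try exact: measurable_cst; last exact: mg.
  exact: meas_indic.
- by apply: Klin => //; exact: Kindic.
- move=> th Dth; have := hg _ Dth; rewrite /h' exprS.
  have -> : h th - (2^-1 * \1_A th + 2^-1 * g th) = 2^-1 * (2 * h th - \1_A th - g th) by field.
  by rewrite normrM ger0_norm ?invr_ge0// => hh; rewrite ler_wpM2l ?invr_ge0.
Qed.

(** An affine change of values leads to the range [[0, 1]], where the binary approximants of
    [Kdyadic] converge uniformly. Taking [N = M + 1] keeps the denominator positive when [M = 0]. *)
Lemma bounded_class (h : R -> R) (M : R) : measurable_fun D h ->
  (forall th, D th -> `|h th| <= M) -> K h.
Proof.
move=> mh hM.
have M0 : 0 <= M by apply: le_trans (hM 0 _); rewrite // /I02 /= in_itv /= lexx ltW// pi2_gt0.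
suff K01 (k : R -> R) : measurable_fun D k -> (forall th, D th -> 0 <= k th <= 1) -> K k.
  pose N := M + 1; have N0 : 0 < N by rewrite /N; lra.
  pose k th := (h th + N) / (2 * N).
  have mk : measurable_fun D k.
    apply: measurable_funM; last exact: measurable_cst.
    by apply: measurable_funD => //; exact: measurable_cst.
  have Kk : K k.
    apply: K01 => // th Dth; have := hM _ Dth; rewrite ler_norml => /andP[h1 h2].
    rewrite /k divr_ge0//= ?ler_pdivrMr ?mul1r; rewrite /N; lra.
  apply: (@Kae (fun th => (2 * N) * k th + (- N) * 1)) => //.
  - apply: measurable_funD; last exact: measurable_cst.
    by apply: measurable_funM => //; exact: measurable_cst.
  - exists M => th Dth; rewrite /k mulrC divfK; first by rewrite mulr1 addrK hM.
    by rewrite mulf_neq0// gt_eqF.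
  - apply: aeD_all => th _; rewrite /k mulrC divfK; first by rewrite mulr1 addrK.
    by rewrite mulf_neq0// gt_eqF.
  - exact: Klin.
move=> mk k01.
have /choice[g hg] n := Kdyadic n mk k01.
apply: (@Klim 2 g) => //.
- by move=> n; case: (hg n).
- move=> n th Dth; have [_ _ /(_ _ Dth) h1] := hg n.
  have /andP[k0 k1] := k01 _ Dth.
  have : 2^-1 ^+ n <= 1 :> R by rewrite exprn_ile1//; lra.
  move: h1; set e := 2^-1 ^+ n; rewrite !ler_norml => /andP[? ?] ?; apply/andP; split; lra.
- apply: aeD_all => th Dth; apply: (@cvg_dist0 _ _ (fun n => 2^-1 ^+ n)).
    by move=> n; have [_ _ /(_ _ Dth)] := hg n.
  by apply: cvg_expr; rewrite ger0_norm; lra.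
- by move=> n; case: (hg n).
Qed.

End monotone_class.

(** * Fourier coefficients determine an integrable function almost everywhere *)

Section uniqueness.
Context {R : realType}.
Local Notation D := (@I02 R).
Local Notation C := R[i].
Implicit Types f g : fn R.

(** The [h] orthogonal to both parts of [f] form a class to which [bounded_class] applies: it
    contains the real trigonometric polynomials by [cmean_TP0], and dominated convergence with
    majorant a multiple of [|f|] gives the limits. *)
Lemma bounded_mul_coef0 f (h : R -> R) M : LL 1 f -> (forall n, coef f n = 0) ->
  measurable_fun D h -> (forall th, D th -> `|h th| <= M) ->
  intg (fun th => complex.Re (f (circ th)) * h th) = 0 /\
  intg (fun th => complex.Im (f (circ th)) * h th) = 0.
Proof.
move=> Lf cf mh hM; have /Lp1P[f1 f2] := Lf.
pose u th := complex.Re (f (circ th)); pose v th := complex.Im (f (circ th)).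
pose K h := [/\ Int (fun th => u th * h th), Int (fun th => v th * h th),
  intg (fun th => u th * h th) = 0 & intg (fun th => v th * h th) = 0].
suff : K h by case.
have KTP phi (k : R -> R) : TP phi -> (forall th, phi (circ th) = (k th)%:C%C) -> K k.
  move=> Tphi e.
  have Lphi : LL 1 (fmul f phi).
    rewrite (_ : fmul f phi = fmul phi f); last by apply/funext => z; rewrite /fmul mulrC.
    by apply: Lp_mulinf => //; exact: TP_Linf.
  have e1 th : complex.Re (fmul f phi (circ th)) = u th * k th.
    by rewrite /fmul e /u; case: (f _) => x y /=; rewrite mulr0 subr0.
  have e2 th : complex.Im (fmul f phi (circ th)) = v th * k th.
    by rewrite /fmul e /v; case: (f _) => x y /=; rewrite mulr0 add0r.
  have /Lp1P[i1 i2] := Lphi.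
  have := cmean_TP0 Lf cf Tphi; rewrite cmeanE => -[/eqP h1 /eqP h2].
  have n0 : (2 * pi : R)^-1 != 0 by rewrite invr_eq0 gt_eqF ?pi2_gt0.
  split.
  - by apply: eq_Int i1 => th _.
  - by apply: eq_Int i2 => th _.
  - apply/eqP; move: h1; rewrite mulf_eq0 (negbTE n0) /= => /eqP <-.
    by apply/eqP; apply: eq_intg => th _.
  - apply/eqP; move: h2; rewrite mulf_eq0 (negbTE n0) /= => /eqP <-.
    by apply/eqP; apply: eq_intg => th _.
apply: (@bounded_class _ K _ _ _ _ h M) => //.
- by apply: (KTP (fcst 1)) => //; exact: TP_cst.
- move=> al c n _; apply: (KTP (arcpoly al c n)); first exact: TP_arcpoly.
  by move=> th; rewrite arcpoly_circ.
- move=> a b h1 h2 _ _ [i1 j1 e1 d1] [i2 j2 e2 d2].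
  have E w th : w th * (a * h1 th + b * h2 th) = a * (w th * h1 th) + b * (w th * h2 th).
    by ring.
  split.
  + by apply: eq_Int (IntD (IntZ a i1) (IntZ b i2)) => th _; rewrite E.
  + by apply: eq_Int (IntD (IntZ a j1) (IntZ b j2)) => th _; rewrite E.
  + rewrite (@eq_intg _ _ (fun th => a * (u th * h1 th) + b * (u th * h2 th))); last by move=> th _; exact: E.
    by rewrite intgD ?intgZ ?e1 ?e2 ?mulr0 ?addr0//; exact: IntZ.
  + rewrite (@eq_intg _ _ (fun th => a * (v th * h1 th) + b * (v th * h2 th))); last by move=> th _; exact: E.
    by rewrite intgD ?intgZ ?d1 ?d2 ?mulr0 ?addr0//; exact: IntZ.
- move=> N h_ k mh_ mk hN cv Kh.
  have key w : Int w -> (forall n, intg (fun th => w th * h_ n th) = 0) ->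
      Int (fun th => w th * k th) /\ intg (fun th => w th * k th) = 0.
    move=> iw e; have mw := Int_meas iw.
    have [] := @intg_dominated _ (fun n th => w th * h_ n th) (fun th => w th * k th) (fun th => N * `|w th|).
    + by move=> n; exact: measurable_funM.
    + exact: measurable_funM.
    + by apply: aeDW cv => th _ cv; apply: cvgM => //; exact: cvg_cst.
    + by apply: IntZ; exact: Int_abs.
    + by move=> n th Dth; rewrite normrM mulrC ler_wpM2r// hN.
    + move=> i _ c; split=> //; apply/esym.
      rewrite (_ : (fun n => _) = (fun=> 0)) in c; last by apply/funext => n; exact: e.
      exact: (cvg_unique _ (@cvg_cst _ _ _ _ _) c).
  have [i1 e1] := key u f1 (fun n => let: And4 _ _ e _ := Kh n in e).
  have [i2 e2] := key v f2 (fun n => let: And4 _ _ _ e := Kh n in e).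
  by split.
Qed.

Lemma intg_sgn_eq0 (u : R -> R) : Int u ->
  intg (fun th => u th * Num.sg (u th)) = 0 -> aeD (fun th => u th = 0).
Proof.
move=> iu e; apply: aeDW (@intg_eq0 _ (fun th => `|u th|) _ _ _).
- by move=> th _ /normr0_eq0.
- exact: Int_abs.
- by [].
- by rewrite -e; apply: eq_intg => th _; rewrite normrEsg mulrC.
Qed.

Lemma meas_sgr (u : R -> R) : measurable_fun D u -> measurable_fun D (fun th => Num.sg (u th)).
Proof.
move=> mu_; rewrite (_ : (fun th => _) = (fun th => (0 < u th)%R%:R - (u th < 0)%R%:R)); last first.
  by apply/funext => th; have [h|h|->] := ltrgtP (u th) 0;
    rewrite ?(gtr0_sg h) ?(ltr0_sg h) ?sgr0 ?subr0 ?sub0r ?subrr.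
have m0 : measurable_fun D (fun=> 0 : R) by exact: measurable_cst.
have mb (b : R -> bool) : measurable_fun D b -> measurable_fun D (fun th => (b th)%:R : R).
  by move=> mb; apply: (@measurableT_comp _ _ _ _ _ _ (fun b : bool => b%:R : R)).
apply: measurable_funB; apply: mb; exact: measurable_fun_ltr.
Qed.

(** The signs of the real and imaginary parts are bounded test functions, and testing against them
    gives the [L^1] norms of the two parts. *)
Lemma coef_eq0 f : LL 1 f -> (forall n, coef f n = 0) -> aeeq f (fcst 0).
Proof.
move=> Lf cf; have /Lp1P[f1 f2] := Lf.
have sg1 (x : R) : `|Num.sg x| <= 1 by rewrite normr_sg lern1 leq_b1.
have [h1 _] := bounded_mul_coef0 Lf cf (meas_sgr (Int_meas f1)) (fun th _ => sg1 _).
have [_ h2] := bounded_mul_coef0 Lf cf (meas_sgr (Int_meas f2)) (fun th _ => sg1 _).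
apply/aeeqP; apply: aeDW (aeD_and (intg_sgn_eq0 f1 h1) (intg_sgn_eq0 f2 h2)) => th _ [e1 e2].
exact: complex_eq.
Qed.

Lemma coef_inj f g : LL 1 f -> LL 1 g -> (forall n, coef f n = coef g n) -> aeeq f g.
Proof.
move=> Lf Lg e.
have /aeeqP h : aeeq (fminus f g) (fcst 0).
  apply: coef_eq0; first exact: Lp_minus.
  by move=> n; rewrite fcoefB// e subrr.
by apply/aeeqP; apply: AEW h => z _ /eqP; rewrite /fminus /fcst subr_eq0 => /eqP.
Qed.

End uniqueness.

(** * Density of trigonometric polynomials in [L^p] *)

Section density.
Context {R : realType}.
Local Notation D := (@I02 R).
Local Notation C := R[i].
Implicit Types f g : fn R.

Definition ddist (h : R -> C) (phi : fn R) (th : R) : R := cmod (h th - phi (circ th)).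

(** Closeness is measured by the integral of the [p]-th power, so that [powR_addle] can act as
    triangle inequality. *)
Definition apx (p : R) (h : R -> R) : Prop := forall e, 0 < e ->
  exists phi, [/\ TP phi, Int (fun th => ddist (fun th => (h th)%:C%C) phi th `^ p) &
    intg (fun th => ddist (fun th => (h th)%:C%C) phi th `^ p) < e].

Lemma meas_ddist (h : R -> R) phi : measurable_fun D h -> TP phi ->
  measurable_fun D (ddist (fun th => (h th)%:C%C) phi).
Proof.
move=> mh /TP_meas; rewrite measCE => -[m1 m2].
apply: (@measurableT_comp _ _ _ _ _ _ (@Num.sqrt R)).
  by apply: continuous_measurable_fun; exact: sqrt_continuous.
apply: measurable_funD; apply: measurable_funX.
  rewrite (_ : (fun th => _) = h \- (fun th => complex.Re (phi (circ th)))).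
    exact: measurable_funB.
  by apply/funext => th /=; rewrite cReD cReN.
rewrite (_ : (fun th => _) = \- (fun th => complex.Im (phi (circ th)))).
  exact: measurable_funN.
by apply/funext => th /=; rewrite cImD cImN add0r.
Qed.

Lemma apx_close (p : R) (h : R -> R) : 0 <= p -> measurable_fun D h ->
  (forall e : R, 0 < e -> exists g : R -> R, [/\ measurable_fun D g, apx p g,
     Int (fun th => `|h th - g th| `^ p) & intg (fun th => `|h th - g th| `^ p) < e]) ->
  apx p h.
Proof.
move=> p0 mh H e e0.
have k0 : 0 < 2 `^ p :> R by rewrite powR_gt0.
have e'0 : 0 < e / (2 * 2 `^ p) by rewrite divr_gt0// mulr_gt0.
have [g [mg ag ig lg]] := H _ e'0; have [phi [Tp ip lp]] := ag _ e'0.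
have b th : ddist (fun th => (h th)%:C%C) phi th `^ p <=
    2 `^ p * (`|h th - g th| `^ p + ddist (fun th => (g th)%:C%C) phi th `^ p).
  apply: le_trans (powR_addle _ _ _); rewrite ?cmod_ge0//.
  rewrite ge0_ler_powR ?nnegrE ?addr_ge0 ?cmod_ge0//.
  rewrite -cmod_real (le_trans _ (cmodD _ _))// rmorphB /=.
  by rewrite addrA subrK.
have ib := IntZ (2 `^ p) (IntD ig ip).
have ih : Int (fun th => ddist (fun th => (h th)%:C%C) phi th `^ p).
  apply: Int_le ib _; first by apply: meas_pow; exact: meas_ddist.
  by move=> th _; rewrite ger0_norm ?powR_ge0.
exists phi; split => //.
apply: le_lt_trans (le_intg ih ib (fun th _ => b th)) _.
rewrite intgZ; last exact: IntD.
rewrite intgD// -ltr_pdivlMl//.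
apply: lt_le_trans (ltrD lg lp) _.
by rewrite -mulr2n -mulr_natl le_eqVlt; apply/orP; left; apply/eqP; field; rewrite gt_eqF.
Qed.

Lemma apx_lin p (a b : R) (h g : R -> R) : 0 <= p ->
  measurable_fun D h -> measurable_fun D g -> apx p h -> apx p g ->
  apx p (fun th => a * h th + b * g th).
Proof.
move=> p0 mh mg ah ag e e0.
have k0 : 0 < 2 `^ p :> R by rewrite powR_gt0.
pose ka := 2 `^ p * `|a| `^ p + 1; pose kb := 2 `^ p * `|b| `^ p + 1.
have ka0 : 0 < ka by rewrite ltr_wpDl// mulr_ge0 ?powR_ge0.
have kb0 : 0 < kb by rewrite ltr_wpDl// mulr_ge0 ?powR_ge0.
have ea0 : 0 < e / 2 / ka by rewrite !divr_gt0.
have eb0 : 0 < e / 2 / kb by rewrite !divr_gt0.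
have [phi [Tp ip lp]] := ah _ ea0; have [psi [Ts is_ ls]] := ag _ eb0.
pose w := fadd (fscal a%:C%C phi) (fscal b%:C%C psi).
have Tw : TP w by apply: TP_add; exact: TP_scal.
pose H th := a * h th + b * g th.
have mH : measurable_fun D H.
  by apply: measurable_funD; apply: measurable_funM => //; exact: measurable_cst.
have bd th : ddist (fun th => (H th)%:C%C) w th `^ p <=
  ka * ddist (fun th => (h th)%:C%C) phi th `^ p + kb * ddist (fun th => (g th)%:C%C) psi th `^ p.
  apply: (@le_trans _ _ (2 `^ p * ((`|a| * ddist (fun th => (h th)%:C%C) phi th) `^ p +
     (`|b| * ddist (fun th => (g th)%:C%C) psi th) `^ p))).
    apply: le_trans (powR_addle _ _ _); rewrite ?mulr_ge0 ?cmod_ge0//.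
    rewrite ge0_ler_powR ?nnegrE ?addr_ge0 ?mulr_ge0 ?cmod_ge0//.
    rewrite -!cmod_real -!cmodM (le_trans _ (cmodD _ _))//.
    rewrite /ddist /H /w /fadd /fscal rmorphD !rmorphM /= le_eqVlt.
    by apply/orP; left; apply/eqP; congr cmod; ring.
  rewrite !powRM ?cmod_ge0// mulrDr !mulrA lerD// ler_wpM2r ?powR_ge0//;
    by rewrite lerDl.
have ib := IntD (IntZ ka ip) (IntZ kb is_).
have ih : Int (fun th => ddist (fun th => (H th)%:C%C) w th `^ p).
  apply: Int_le ib _; first by apply: meas_pow; exact: meas_ddist.
  by move=> th _; rewrite ger0_norm ?powR_ge0.
exists w; split => //.
apply: le_lt_trans (le_intg ih ib (fun th _ => bd th)) _.
rewrite intgD; [|exact: IntZ..]; rewrite !intgZ//.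
rewrite [ltRHS](_ : e = ka * (e / 2 / ka) + kb * (e / 2 / kb)).
  by rewrite ltrD// ltr_pM2l.
by field; rewrite !gt_eqF.
Qed.

Lemma apx_TP p (h : R -> R) phi : 0 < p -> TP phi ->
  (forall th, phi (circ th) = (h th)%:C%C) -> apx p h.
Proof.
move=> p0 Tp e eps eps0; exists phi; split => //.
  by apply: eq_Int (Int_cst 0) => th _; rewrite /ddist e subrr cmod0 powR0// gt_eqF.
rewrite (@eq_intg _ _ (fun=> 0)); first by rewrite intg_cst mul0r.
by move=> th _; rewrite /ddist e subrr cmod0 powR0// gt_eqF.
Qed.

Lemma cvg_powR0 (p : R) (u : nat -> R) : 0 < p -> (forall n, 0 <= u n) ->
  u n @[n --> \oo] --> (0 : R) -> u n `^ p @[n --> \oo] --> (0 : R).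
Proof.
move=> p0 u0 cu; apply/cvgr0Pnorm_lt => e e0.
have d0 : 0 < e `^ p^-1 by rewrite powR_gt0.
have /cvgr0_norm_lt/(_ _ d0) := cu; apply: filterS => n.
rewrite ger0_norm// ger0_norm ?powR_ge0// => h.
rewrite -[ltRHS](@powRr1 _ e) ?ltW// -(@mulVf _ p) ?gt_eqF// powRrM.
by rewrite gt0_ltr_powR ?nnegrE ?powR_ge0.
Qed.

(** [bounded_class] applied to approximability. For the limits, bounded a.e. convergence implies
    [L^p] convergence, by dominated convergence with majorant [(M + |k|)^p]. *)
Lemma apx_bounded p (h : R -> R) (M : R) : 0 < p -> measurable_fun D h ->
  (forall th, D th -> `|h th| <= M) -> apx p h.
Proof.
move=> p0 mh hM; apply: (@bounded_class _ (apx p) _ _ _ _ h M mh hM).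
- by apply: (apx_TP p0 (TP_cst 1)).
- move=> al c n _; apply: (apx_TP p0 (TP_arcpoly al c n)) => th.
  exact: arcpoly_circ.
- by move=> *; apply: apx_lin => //; exact: ltW.
move=> {M hM} M h_ {mh}k mh_ mk hM cv ah.
apply: apx_close => //; first exact: ltW.
have kM : aeD (fun th => `|k th| <= M).
  apply: aeDW cv => th Dth cv.
  have cn : `|h_ n th| @[n --> \oo] --> `|k th| by exact: cvg_norm.
  rewrite -(cvg_lim _ cn)//; apply: limr_le; first by apply/cvg_ex; exists `|k th|.
  by apply: nearW => n; exact: hM.
have M0 : 0 <= M by apply: le_trans (hM 0%N 0 _); rewrite // /I02 /= in_itv /= lexx ltW// pi2_gt0.
have ik : Int (fun th => (M + `|k th|) `^ p).
  apply: (@ae_Int_le _ _ (fun=> (M + M) `^ p)).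
  - apply: meas_pow; apply: measurable_funD; first exact: measurable_cst.
    exact: measurableT_comp.
  - exact: Int_cst.
  - apply: aeDW kM => th _ kM; rewrite ger0_norm ?powR_ge0//.
    by rewrite ge0_ler_powR ?nnegrE ?addr_ge0 ?lerD2l// ltW.
have md n : measurable_fun D (fun th => `|k th - h_ n th| `^ p).
  by apply: meas_pow; apply: measurableT_comp => //; exact: measurable_funB.
have bd n th : D th -> `|k th - h_ n th| `^ p <= (M + `|k th|) `^ p.
  move=> Dth; rewrite ge0_ler_powR ?nnegrE ?addr_ge0 ?(ltW p0)//.
  by rewrite (le_trans (ler_normB _ _))// addrC lerD2r hM.
have [] := @intg_dominated _ (fun n th => `|k th - h_ n th| `^ p) (fun=> 0) (fun th => (M + `|k th|) `^ p).
- exact: md.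
- exact: measurable_cst.
- apply: aeDW cv => th _ cv; apply: cvg_powR0 => //.
  have -> : 0 = `|k th - k th| by rewrite subrr normr0.
  by apply: cvg_norm; apply: cvgB => //; exact: cvg_cst.
- exact: ik.
- by move=> n th Dth; rewrite ger0_norm ?powR_ge0// bd.
move=> _ _; rewrite intg_cst mul0r => c0 e e0.
have /cvgr0_norm_lt/(_ _ e0)[N _ hN] := c0.
exists (h_ N); split => //.
  apply: Int_le ik _ => // th Dth; rewrite ger0_norm ?powR_ge0// bd//.
by apply: le_lt_trans (hN N (leqnn _)); exact: ler_norm.
Qed.

(** Truncation: [h] set to 0 where [|h| > n] is bounded and tends to [h] in [L^p]. *)
Lemma apx_Lp p (h : R -> R) : 0 < p -> measurable_fun D h ->
  Int (fun th => `|h th| `^ p) -> apx p h.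
Proof.
move=> p0 mh ih; apply: apx_close => //; first exact: ltW.
pose g (n : nat) th : R := h th * (`|h th| <= n%:R)%R%:R.
have mg n : measurable_fun D (g n).
  apply: measurable_funM => //.
  apply: (@measurableT_comp _ _ _ _ _ _ (fun b : bool => b%:R : R)) => //.
  apply: measurable_fun_ler; last exact: measurable_cst.
  exact: measurableT_comp.
have hg n th : `|h th - g n th| <= `|h th|.
  by rewrite /g; have [_|_] := leP `|h th| n%:R; rewrite ?mulr1 ?subrr ?normr0// mulr0 subr0.
have bd n th : `|h th - g n th| `^ p <= `|h th| `^ p.
  by rewrite ge0_ler_powR ?nnegrE ?(ltW p0)// hg.
have md n : measurable_fun D (fun th => `|h th - g n th| `^ p).
  by apply: meas_pow; apply: measurableT_comp => //; exact: measurable_funB.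
have [] := @intg_dominated _ (fun n th => `|h th - g n th| `^ p) (fun=> 0) (fun th => `|h th| `^ p).
- exact: md.
- exact: measurable_cst.
- apply: aeD_all => th _; apply: cvg_near_cst; exists (Num.truncn `|h th|).+1 => // n /= hn.
  rewrite /g (_ : `|h th| <= n%:R) ?mulr1 ?subrr ?normr0 ?powR0 ?gt_eqF//.
  by rewrite (le_trans (ltW (truncnS_gt _)))// ler_nat.
- exact: ih.
- by move=> n th Dth; rewrite ger0_norm ?powR_ge0// bd.
move=> _ _; rewrite intg_cst mul0r => c0 e e0.
have /cvgr0_norm_lt/(_ _ e0)[N _ hN] := c0.
exists (g N); split => //.
- apply: (@apx_bounded _ _ N%:R) => // th _; rewrite /g.
  by have [h1|h1] := leP `|h th| N%:R; rewrite ?mulr1// mulr0 normr0.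
- by apply: Int_le ih _ => // th Dth; rewrite ger0_norm ?powR_ge0// bd.
- by apply: le_lt_trans (hN N (leqnn _)); exact: ler_norm.
Qed.

Lemma TP_dense p f e : 0 < p -> LL p f -> 0 < e ->
  exists phi, TP phi /\ intg (fun th => cmod (f (circ th) - phi (circ th)) `^ p) < e.
Proof.
move=> p0 /LpP[mf If] e0; have := mf; rewrite measCE => -[m1 m2].
have k0 : 0 < 2 `^ p :> R by rewrite powR_gt0.
have e'0 : 0 < e / (2 * 2 `^ p) by rewrite divr_gt0// mulr_gt0.
have a1 : apx p (fun th => complex.Re (f (circ th))).
  apply: apx_Lp => //; apply: Int_le If _.
    by apply: meas_pow; exact: measurableT_comp.
  by move=> th _; rewrite ger0_norm ?powR_ge0// ge0_ler_powR ?nnegrE ?cmod_ge0 ?(ltW p0)// Re_cmod.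
have a2 : apx p (fun th => complex.Im (f (circ th))).
  apply: apx_Lp => //; apply: Int_le If _.
    by apply: meas_pow; exact: measurableT_comp.
  by move=> th _; rewrite ger0_norm ?powR_ge0// ge0_ler_powR ?nnegrE ?cmod_ge0 ?(ltW p0)// Im_cmod.
have [phi [T1 i1 l1]] := a1 _ e'0; have [psi [T2 i2 l2]] := a2 _ e'0.
pose w := fadd phi (fscal 'i%C psi).
have Tw : TP w by apply: TP_add => //; exact: TP_scal.
exists w; split => //.
have b th : cmod (f (circ th) - w (circ th)) `^ p <= 2 `^ p *
   (ddist (fun th => (complex.Re (f (circ th)))%:C%C) phi th `^ p +
    ddist (fun th => (complex.Im (f (circ th)))%:C%C) psi th `^ p).
  apply: le_trans (powR_addle _ _ _); rewrite ?cmod_ge0 ?(ltW p0)//.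
  rewrite ge0_ler_powR ?nnegrE ?addr_ge0 ?cmod_ge0 ?(ltW p0)//.
  have -> : ddist (fun th => (complex.Im (f (circ th)))%:C%C) psi th =
     cmod ('i%C * ((complex.Im (f (circ th)))%:C%C - psi (circ th))).
    rewrite cmodM (_ : cmod 'i%C = 1) ?mul1r//.
    by rewrite /cmod /= expr0n /= add0r expr1n sqrtr1.
  rewrite (le_trans _ (cmodD _ _))// le_eqVlt; apply/orP; left; apply/eqP; congr cmod.
  by rewrite {1}[f (circ th)]complexE /w /fadd /fscal; ring.
have ib := IntZ (2 `^ p) (IntD i1 i2).
have mw : measC (fminus f w) by apply: measC_minus => //; exact: TP_meas.
have ih : Int (fun th => cmod (f (circ th) - w (circ th)) `^ p).
  apply: Int_le ib _; first exact: (meas_powcmod p mw).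
  by move=> th _; rewrite ger0_norm ?powR_ge0.
apply: le_lt_trans (le_intg ih ib (fun th _ => b th)) _.
rewrite intgZ; last exact: IntD.
rewrite intgD// -ltr_pdivlMl//.
apply: lt_le_trans (ltrD l1 l2) _.
by rewrite -mulr2n -mulr_natl le_eqVlt; apply/orP; left; apply/eqP; field; rewrite gt_eqF.
Qed.

End density.

(** * The [L^p] norm, with the inequalities of Minkowski and Hölder *)

HB.lock Definition nrm {R : realType} (p : R) (f : fn R) : R :=
  intg (fun th => cmod (f (circ th)) `^ p) `^ p^-1.

Section norm.
Context {R : realType}.
Local Notation mu := (@lebesgue_measure R).
Local Notation D := (@I02 R).
Local Notation C := R[i].
Implicit Types f g : fn R.

Lemma Lnorm_D (p : R) (u : R -> R) : 0 < p -> (forall th, 0 <= u th) ->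
  Int (fun th => u th `^ p) ->
  Lnorm mu p%:E (EFin \o (u \_ D)) = (intg (fun th => u th `^ p) `^ p^-1)%:E.
Proof.
move=> p0 u0 iu; rewrite unlock /=.
rewrite (_ : (\int[mu]_x _)%E = (\int[mu]_(th in D) (u th `^ p)%:E)%E).
  by rewrite intg_EFin.
rewrite [RHS]integral_mkcond; apply: eq_integral => th _ /=.
rewrite !patchE; case: ifPn => _ /=; first by rewrite ger0_norm.
by rewrite normr0 powR0// gt_eqF.
Qed.

Lemma meas_patch (u : R -> R) : measurable_fun D u -> measurable_fun setT (u \_ D).
Proof. by move=> mu_; apply/(measurable_restrictT _ measurable_D). Qed.

Lemma minkowski_D (p : R) (u v : R -> R) : 1 <= p -> measurable_fun D u -> measurable_fun D v ->
  (forall th, 0 <= u th) -> (forall th, 0 <= v th) ->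
  Int (fun th => u th `^ p) -> Int (fun th => v th `^ p) ->
  Int (fun th => (u th + v th) `^ p) ->
  intg (fun th => (u th + v th) `^ p) `^ p^-1 <=
  intg (fun th => u th `^ p) `^ p^-1 + intg (fun th => v th `^ p) `^ p^-1.
Proof.
move=> p1 mu_ mv u0 v0 iu iv iuv; have p0 : 0 < p by exact: lt_le_trans p1.
have := @minkowski_EFin _ _ _ mu (u \_ D) (v \_ D) p (meas_patch mu_) (meas_patch mv) p1.
rewrite (_ : (EFin \o ((u \_ D) \+ (v \_ D))%R) = EFin \o ((fun th => u th + v th) \_ D)).
  have uv0 th : 0 <= u th + v th by exact: addr_ge0.
  by rewrite !Lnorm_D// -EFinD lee_fin.
by apply/funext => th /=; rewrite !patchE; case: ifP; rewrite // addr0.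
Qed.

Lemma hoelder_D (p q : R) (u v : R -> R) : 0 < p -> 0 < q -> p^-1 + q^-1 = 1 ->
  measurable_fun D u -> measurable_fun D v ->
  (forall th, 0 <= u th) -> (forall th, 0 <= v th) ->
  Int (fun th => u th `^ p) -> Int (fun th => v th `^ q) ->
  Int (fun th => u th * v th) /\
  intg (fun th => u th * v th) <=
    intg (fun th => u th `^ p) `^ p^-1 * intg (fun th => v th `^ q) `^ q^-1.
Proof.
move=> p0 q0 pq mu_ mv u0 v0 iu iv.
have iuv : Int (fun th => u th * v th).
  apply: Int_le (IntD (IntZ p^-1 iu) (IntZ q^-1 iv)) _; first exact: measurable_funM.
  move=> th _; rewrite ger0_norm ?mulr_ge0//.
  by rewrite mulrC [X in _ + X]mulrC [X in X + _]mulrC mulrC; apply: conjugate_powR.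
split=> //.
have := @hoelder _ _ _ mu (u \_ D) (v \_ D) p q (meas_patch mu_) (meas_patch mv) p0 q0 pq.
rewrite (_ : (EFin \o ((u \_ D) \* (v \_ D))%R) = EFin \o ((fun th => u th * v th) \_ D)).
  rewrite !Lnorm_D//.
  - rewrite invr1 powRr1; first by rewrite -EFinM lee_fin; under eq_fun do rewrite powRr1 ?mulr_ge0//.
    by apply: intg_ge0 => th _; exact: powR_ge0.
  - by move=> th; exact: mulr_ge0.
  - by apply: eq_Int iuv => th _; rewrite powRr1// mulr_ge0.
by apply/funext => th /=; rewrite !patchE; case: ifP; rewrite // mulr0.
Qed.

Lemma nrmE p f : nrm p f = intg (fun th => cmod (f (circ th)) `^ p) `^ p^-1.
Proof. by rewrite nrm.unlock. Qed.

Lemma nrm_ge0 p f : 0 <= nrm p f.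
Proof. by rewrite nrmE; exact: powR_ge0. Qed.

Lemma nrm_pow p f : 0 < p -> nrm p f `^ p = intg (fun th => cmod (f (circ th)) `^ p).
Proof.
move=> p0; rewrite !nrmE -powRrM mulVf ?gt_eqF// powRr1//.
by apply: intg_ge0 => th _; exact: powR_ge0.
Qed.

Lemma nrm_eq p f g : (forall th, D th -> f (circ th) = g (circ th)) -> nrm p f = nrm p g.
Proof. by move=> fg; rewrite !nrmE; congr powR; apply: eq_intg => th Dth; rewrite fg. Qed.

Lemma nrm_add p f g : 1 <= p -> LL p f -> LL p g ->
  nrm p (fadd f g) <= nrm p f + nrm p g.
Proof.
move=> p1 Lf Lg; have p0 : 0 < p by exact: lt_le_trans p1.
have /LpP[mfg ifg] := Lp_add (ltW p0) Lf Lg.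
have /LpP[mf jf] := Lf; have /LpP[mg jg] := Lg.
have is_ : Int (fun th => (cmod (f (circ th)) + cmod (g (circ th))) `^ p).
  apply: Int_le (IntZ (2 `^ p) (IntD jf jg)) _.
    by apply: meas_pow; apply: measurable_funD; exact: meas_cmod.
  by move=> th _; rewrite ger0_norm ?powR_ge0// powR_addle ?cmod_ge0// ltW.
rewrite !nrmE; apply: le_trans (minkowski_D p1 (meas_cmod mf) (meas_cmod mg) _ _ jf jg is_).
- rewrite ge0_ler_powR ?nnegrE ?invr_ge0 ?(ltW p0)//.
  + by apply: intg_ge0 => th _; exact: powR_ge0.
  + by apply: intg_ge0 => th _; exact: powR_ge0.
  + apply: le_intg => // th _; rewrite ge0_ler_powR ?nnegrE ?addr_ge0 ?cmod_ge0 ?(ltW p0)//.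
    exact: cmodD.
- by move=> th; exact: cmod_ge0.
- by move=> th; exact: cmod_ge0.
Qed.

Lemma nrmZ p k f : 0 < p -> LL p f -> nrm p (fscal k f) = cmod k * nrm p f.
Proof.
move=> p0 /LpP[mf jf]; rewrite !nrmE.
rewrite (@eq_intg _ _ (fun th => cmod k `^ p * cmod (f (circ th)) `^ p)).
  rewrite intgZ// powRM ?powR_ge0//; last by apply: intg_ge0 => th _; exact: powR_ge0.
  by rewrite -powRrM mulfV ?gt_eqF// powRr1// cmod_ge0.
by move=> th _; rewrite /fscal cmodM powRM// cmod_ge0.
Qed.

Lemma nrmB p f g : 1 <= p -> LL p f -> LL p g ->
  nrm p (fminus f g) <= nrm p f + nrm p g.
Proof.
move=> p1 Lf Lg; have p0 : 0 < p by exact: lt_le_trans p1.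
rewrite (_ : fminus f g = fadd f (fscal (-1) g)).
  apply: le_trans (nrm_add p1 Lf (Lp_scal _ Lg)) _.
  by rewrite nrmZ// cmodN cmod1 mul1r.
by apply/funext => z; rewrite /fadd /fscal /fminus mulN1r.
Qed.

Lemma nrm_cst0 p : 0 < p -> nrm p (@fcst R 0) = 0.
Proof.
move=> p0; rewrite !nrmE (@eq_intg _ _ (fun=> 0)).
  by rewrite intg_cst mul0r powR0// invr_eq0 gt_eqF.
by move=> th _; rewrite /fcst cmod0 powR0// gt_eqF.
Qed.

Lemma nrm_aeeq p f g : measC f -> measC g -> aeeq f g -> nrm p f = nrm p g.
Proof.
move=> mf mg /aeeqP e; rewrite !nrmE; congr powR; apply: ae_eq_intg; [exact: meas_powcmod..|].
by apply: aeDW e => th _ ->.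
Qed.

Lemma nrm_eq0 p f : 0 < p -> LL p f -> nrm p f = 0 -> aeeq f (fcst 0).
Proof.
move=> p0 /LpP[mf jf] /eqP; rewrite nrmE powR_eq0 => /andP[/eqP h _].
apply/aeeqP; apply: aeDW (intg_eq0 jf _ h).
  by move=> th _ /eqP; rewrite powR_eq0 cmod_eq0 => /andP[/eqP].
by move=> th _; exact: powR_ge0.
Qed.

Lemma nrm_mono p f g : 0 < p -> LL p f -> LL p g ->
  aeD (fun th => cmod (f (circ th)) <= cmod (g (circ th))) -> nrm p f <= nrm p g.
Proof.
move=> p0 /LpP[mf jf] /LpP[mg jg] h.
rewrite !nrmE ge0_ler_powR ?nnegrE ?invr_ge0 ?(ltW p0)//.
- by apply: intg_ge0 => th _; exact: powR_ge0.
- by apply: intg_ge0 => th _; exact: powR_ge0.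
pose m th := Num.max (cmod (f (circ th)) `^ p) (cmod (g (circ th)) `^ p).
have mm : measurable_fun D m by apply: measurable_maxr; exact: meas_powcmod.
have e : aeD (fun th => cmod (g (circ th)) `^ p = m th).
  apply: aeDW h => th _ h; apply/esym/max_idPr.
  by rewrite ge0_ler_powR ?nnegrE ?cmod_ge0 ?(ltW p0).
rewrite [leRHS](ae_eq_intg _ mm e); last exact: meas_powcmod.
apply: le_intg => //; first exact: ae_Int e jg.
by move=> th _; rewrite /m le_max lexx.
Qed.

Lemma nrm_mulinf p f : 1 <= p -> Linf f -> exists2 M, 0 <= M &
  forall g, LL p g -> nrm p (fmul f g) <= M * nrm p g.
Proof.
move=> p1 Lf; have p0 : 0 < p by exact: lt_le_trans p1.
have [M M0 hM] := Linf_bound Lf; exists M => // g Lg.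
have -> : M * nrm p g = nrm p (fscal M%:C%C g) by rewrite nrmZ// cmod_real ger0_norm.
apply: nrm_mono => //; [by apply: Lp_mulinf => //; exact: ltW|exact: Lp_scal|].
apply: aeDW hM => th _ hM; rewrite /fmul /fscal !cmodM cmod_real ger0_norm//.
by rewrite ler_wpM2r// cmod_ge0.
Qed.

Lemma nrm_tilde p f : LL p f -> nrm p (tilde f) = nrm p f.
Proof.
move=> /LpP[mf jf]; rewrite !nrmE; congr powR; rewrite -(intg_refl jf).
by apply: eq_intg => th _; rewrite circ_refl.
Qed.

(** With [t = nrm p f], the inequality [x <= 1 + x^p] at [x = |f| / t] gives
    [|f| <= t + t t^-p |f|^p]; the two terms integrate to [2 pi t] and [t]. *)
Lemma intg_le_nrm p f : 1 <= p -> LL p f ->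
  intg (fun th => cmod (f (circ th))) <= (2 * pi + 1) * nrm p f.
Proof.
move=> p1 Lf; have p0 : 0 < p by exact: lt_le_trans p1.
have [n0|n0] := eqVneq (nrm p f) 0.
  have /aeeqP e := nrm_eq0 p0 Lf n0.
  rewrite n0 mulr0 (@ae_eq_intg _ _ (fun=> 0)) ?intg_cst ?mul0r//.
    by case/LpP: Lf => mf _; exact: meas_cmod.
  by apply: aeDW e => th _ ->; rewrite cmod0.
have t0 : 0 < nrm p f by rewrite lt_def n0 nrm_ge0.
have /LpP[mf jf] := Lf; set t := nrm p f in n0 t0 *.
have i1 := L1_cmod (Lp_Lp1 p1 Lf).
have i2 := IntD (Int_cst t) (IntZ (t * t `^ (- p)) jf).
apply: le_trans (le_intg i1 i2 _) _ => [th _|].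
  have := @powR_leD1 _ p (cmod (f (circ th)) / t) p1.
  rewrite divr_ge0 ?cmod_ge0 ?(ltW t0)// => /(_ isT).
  rewrite ler_pdivrMr// => /le_trans; apply.
  rewrite mulrC mulrDr mulr1 lerD2l powRM ?cmod_ge0 ?invr_ge0 ?(ltW t0)//.
  by rewrite -powR_inv1 ?(ltW t0)// -powRrM mulN1r [X in _ * X]mulrC mulrA.
rewrite intgD; [|exact: Int_cst|exact: IntZ].
rewrite intg_cst intgZ// -nrm_pow// -/t -mulrA -powRD.
  by rewrite addNr powRr0 mulr1 le_eqVlt; apply/orP; left; apply/eqP; ring.
by apply/implyP => _.
Qed.

Lemma coef_nrm p f n : 1 <= p -> LL p f ->
  cmod (coef f n) <= pi^-1 * (2 * pi + 1) * nrm p f.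
Proof.
move=> p1 Lf; apply: le_trans (coef_norm n (Lp_Lp1 p1 Lf)) _.
by rewrite -mulrA ler_wpM2l ?invr_ge0 ?pi_ge0// intg_le_nrm.
Qed.

End norm.

(** * Completeness of [L^p] *)

Section completeness.
Context {R : realType}.
Local Notation mu := (@lebesgue_measure R).
Local Notation D := (@I02 R).
Local Notation C := R[i].

(** Monotone convergence in the extended reals: the limit has integral at most [M], hence is finite
    almost everywhere, and [fine] makes it a real function. *)
Lemma monotone_dominated (u_ : nat -> R -> R) (M : R) : (forall n, Int (u_ n)) ->
  (forall n th, 0 <= u_ n th) ->
  (forall n m th, (n <= m)%N -> u_ n th <= u_ m th) -> (forall n, intg (u_ n) <= M) ->
  exists2 g, Int g & aeD (fun th => forall n, u_ n th <= g th).
Proof.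
move=> iu u0 nd uM.
pose a n th : \bar R := (u_ n th)%:E.
have ma n : measurable_fun D (a n) by apply/measurable_EFinP; exact: Int_meas.
have a0 n th : D th -> (0 <= a n th)%E by rewrite lee_fin.
have nda th : D th -> {homo a ^~ th : n m / (n <= m)%N >-> (n <= m)%E}.
  by move=> _ n m nm; rewrite lee_fin; exact: nd.
have mc := monotone_convergence mu measurable_D ma a0 nda.
pose G th := limn (a ^~ th).
have cvG th : D th -> a n th @[n --> \oo] --> G th.
  by move=> Dth; apply: ereal_nondecreasing_is_cvgn; exact: nda.
have mG : measurable_fun D G.
  by apply: (@emeasurable_fun_cvg _ _ _ D a G) => // th Dth; exact: cvG.
have aG n th : D th -> (a n th <= G th)%E.
  move=> Dth; apply: lime_ge; first by apply: ereal_nondecreasing_is_cvgn; exact: nda.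
  by exists n => // m /= nm; exact: nda.
have G0 th : D th -> (0 <= G th)%E by move=> Dth; exact: le_trans (a0 0%N _ Dth) (aG _ _ Dth).
have iG : mu.-integrable D G.
  apply/integrableP; split => //.
  rewrite (_ : (\int[mu]_(x in D) _ = \int[mu]_(x in D) G x)%E); last first.
    by apply: eq_integral => th /set_mem Dth; rewrite gee0_abs// G0.
  rewrite [X in (X < _)%E]mc; apply: (@le_lt_trans _ _ M%:E); last exact: ltry.
  apply: lime_le.
    apply: ereal_nondecreasing_is_cvgn => n m nm; apply: ge0_le_integral.
    - exact: measurable_D.
    - by move=> th Dth; exact: a0.
    - exact: ma.
    - exact: ma.
    - by move=> th Dth; exact: nda.
  by apply: nearW => n; rewrite /a intg_EFin// lee_fin.
have fG := integrable_ae measurable_D iG.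
pose g th := fine (G th).
exists g.
  rewrite IntE; apply/integrableP; split.
    by apply/measurable_EFinP; apply: measurableT_comp.
  case/integrableP : iG => _; apply: le_lt_trans; apply: ge0_le_integral => //.
  - exact: measurable_D.
  - by apply: measurableT_comp => //; apply/measurable_EFinP; apply: measurableT_comp.
  - by apply: measurableT_comp.
  - by move=> th Dth; rewrite /= /g; case: (G th) => [r| |] //=; rewrite ?leey.
rewrite aeDE; move: fG; apply: filterS => th fG Dth n.
by rewrite -lee_fin /g fineK ?fG//; exact: aG.
Qed.

Lemma abs_series_cvg (u b : nat -> R) (M : R) : (forall i, `|u i| <= b i) ->
  (forall n, \sum_(i < n) b i <= M) -> cvgn (fun n => \sum_(i < n) u i).
Proof.
move=> ub bM.
have h : cvgn [normed series u].
  apply: nondecreasing_is_cvgn.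
    by apply: nondecreasing_series => i _ _ /=.
  exists M => _ [n _ <-]; apply: le_trans (bM n); rewrite /= seriesEord /=.
  exact: ler_sum.
suff -> : (fun n => \sum_(i < n) u i) = series u by exact: normed_cvg.
by apply/funext => n; rewrite seriesEord.
Qed.

Local Notation psum f_ n := (fun z => \sum_(i < n) (f_ : nat -> fn R) i z).

Lemma LL_psum p (f_ : nat -> fn R) n : 1 <= p -> (forall i, LL p (f_ i)) ->
  LL p (psum f_ n).
Proof.
move=> p1 Lf; elim: n => [|n IH].
  rewrite (_ : psum _ _ = fcst 0).
    by apply: Linf_Lp; [lra|exact: (TP_Linf (TP_cst 0))].
  by apply/funext => z; rewrite big_ord0.
rewrite (_ : psum _ _ = fadd (psum f_ n) (f_ n)); first by apply: Lp_add => //; lra.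
by apply/funext => z; rewrite big_ord_recr.
Qed.

Lemma nrm_psum p (f_ : nat -> fn R) n : 1 <= p -> (forall i, LL p (f_ i)) ->
  nrm p (psum f_ n) <= \sum_(i < n) nrm p (f_ i).
Proof.
move=> p1 Lf; elim: n => [|n IH].
  rewrite big_ord0 (_ : psum _ _ = fcst 0) ?nrm_cst0//; first lra.
  by apply/funext => z; rewrite big_ord0.
rewrite (_ : psum _ _ = fadd (psum f_ n) (f_ n)).
  rewrite big_ord_recr /=; apply: le_trans (nrm_add p1 (LL_psum n p1 Lf) (Lf n)) _.
  by rewrite lerD2r.
by apply/funext => z; rewrite big_ord_recr.
Qed.

Lemma sum_half (n : nat) : \sum_(i < n) (2^-1 : R) ^+ i <= 2.
Proof.
suff -> : \sum_(i < n) (2^-1 : R) ^+ i = 2 - 2 * 2^-1 ^+ n.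
  by rewrite gerBl mulr_ge0// exprn_ge0.
elim: n => [|n IH]; first by rewrite big_ord0 expr0; lra.
by rewrite big_ord_recr /= IH exprS; set x := _ ^+ n; lra.
Qed.

(** The Riesz-Fischer argument. The partial sums of the moduli have norm at most 2, so
    [monotone_dominated] bounds their [p]-th powers by one integrable [g]. The series then converges
    absolutely almost everywhere, and [g] also provides the majorant for convergence in norm. *)
Lemma LL_complete0 p (f_ : nat -> fn R) : 1 <= p -> (forall n, LL p (f_ n)) ->
  (forall n, nrm p (f_ n) <= 2^-1 ^+ n) ->
  exists f, LL p f /\ nrm p (fminus f (psum f_ n)) @[n --> \oo] --> (0 : R).
Proof.
move=> p1 Lf bf; have p0 : 0 < p by exact: lt_le_trans p1.
have pn0 : p != 0 by rewrite gt_eqF.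
pose b i (z : C) : R := cmod (f_ i z).
pose A n (z : C) : R := \sum_(i < n) b i z.
have A0 n z : 0 <= A n z by apply: sumr_ge0 => i _; exact: cmod_ge0.
have And n m z : (n <= m)%N -> A n z <= A m z.
  move=> nm; rewrite -(subnKC nm); elim: (m - n)%N => [|k IH]; first by rewrite addn0.
  by rewrite addnS (le_trans IH)// /A big_ord_recr /= lerDl cmod_ge0.
pose Ac n : fn R := fun z => (A n z)%:C%C.
have cAc n z : cmod (Ac n z) = A n z by rewrite cmod_real ger0_norm.
pose bc i : fn R := fun z => (b i z)%:C%C.
have cbc i z : cmod (bc i z) = b i z by rewrite cmod_real ger0_norm// cmod_ge0.
have Lb i : LL p (bc i).
  have /LpP[mi ii] := Lf i; apply/LpP; split.
    by rewrite measCE; split; [exact: meas_cmod|exact: measurable_cst].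
  by apply: eq_Int ii => th _; rewrite cbc.
have AcE n : Ac n = psum bc n.
  by apply/funext => z; rewrite /Ac /A rmorph_sum.
have LA n : LL p (Ac n) by rewrite AcE; exact: LL_psum.
have nA n : nrm p (Ac n) <= 2.
  rewrite AcE; apply: le_trans (nrm_psum n p1 Lb) _.
  apply: le_trans (sum_half n); apply: ler_sum => i _; apply: le_trans (bf i).
  rewrite le_eqVlt; apply/orP; left; apply/eqP; rewrite !nrmE; congr powR; apply: eq_intg => th _.
  by rewrite cbc.
have [g ig hg] : exists2 g, Int g & aeD (fun th => forall n, A n (circ th) `^ p <= g th).
  apply: (@monotone_dominated _ (2 `^ p)).
  - by move=> n; have /LpP[_] := LA n; apply: eq_Int => th _; rewrite cAc.
  - by move=> n th; exact: powR_ge0.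
  - by move=> n m th nm; rewrite ge0_ler_powR ?nnegrE ?(ltW p0) ?A0 ?And.
  - move=> n; have -> : intg (fun th => A n (circ th) `^ p) = nrm p (Ac n) `^ p.
      by rewrite nrm_pow//; apply: eq_intg => th _; rewrite cAc.
    by rewrite ge0_ler_powR ?nnegrE ?nrm_ge0 ?(ltW p0).
(* The set of absolute convergence. The limit is declared 0 off it, and its indicator is used below
   to see that [F] is measurable. *)
pose B (z : C) : bool := `[< exists M, forall n, A n z <= M >].
have Bae : aeD (fun th => B (circ th)).
  apply: aeDW hg => th _ hg; apply/asboolP; exists (g th `^ p^-1) => n.
  rewrite -[leLHS](@powRr1 _ (A n (circ th)))// -(mulfV pn0) powRrM.
  by rewrite ge0_ler_powR ?nnegrE ?invr_ge0 ?powR_ge0 ?(ltW p0)// (le_trans _ (hg 0%N))// powR_ge0.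
pose S n : fn R := psum f_ n.
have LS n : LL p (S n) by exact: LL_psum.
pose F : fn R := fun z => if B z then
  (limn (fun n => complex.Re (S n z)) +i* limn (fun n => complex.Im (S n z)))%C else 0.
have reS n z : complex.Re (S n z) = \sum_(i < n) complex.Re (f_ i z).
  by rewrite /S; elim: n => [|n IH]; rewrite ?big_ord0// !big_ord_recr /= cReD IH.
have imS n z : complex.Im (S n z) = \sum_(i < n) complex.Im (f_ i z).
  by rewrite /S; elim: n => [|n IH]; rewrite ?big_ord0// !big_ord_recr /= cImD IH.
have cvre z : B z -> complex.Re (S n z) @[n --> \oo] --> complex.Re (F z).
  move=> Bz; rewrite /F Bz /=; have /asboolP[M hM] := Bz.
  suff : cvgn (fun n => complex.Re (S n z)) by [].
  rewrite (_ : (fun n => _) = (fun n => \sum_(i < n) complex.Re (f_ i z))); last first.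
    by apply/funext => n; rewrite reS.
  exact: (@abs_series_cvg (fun i => complex.Re (f_ i z)) (b ^~ z) M (fun i => Re_cmod _) hM).
have cvim z : B z -> complex.Im (S n z) @[n --> \oo] --> complex.Im (F z).
  move=> Bz; rewrite /F Bz /=; have /asboolP[M hM] := Bz.
  suff : cvgn (fun n => complex.Im (S n z)) by [].
  rewrite (_ : (fun n => _) = (fun n => \sum_(i < n) complex.Im (f_ i z))); last first.
    by apply/funext => n; rewrite imS.
  exact: (@abs_series_cvg (fun i => complex.Im (f_ i z)) (b ^~ z) M (fun i => Im_cmod _) hM).
have mE : measurable_fun D (fun th => (B (circ th))%:R : R).
  have mAn n : measurable_fun D (fun th => A n (circ th)).
    have /LpP[mm _] := LA n; have := meas_cmod mm.
    by congr (measurable_fun _ _); apply/funext => th; rewrite cAc.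
  pose E : set R := \bigcup_M \bigcap_n (D `&` (fun th => A n (circ th)) @^-1` `]-oo, (M%:R : R)]).
  have mE : measurable E.
    apply: bigcupT_measurable => M; apply: bigcapT_measurable => n.
    by apply: mAn; [exact: measurable_D|exact: measurable_itv].
  apply: (@eq_measurable_fun _ _ _ _ D (\1_E : R -> R)); last exact: meas_indic.
  move=> th /set_mem Dth; rewrite indicE; congr ((_ : bool)%:R); apply/idP/idP.
    move=> /set_mem[M _ h]; apply/asboolP; exists M%:R => n.
    by have [_] := h n I; rewrite /= in_itv.
  move=> /asboolP[M hM]; apply/mem_set; exists (Num.truncn M).+1 => // n _; split => //=.
  by rewrite in_itv /= (le_trans (hM n))// ltW// truncnS_gt.
have mF : measC F.
  rewrite measCE; split.
  - apply: (@measurable_fun_cvg _ _ _ D (fun n th => (B (circ th))%:R * complex.Re (S n (circ th)))).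
      move=> n; apply: measurable_funM => //.
      by have /LpP[] := LS n; rewrite measCE => -[].
    move=> th Dth; have [Bz|nB] := boolP (B (circ th)).
      under eq_fun do rewrite mul1r; exact: cvre.
    rewrite /F (negbTE nB) /=; under eq_fun do rewrite mul0r; exact: cvg_cst.
  - apply: (@measurable_fun_cvg _ _ _ D (fun n th => (B (circ th))%:R * complex.Im (S n (circ th)))).
      move=> n; apply: measurable_funM => //.
      by have /LpP[] := LS n; rewrite measCE => -[].
    move=> th Dth; have [Bz|nB] := boolP (B (circ th)).
      under eq_fun do rewrite mul1r; exact: cvim.
    rewrite /F (negbTE nB) /=; under eq_fun do rewrite mul0r; exact: cvg_cst.
have SA n z : cmod (S n z) <= A n z by exact: cmod_sum.
have cvd z : B z -> cmod (F z - S n z) @[n --> \oo] --> (0 : R).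
  move=> Bz.
  apply: (@cvg_dist0 _ _ (fun n => `|complex.Re (F z) - complex.Re (S n z)| +
      `|complex.Im (F z) - complex.Im (S n z)|)).
    move=> n; rewrite sub0r normrN ger0_norm ?cmod_ge0//.
    by rewrite (le_trans (cmod_ReIm _))// cReD cImD cReN cImN.
  rewrite -[X in _ --> X](addr0 0); apply: cvgD.
    have -> : (0 : R) = `|complex.Re (F z) - complex.Re (F z)| by rewrite subrr normr0.
    by apply: cvg_norm; apply: cvgB; [exact: cvg_cst|exact: cvre].
  have -> : (0 : R) = `|complex.Im (F z) - complex.Im (F z)| by rewrite subrr normr0.
  by apply: cvg_norm; apply: cvgB; [exact: cvg_cst|exact: cvim].
(* Obtained by comparing [F] with a partial sum arbitrarily close to it, at the price of the factor
   [2^p] of [powR_addle]. *)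
have FA th : B (circ th) -> (forall n, A n (circ th) `^ p <= g th) ->
    cmod (F (circ th)) `^ p <= 2 `^ p * g th.
  move=> Bz hgz; apply/ler_addgt0Pr => e e0.
  have k0 : 0 < 2 `^ p :> R by rewrite powR_gt0.
  have := cvg_powR0 p0 (fun n => cmod_ge0 _) (cvd _ Bz).
  move=> /cvgr0_norm_lt/(_ _ (divr_gt0 e0 k0))[N _ /(_ N (leqnn N))] /=.
  rewrite ger0_norm ?powR_ge0// => h.
  apply: (@le_trans _ _ (2 `^ p * (cmod (S N (circ th)) `^ p + cmod (F (circ th) - S N (circ th)) `^ p))).
    apply: le_trans (powR_addle (ltW p0) (cmod_ge0 _) (cmod_ge0 _)).
    rewrite ge0_ler_powR ?nnegrE ?addr_ge0 ?cmod_ge0 ?(ltW p0)//.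
    by rewrite (le_trans _ (cmodD _ _))// addrC subrK.
  rewrite mulrDr lerD//.
    rewrite ler_pM2l// (le_trans _ (hgz N))// ge0_ler_powR ?nnegrE ?cmod_ge0 ?(ltW p0)//.
  by rewrite -ler_pdivlMl// mulrC ltW.
have LF : LL p F.
  apply/LpP; split => //; apply: (@ae_Int_le _ _ (fun th => 2 `^ p * g th)).
  - exact: meas_powcmod.
  - exact: IntZ.
  - apply: aeDW (aeD_and Bae hg) => th _ [Bz hz].
    by rewrite ger0_norm ?powR_ge0// FA.
exists F; split => //.
have key : intg (fun th => cmod (F (circ th) - S n (circ th)) `^ p) @[n --> \oo] --> (0 : R).
  have := @ae_intg_dominated _ (fun n th => cmod (F (circ th) - S n (circ th)) `^ p) (fun=> 0)
    (fun th => 2 `^ p * (2 `^ p * g th + g th)).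
  case.
  - move=> n; have /LpP[mm _] := LS n; exact: (meas_powcmod p (measC_minus mF mm)).
  - exact: measurable_cst.
  - apply: aeDW Bae => th _ Bz; apply: cvg_powR0 => //; last exact: cvd.
    by move=> n; exact: cmod_ge0.
  - by apply: IntZ; apply: IntD => //; exact: IntZ.
  - apply: aeDW (aeD_and Bae hg) => th _ [Bz hz] n.
    rewrite ger0_norm ?powR_ge0//.
    apply: (@le_trans _ _ (2 `^ p * (cmod (F (circ th)) `^ p + cmod (S n (circ th)) `^ p))).
      apply: le_trans (powR_addle (ltW p0) (cmod_ge0 _) (cmod_ge0 _)).
      by rewrite ge0_ler_powR ?nnegrE ?addr_ge0 ?cmod_ge0 ?(ltW p0)// cmodB.
    rewrite ler_wpM2l ?powR_ge0// lerD// ?FA// (le_trans _ (hz n))//.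
    by rewrite ge0_ler_powR ?nnegrE ?cmod_ge0 ?(ltW p0).
  - by rewrite intg_cst mul0r.
have pi0 : 0 < p^-1 by rewrite invr_gt0.
under eq_fun do rewrite nrmE.
apply: (cvg_powR0 pi0 _ key) => n; apply: intg_ge0 => th _; exact: powR_ge0.
Qed.

End completeness.

(** * Mean value property of analytic polynomials *)

Section analytic_polynomials.
Context {R : realType}.
Local Notation D := (@I02 R).
Local Notation C := R[i].
Implicit Types (A : {poly C}).

Lemma TP_horner A : TP (horner A).
Proof.
elim/poly_ind: A => [|P c IH]; first by apply: TP_eq (TP_cst 0) => th; rewrite horner0.
apply: TP_eq (TP_add (TP_mul IH (TP_tpow 1)) (TP_cst c)) => th.
by rewrite hornerMXaddC /fadd /fmul /tpow expr1z.
Qed.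

Lemma cmean_horner A : cmean (horner A) = A.[0].
Proof.
(* The extra power of [z] makes the induction work: passing from [P] to [P * 'X + c] raises [k] by
   one on [P]. *)
suff h (k : nat) : cmean (fmul (tpow k) (horner A)) = (k == 0%N)%:R * A.[0].
  rewrite -[RHS]mul1r -(h 0%N); apply: cmean_eq => th.
  by rewrite /fmul /tpow expr0z mul1r.
elim/poly_ind: A k => [|P c IH] k.
  rewrite horner0 mulr0 -[RHS](@cmean_cst R 0); apply: cmean_eq => th.
  by rewrite /fmul horner0 mulr0.
rewrite (_ : fmul _ _ = fadd (fmul (tpow k.+1) (horner P)) (fscal c (tpow k))); last first.
  apply/funext => z; rewrite /fadd /fmul /fscal /tpow hornerMXaddC.
  by rewrite -!exprnP exprS; ring.
have Lt n : LL 1 (@tpow R n) by apply: Linf_Lp => //; exact: Linf_tpow.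
rewrite cmeanD ?cmeanZ ?IH ?cmean_tpow//.
- by rewrite hornerMXaddC mulr0 add0r mul0r add0r mulrC.
- by apply: Linf_Lp => //; apply: TP_Linf; apply: TP_mul; [exact: TP_tpow|exact: TP_horner].
- exact: Lp_scal.
Qed.

Lemma L1_horner A : LL 1 (horner A).
Proof. by apply: TP_Lp => //; exact: TP_horner. Qed.

Lemma LL_horner p A : 0 <= p -> LL p (horner A).
Proof. by move=> p0; apply: TP_Lp => //; exact: TP_horner. Qed.

Lemma Re_cmean (f : fn R) : complex.Re (cmean f) =
  (2 * pi)^-1 * intg (fun th => complex.Re (f (circ th))).
Proof. by rewrite cmeanE. Qed.

Lemma real_Im0 (z : C) : complex.Im z = 0 -> z = (complex.Re z)%:C%C.
Proof. by case: z => a b /= ->. Qed.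

(* Expanding [1 / (A + s)] in a geometric series of polynomials, the mean is
   [A(0)^2 / (A(0) + s)]. *)
Lemma mean_sqr_div_ge0 A (s : R) : 0 < s -> complex.Im A.[0] = 0 ->
  (forall th, 0 <= complex.Re A.[circ th]) ->
  0 <= intg (fun th => complex.Re (A.[circ th] ^+ 2 / (A.[circ th] + s%:C%C))).
Proof.
move=> s0 A0 Apos.
have [M M0 hM] := TP_bounded (TP_horner A).
(* A value [w] of [A + s] on the circle has [Re w >= s] and [|w| <= M + s]. For this [r] it follows
   that [|1 - w / r|^2 <= 1 - s / r], which is [rho^2], so the geometric series in [E] converges
   uniformly. *)
pose r := (M + s) ^+ 2 / s; have Ms0 : 0 < M + s by rewrite ltr_wpDl.
have r0 : 0 < r by rewrite divr_gt0 ?exprn_gt0.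
pose E : {poly C} := 1 - (r^-1)%:C%C *: (A + (s%:C%C)%:P).
have EE z : E.[z] = 1 - (r^-1)%:C%C * (A.[z] + s%:C%C).
  by rewrite /E hornerD hornerN hornerZ hornerD !hornerC.
pose rho := Num.sqrt (1 - (s / (M + s)) ^+ 2).
have sM : 0 < s / (M + s) <= 1.
  by rewrite divr_gt0//= ler_pdivrMr// mul1r lerDr.
have x01 : 0 <= 1 - (s / (M + s)) ^+ 2 < 1.
  case/andP: sM => h1 h2; rewrite subr_ge0 exprn_ile1 ?(ltW h1)//=.
  by rewrite gtrBl exprn_gt0.
have rho01 : 0 <= rho < 1.
  rewrite sqrtr_ge0 /= -[ltRHS](sqrtr1 R) ltr_sqrt//.
  by case/andP: x01.
have Erho th : cmod E.[circ th] <= rho.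
  have h : cmod E.[circ th] ^+ 2 <= 1 - (s / (M + s)) ^+ 2.
    have h1 := hM th; have u0 := Apos th.
    have em := sqr_cmod A.[circ th]; have m0 := cmod_ge0 A.[circ th].
    rewrite sqr_cmod; set u := complex.Re A.[circ th] in u0 em *.
    set v := complex.Im A.[circ th] in em *; set m := cmod _ in h1 m0 em *.
    have -> : complex.Re E.[circ th] = 1 - r^-1 * (u + s).
      by rewrite EE /u; case: (A.[circ th]) => a b /=; rewrite !mul0r subr0.
    have -> : complex.Im E.[circ th] = - (r^-1 * v).
      by rewrite EE /v; case: (A.[circ th]) => a b /=; rewrite !mul0r !addr0 sub0r.
    have hr : r * s = (M + s) ^+ 2 by rewrite /r divfK// gt_eqF.
    have -> : (s / (M + s)) ^+ 2 = s / r.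
      rewrite expr_div_n -hr; field; by rewrite !gt_eqF.
    rewrite -(ler_pM2l (mulr_gt0 r0 r0)).
    have -> : r * r * ((1 - r^-1 * (u + s)) ^+ 2 + (- (r^-1 * v)) ^+ 2) =
        (r - (u + s)) ^+ 2 + v ^+ 2 by field; rewrite gt_eqF.
    have -> : r * r * (1 - s / r) = r * r - r * s by field; rewrite gt_eqF.
    have mM : m ^+ 2 <= M ^+ 2 by rewrite ler_sqr ?nnegrE.
    have uM : u <= M.
      by apply: le_trans h1; rewrite -(@ler_sqr _) ?nnegrE// em lerDl sqr_ge0.
    have ru : 0 <= r * u by rewrite mulr_ge0// ltW.
    nra.
  by rewrite -(@ger0_norm _ (cmod _)) ?cmod_ge0// -sqrtr_sqr ler_wsqrtr.
pose g : fn R := fun z => A.[z] ^+ 2 / (A.[z] + s%:C%C).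
have Ags th : s <= cmod (A.[circ th] + s%:C%C).
  apply: le_trans (Re_cmod _); rewrite cReD /= ger0_norm ?lerDr//.
  by rewrite addr_ge0// ltW.
have nz th : A.[circ th] + s%:C%C != 0.
  by rewrite -cmod_eq0 gt_eqF// (lt_le_trans s0).
have mg : measC g.
  apply: (@measC_mul _ (fun z => A.[z] ^+ 2) (frecip (fun z => A.[z] + s%:C%C))).
    by apply: TP_meas; apply: TP_exp; exact: TP_horner.
  apply: measC_frecip; apply: TP_meas; apply: (TP_add (TP_horner A) (TP_cst _)).
have bg th : cmod (g (circ th)) <= M ^+ 2 / s.
  rewrite /g cmodM cmodV cmodX ler_pM ?invr_ge0 ?cmod_ge0 ?exprn_ge0 ?cmod_ge0//.
    by rewrite ler_sqr ?nnegrE ?cmod_ge0.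
  by rewrite lef_pV2 ?posrE// (lt_le_trans s0).
have Lg : LL 1 g.
  apply: Linf_Lp => //; apply: (@Linf_cmod _ _ (M ^+ 2 / s)) => //.
  by apply: aeD_all => th _; exact: bg.
pose G n : {poly C} := (r^-1)%:C%C *: (A ^+ 2 * \sum_(k < n) E ^+ k).
have GE n th : g (circ th) - (G n).[circ th] = g (circ th) * E.[circ th] ^+ n.
  rewrite /G hornerZ hornerM horner_exp horner_sum.
  under eq_bigr do rewrite horner_exp.
  set S := \sum_(_ < _) _; have hS : E.[circ th] ^+ n = 1 - (1 - E.[circ th]) * S.
    by have := subrX1 E.[circ th] n; rewrite -/S => h; rewrite -[LHS](subrK 1) h; ring.
  have e1 : 1 - E.[circ th] = (r^-1)%:C%C * (A.[circ th] + s%:C%C) by rewrite EE; ring.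
  rewrite hS e1 /g; have n0 := nz th; set w := A.[circ th] + _ in n0 *.
  by field; rewrite n0 andbT fmorph_eq0 gt_eqF.
have Gpos n : 0 <= complex.Re (cmean (horner (G n))).
  rewrite cmean_horner /G hornerZ hornerM horner_exp horner_sum.
  pose a := complex.Re A.[0]; have eA : A.[0] = a%:C%C := real_Im0 A0.
  rewrite eA.
  have a0 : 0 <= a.
    have -> : a = complex.Re (cmean (horner A)) by rewrite /a cmean_horner.
    by rewrite Re_cmean mulr_ge0 ?invr_ge0 ?(ltW pi2_gt0)//; apply: intg_ge0 => th _.
  (* The factor 2 is the loss in [cmean_norm]. It is harmless: [(2 M + s) s <= (M + s)^2] still
     gives [E(0) >= 0], so all terms of the partial sums are nonnegative at 0. *)
  have aM : a <= 2 * M.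
    have -> : a = complex.Re (cmean (horner A)) by rewrite /a cmean_horner.
    apply: le_trans (ler_norm _) _; apply: le_trans (Re_cmod _) _.
    apply: le_trans (cmean_norm (L1_horner A)) _.
    rewrite ler_pdivrMl ?pi_gt0//.
    apply: le_trans (le_intg (L1_cmod (L1_horner A)) (Int_cst M) (fun th _ => hM th)) _.
    by rewrite intg_cst mulrCA [pi * _]mulrC mulrA mulrC.
  have e0 : E.[0] = (1 - r^-1 * (a + s))%:C%C.
    by rewrite EE eA rmorphB /= rmorphM /= rmorphD /=.
  have e0pos : 0 <= 1 - r^-1 * (a + s).
    rewrite subr_ge0 ler_pdivrMl// mulr1 /r ler_pdivlMr//.
    have : 0 <= M * s by rewrite mulr_ge0// ltW.
    have : 0 <= M * M by rewrite mulr_ge0.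
    have := ler_wpM2r (ltW s0) aM; nra.
  under eq_bigr do rewrite horner_exp e0 -rmorphXn /=.
  rewrite -rmorph_sum -rmorphXn -!rmorphM /=.
  by rewrite mulr_ge0 ?invr_ge0 ?(ltW r0)// mulr_ge0 ?sqr_ge0// sumr_ge0// => k _; rewrite exprn_ge0.
suff h : 0 <= complex.Re (cmean g).
  by move: h; rewrite Re_cmean pmulr_rge0// invr_gt0 pi2_gt0.
rewrite leNgt; apply/negP => neg.
pose e := - complex.Re (cmean g); have e0 : 0 < e by rewrite oppr_gt0.
pose K := pi^-1 * (M ^+ 2 / s * (2 * pi)).
have cv : K * rho ^+ n @[n --> \oo] --> (0 : R).
  rewrite -[X in _ --> X](mulr0 K); apply: cvgM; first exact: cvg_cst.
  by apply: cvg_expr; case/andP: rho01 => h1 h2; rewrite ger0_norm.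
have /cvgr0_norm_lt/(_ _ e0)[N _ /(_ N (leqnn _)) /=] := cv.
apply/negP; rewrite -leNgt; apply: le_trans (ler_norm _).
have LG : LL 1 (fminus g (horner (G N))) by apply: Lp_minus => //; exact: L1_horner.
have : cmod (cmean (fminus g (horner (G N)))) <= K * rho ^+ N.
  apply: le_trans (cmean_norm LG) _; rewrite /K -mulrA ler_wpM2l ?invr_ge0 ?pi_ge0//.
  apply: le_trans (le_intg (L1_cmod LG) (Int_cst (M ^+ 2 / s * rho ^+ N)) _) _.
    move=> th _; rewrite /fminus GE cmodM ler_pM ?cmod_ge0// cmodX.
    by rewrite lerXn2r ?nnegrE ?cmod_ge0//; case/andP: rho01.
  by rewrite intg_cst mulrAC.
apply: le_trans; apply: le_trans (Re_cmod _); rewrite -normrN; apply: le_trans (ler_norm _).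
have -> : fminus g (horner (G N)) = fadd g (fscal (-1) (horner (G N))).
  by apply/funext => z; rewrite /fminus /fadd /fscal mulN1r.
rewrite cmeanD//; last by apply: Lp_scal; exact: L1_horner.
rewrite cmeanZ; last exact: L1_horner.
by rewrite mulN1r cReD cReN opprD opprK lerDl.
Qed.

End analytic_polynomials.

(** * The conjugate function of a nonnegative function: weak type estimate and dyadic summation *)

Section riesz_positive.
Context {R : realType}.
Local Notation D := (@I02 R).
Local Notation C := R[i].
Implicit Types (A : {poly C}).

Definition wker (s u v : R) : R :=
  (u * (u ^+ 2 + v ^+ 2) + s * (u ^+ 2 - v ^+ 2)) / ((u + s) ^+ 2 + v ^+ 2).

Lemma Re_sqr_div (z : C) (s : R) : 0 < s -> 0 <= complex.Re z ->
  complex.Re (z ^+ 2 / (z + s%:C%C)) = wker s (complex.Re z) (complex.Im z).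
Proof.
move=> s0; case: z => u v /= u0; rewrite /wker !addr0.
have N0 : (u + s) ^+ 2 + v ^+ 2 != 0.
  by rewrite gt_eqF// ltr_pwDl ?sqr_ge0// exprn_gt0// ltr_wpDl.
by rewrite expr2 /=; field.
Qed.

(** If [s < 2 u], the minimum is at least [u / 2] and dominates both [s] and the kernel, which is at
    most [5/4 u]. If [2 u <= s], the minimum is [u^2 / s]: for [|v| <= s] the kernel is at most
    that, and for [|v| > s] it is so negative, up to a multiple of [u^2 / s], that it absorbs the
    term [s]. The constants [13/2] and 25 leave room in both cases. *)
Lemma weak_pointwise (s u v : R) : 0 < s -> 0 <= u ->
  s * (s < `|v|)%R%:R + 13 / 2 * wker s u v <= 25 * Num.min u (u ^+ 2 / s).
Proof.
move=> s0 u0; set N := (u + s) ^+ 2 + v ^+ 2.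
have us0 : 0 < u + s by rewrite ltr_wpDl.
have N0 : 0 < N by rewrite ltr_pwDl ?sqr_ge0// exprn_gt0.
have v20 : 0 <= v ^+ 2 by rewrite sqr_ge0.
have v2E : `|v| ^+ 2 = v ^+ 2 by rewrite real_normK// num_real.
pose t := u ^+ 2 / s; have tE : t * s = u ^+ 2 by rewrite divfK// gt_eqF.
have t0 : 0 <= t by rewrite divr_ge0 ?sqr_ge0// ltW.
have [s2|s2] := ltP s (2 * u).
  have m : u / 2 <= Num.min u t.
    rewrite le_min; apply/andP; split; first lra.
    by rewrite /t ler_pdivlMr//; nra.
  have w : wker s u v <= 5 / 4 * u.
    rewrite /wker ler_pdivrMr//.
    have := mulr_ge0 u0 v20; have := mulr_ge0 (ltW s0) v20.
    have := mulr_ge0 u0 (mulr_ge0 u0 u0); have := mulr_ge0 (mulr_ge0 u0 u0) (ltW s0).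
    have := mulr_ge0 u0 (mulr_ge0 (ltW s0) (ltW s0)); rewrite /N; nra.
  have : s * (s < `|v|)%R%:R <= s by case: (_ < _); rewrite ?mulr1 ?mulr0// ltW.
  rewrite -/t; lra.
have tm : Num.min u t = t.
  by apply/min_idPr; rewrite /t ler_pdivrMr//; nra.
rewrite -/t tm.
have [sv|sv] := ltP s `|v|; rewrite ?mulr1 ?mulr0 ?add0r.
  suff : wker s u v <= (25 * t - s) * (2 / 13) by lra.
  rewrite /wker ler_pdivrMr// -/N.
  have vs : s ^+ 2 <= v ^+ 2 by rewrite -v2E ler_sqr ?nnegrE// ltW.
  have h1 : t * (u + s) ^+ 2 >= 0 by rewrite mulr_ge0 ?sqr_ge0.
  have h2 : t * (v ^+ 2 - s ^+ 2) >= 0 by rewrite mulr_ge0// subr_ge0.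
  have h3 : (s - 2 * u) * (v ^+ 2 - s ^+ 2) >= 0 by rewrite mulr_ge0// subr_ge0.
  have h4 : s * (v ^+ 2 - s ^+ 2) >= 0 by rewrite mulr_ge0 ?(ltW s0)// subr_ge0.
  have h5 : t * s ^+ 2 = s * u ^+ 2 by rewrite -tE; ring.
  have h6 : 0 <= s * (s - u) ^+ 2 by rewrite mulr_ge0 ?sqr_ge0// ltW.
  have h7 : 0 <= (s - 2 * u) * u ^+ 2 by rewrite mulr_ge0 ?sqr_ge0// subr_ge0.
  have h8 : t * (u + s) ^+ 2 = t * u ^+ 2 + 2 * (u * u ^+ 2) + s * u ^+ 2.
    transitivity (t * u ^+ 2 + 2 * (u * (t * s)) + s * (t * s)); first ring.
    by rewrite tE.
  have h9 : 0 <= t * u ^+ 2 by rewrite mulr_ge0 ?sqr_ge0.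
  have h10 : 0 <= u * u ^+ 2 by rewrite mulr_ge0 ?sqr_ge0.
  have h11 : 0 <= (s - 2 * u) * s ^+ 2 by rewrite mulr_ge0 ?sqr_ge0// subr_ge0.
  rewrite /N; nra.
suff : wker s u v <= t by lra.
rewrite /wker ler_pdivrMr// -/N.
have h1 : 0 <= (s - u) * v ^+ 2 by rewrite mulr_ge0// subr_ge0; lra.
have h2 : 0 <= t * v ^+ 2 by rewrite mulr_ge0.
have h8 : t * (u + s) ^+ 2 = t * u ^+ 2 + 2 * (u * u ^+ 2) + s * u ^+ 2.
  transitivity (t * u ^+ 2 + 2 * (u * (t * s)) + s * (t * s)); first ring.
    by rewrite tE.
have h9 : 0 <= t * u ^+ 2 by rewrite mulr_ge0 ?sqr_ge0.
have h10 : 0 <= u * u ^+ 2 by rewrite mulr_ge0 ?sqr_ge0.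
rewrite /N; nra.
Qed.

Lemma meas_bool (b : R -> bool) : measurable_fun D b -> measurable_fun D (fun th => (b th)%:R : R).
Proof. by move=> mb; apply: (@measurableT_comp _ _ _ _ _ _ (fun b : bool => b%:R : R)). Qed.

Lemma meas_Re A : measurable_fun D (fun th => complex.Re A.[circ th]).
Proof. by have := TP_meas (TP_horner A); rewrite measCE => -[]. Qed.

Lemma meas_Im A : measurable_fun D (fun th => complex.Im A.[circ th]).
Proof. by have := TP_meas (TP_horner A); rewrite measCE => -[]. Qed.

Lemma Int_ltIm A (s : R) : Int (fun th => (s < `|complex.Im A.[circ th]|)%R%:R : R).
Proof.
apply: (@Int_bounded _ _ 1); last by move=> th _; case: (_ < _); rewrite ?normr1 ?normr0.
apply: meas_bool; apply: measurable_fun_ltr; first exact: measurable_cst.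
by apply: measurableT_comp => //; exact: meas_Im.
Qed.

Lemma Int_min A (s : R) : 0 < s -> (forall th, 0 <= complex.Re A.[circ th]) ->
  Int (fun th => Num.min (complex.Re A.[circ th]) (complex.Re A.[circ th] ^+ 2 / s)).
Proof.
move=> s0 pos; have /Lp1P[i1 _] := L1_horner A.
apply: Int_le i1 _.
  apply: measurable_minr; first exact: meas_Re.
  by apply: measurable_funM; [apply: measurable_funX; exact: meas_Re|exact: measurable_cst].
move=> th _; rewrite ger0_norm; first by rewrite ge_min lexx.
by rewrite le_min pos divr_ge0 ?sqr_ge0// ltW.
Qed.

Lemma weak_estimate A (s : R) : 0 < s -> complex.Im A.[0] = 0 ->
  (forall th, 0 <= complex.Re A.[circ th]) ->
  s * intg (fun th => (s < `|complex.Im A.[circ th]|)%R%:R) <=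
  25 * intg (fun th => Num.min (complex.Re A.[circ th]) (complex.Re A.[circ th] ^+ 2 / s)).
Proof.
move=> s0 A0 pos.
have h := mean_sqr_div_ge0 s0 A0 pos.
set g := (fun th => _) in h.
have i1 := Int_ltIm A s; have i2 := Int_min s0 pos.
have ig : Int g.
  have mg : measurable_fun D g.
    pose G : fn R := fun z => A.[z] ^+ 2 / (A.[z] + s%:C%C).
    have : measC G.
      apply: (@measC_mul _ (fun z => A.[z] ^+ 2) (frecip (fun z => A.[z] + s%:C%C))).
        by apply: TP_meas; apply: TP_exp; exact: TP_horner.
      apply: measC_frecip; apply: TP_meas; apply: (TP_add (TP_horner A) (TP_cst _)).
    by rewrite measCE => -[].
  have [M M0 hM] := TP_bounded (TP_horner A).
  apply: (@Int_bounded _ _ (M ^+ 2 / s)) => // th _.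
  apply: le_trans (Re_cmod _) _; rewrite cmodM cmodV cmodX.
  have Ags : s <= cmod (A.[circ th] + s%:C%C).
    apply: le_trans (Re_cmod _); rewrite cReD /= ger0_norm ?lerDr//.
    by rewrite addr_ge0// ltW.
  rewrite ler_pM ?invr_ge0 ?cmod_ge0 ?exprn_ge0 ?cmod_ge0//.
    by rewrite ler_sqr ?nnegrE ?cmod_ge0.
  by rewrite lef_pV2 ?posrE// (lt_le_trans s0).
have := le_intg (IntD (IntZ s i1) (IntZ (13 / 2) ig)) (IntZ 25 i2).
rewrite intgD ?intgZ//; [|exact: IntZ..] => H.
apply: le_trans (H _); first by rewrite lerDl mulr_ge0// divr_ge0.
by move=> th _; rewrite /g Re_sqr_div//; exact: weak_pointwise.
Qed.

(** A discrete layer cake formula: if [d 2^j] is the largest scale below [x], then [x <= 2 d 2^j]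
    and this single term suffices; if no scale is below [x], then [x <= d]. *)
Lemma dyadic_layer (p d x : R) (N : nat) : 0 <= p -> 0 < d -> 0 <= x -> x <= d * 2 ^+ N ->
  x `^ p <= d `^ p + \sum_(j < N) (2 * (d * 2 ^+ j)) `^ p * (d * 2 ^+ j < x)%R%:R.
Proof.
move=> p0 d0 x0; elim: N => [|N IH] xN.
  by rewrite big_ord0 addr0 ge0_ler_powR ?nnegrE ?(ltW d0)// -[d]mulr1.
rewrite big_ord_recr /= addrA.
have [lt|ge] := ltP (d * 2 ^+ N) x.
  rewrite mulr1 ler_wpDl//.
    by rewrite addr_ge0 ?powR_ge0// sumr_ge0// => j _; rewrite mulr_ge0 ?powR_ge0.
  rewrite ge0_ler_powR ?nnegrE ?mulr_ge0 ?exprn_ge0 ?(ltW d0)//.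
  by rewrite mulrCA -exprS.
by rewrite mulr0 addr0 IH.
Qed.

(** A geometric series of ratio [2^t > 1] is controlled by its last term. The last scale of the sum
    is [d 2^N / 2]; with its minimum with [u] on the right, the induction on [N] closes. *)
Lemma dyadic_low (t d u : R) (N : nat) : 0 < t -> 0 < d -> 0 < u ->
  \sum_(j < N) (d * 2 ^+ j) `^ t * (d * 2 ^+ j <= u)%R%:R <=
  2 `^ t / (2 `^ t - 1) * (Num.min (d * 2 ^+ N / 2) u) `^ t.
Proof.
move=> t0 d0 u0.
have r1 : 1 < 2 `^ t :> R.
  by have := @gt0_ltr_powR _ t t0 1 2; rewrite !nnegrE powR1 ler01 ler0n ltr1n; apply.
have k0 : 0 <= 2 `^ t / (2 `^ t - 1) :> R by rewrite divr_ge0 ?powR_ge0 ?subr_ge0 ?(ltW r1).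
elim: N => [|N IH]; first by rewrite big_ord0 mulr_ge0 ?powR_ge0.
have s0 : 0 < d * 2 ^+ N by rewrite mulr_gt0 ?exprn_gt0.
rewrite big_ord_recr /= exprS.
have -> : d * (2 * 2 ^+ N) / 2 = d * 2 ^+ N by field.
have [le|gt] := leP (d * 2 ^+ N) u.
  rewrite mulr1; apply: le_trans (lerD IH (lexx _)) _.
  have -> : Num.min (d * 2 ^+ N / 2) u = d * 2 ^+ N / 2.
    by apply/min_idPl; apply: le_trans le; lra.
  rewrite powRM ?(ltW s0) ?invr_ge0// -(@powR_inv1 _ 2)// -powRrM mulN1r powRN.
  rewrite le_eqVlt; apply/orP; left; apply/eqP; field.
  by rewrite gt_eqF ?subr_gt0//= gt_eqF// (lt_trans ltr01).
rewrite mulr0 addr0; apply: le_trans IH _.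
rewrite ler_wpM2l// ge0_ler_powR ?nnegrE ?(ltW t0) ?le_min ?(ltW u0) ?divr_ge0 ?(ltW s0)//.
by rewrite ge_min lexx orbT.
Qed.

(** A geometric series of ratio [2^-t < 1] is controlled by its first term. The induction splits off
    the lowest scale and doubles [d], which is therefore quantified after [N]. *)
Lemma dyadic_high (t u : R) (N : nat) : 0 < t -> 0 < u -> forall d, 0 < d ->
  \sum_(j < N) (d * 2 ^+ j) `^ (- t) * (u < d * 2 ^+ j)%R%:R <=
  (1 - 2 `^ (- t))^-1 * (Num.max d u) `^ (- t).
Proof.
move=> t0 u0.
have r1 : 2 `^ (- t) < 1 :> R.
  rewrite powRN invf_lt1 ?powR_gt0//.
  by have := @gt0_ltr_powR _ t t0 1 2; rewrite !nnegrE powR1 ler01 ler0n ltr1n; apply.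
have k0 : 0 <= (1 - 2 `^ (- t))^-1 :> R by rewrite invr_ge0 subr_ge0 ltW.
elim: N => [|N IH] d d0; first by rewrite big_ord0 mulr_ge0 ?powR_ge0.
have d20 : 0 < d * 2 by rewrite mulr_gt0.
rewrite big_ord_recl /= expr0 mulr1.
rewrite (eq_bigr (fun j : 'I_N => (d * 2 * 2 ^+ j) `^ (- t) * (u < d * 2 * 2 ^+ j)%R%:R)); last first.
  by move=> j _; rewrite /bump /= add1n exprS mulrA.
apply: le_trans (lerD (lexx _) (IH _ d20)) _.
have decr (x y : R) : 0 < x -> x <= y -> y `^ (- t) <= x `^ (- t).
  move=> x0 xy; rewrite !powRN lef_pV2 ?posrE ?powR_gt0//; last exact: lt_le_trans xy.
  by rewrite ge0_ler_powR ?nnegrE ?(ltW t0) ?(ltW x0)// (le_trans (ltW x0)).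
have [lt|ge] := ltP u d.
  rewrite mulr1.
  have -> : Num.max (d * 2) u = d * 2 by apply/max_idPl; lra.
  rewrite powRM ?(ltW d0)// le_eqVlt; apply/orP; left; apply/eqP.
  by field; rewrite subr_eq0 gt_eqF.
by rewrite mulr0 add0r ler_wpM2l// decr// le_max lexx orbT.
Qed.

(** The geometric constants of [dyadic_low] with [t = p - 1] and of [dyadic_high] with [t = 2 - p];
    they are finite and positive because [1 < p < 2]. *)
Definition kriesz (p : R) : R :=
  2 `^ (p - 1) / (2 `^ (p - 1) - 1) + (1 - 2 `^ (- (2 - p)))^-1.

Lemma kriesz_ge0 p : 1 < p -> p < 2 -> 0 <= kriesz p.
Proof.
move=> p1 p2; rewrite /kriesz addr_ge0//.
  rewrite divr_ge0 ?powR_ge0// subr_ge0.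
  have t0 : 0 < p - 1 by rewrite subr_gt0.
  by have := @gt0_ltr_powR _ _ t0 1 2; rewrite !nnegrE powR1 ler01 ler0n ltr1n => /(_ isT isT isT)/ltW.
have t0 : 0 < 2 - p by rewrite subr_gt0.
rewrite invr_ge0 subr_ge0 powRN invf_le1 ?powR_gt0//.
by have := @gt0_ltr_powR _ _ t0 1 2; rewrite !nnegrE powR1 ler01 ler0n ltr1n => /(_ isT isT isT)/ltW.
Qed.

(** At scale [s] the term is [u s^(p-1)] if [s <= u] and [u^2 s^(p-2)] if [s > u]. Both geometric
    sums are dominated by the scales near [u], where each is of order [u^p]. *)
Lemma dyadic_kernel (p d u : R) (N : nat) : 1 < p -> p < 2 -> 0 < d -> 0 <= u ->
  \sum_(j < N) (d * 2 ^+ j) `^ (p - 1) * Num.min u (u ^+ 2 / (d * 2 ^+ j)) <=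
  kriesz p * u `^ p.
Proof.
move=> p1 p2 d0; rewrite le_eqVlt => /predU1P[<-|u0].
  rewrite big1; first by rewrite mulr_ge0 ?powR_ge0 ?kriesz_ge0.
  by move=> j _; rewrite expr0n /= mul0r minxx mulr0.
have t1 : 0 < p - 1 by rewrite subr_gt0.
have t2 : 0 < 2 - p by rewrite subr_gt0.
have s0 j : 0 < d * 2 ^+ j by rewrite mulr_gt0 ?exprn_gt0.
rewrite (eq_bigr (fun j : 'I_N => u * ((d * 2 ^+ j) `^ (p - 1) * (d * 2 ^+ j <= u)%R%:R) +
   u ^+ 2 * ((d * 2 ^+ j) `^ (- (2 - p)) * (u < d * 2 ^+ j)%R%:R))); last first.
  move=> j _; have sj := s0 j; set s := d * 2 ^+ j in sj *.
  have [le|gt] := leP s u.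
    rewrite mulr1 !mulr0 addr0 mulrC; congr (_ * _); apply/min_idPl.
    by rewrite ler_pdivlMr// expr2 ler_wpM2l// ltW.
  rewrite mulr1 !mulr0 add0r.
  have -> : Num.min u (u ^+ 2 / s) = u ^+ 2 / s.
    by apply/min_idPr; rewrite ler_pdivrMr// expr2 ler_wpM2l ?(ltW u0)// ltW.
  have -> : - (2 - p) = (p - 1) - 1 by ring.
  rewrite [in RHS]powRB; last by rewrite (gt_eqF sj) implybT.
  by rewrite powRr1 ?(ltW sj)// mulrCA.
rewrite big_split /= -!mulr_sumr /kriesz mulrDl lerD//.
  apply: le_trans (ler_wpM2l (ltW u0) (dyadic_low N t1 d0 u0)) _.
  rewrite mulrCA ler_wpM2l//.
    rewrite divr_ge0 ?powR_ge0// subr_ge0.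
    by have := @gt0_ltr_powR _ _ t1 1 2; rewrite !nnegrE powR1 ler01 ler0n ltr1n => /(_ isT isT isT)/ltW.
  rewrite -(mulr_powRB1 (ltW u0)) ?(lt_trans ltr01 p1)// ler_wpM2l ?(ltW u0)//.
  rewrite ge0_ler_powR ?nnegrE ?(ltW t1) ?le_min ?(ltW u0) ?divr_ge0 ?(ltW (s0 _))//.
  by rewrite ge_min lexx orbT.
apply: le_trans (ler_wpM2l (sqr_ge0 u) (dyadic_high N t2 u0 d0)) _.
rewrite mulrCA ler_wpM2l//.
  rewrite invr_ge0 subr_ge0 powRN invf_le1 ?powR_gt0//.
  by have := @gt0_ltr_powR _ _ t2 1 2; rewrite !nnegrE powR1 ler01 ler0n ltr1n => /(_ isT isT isT)/ltW.
have -> : u `^ p = u ^+ 2 * u `^ (- (2 - p)).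
  rewrite -(@powR_mulrn _ u 2) ?(ltW u0)// -powRD; last by rewrite (gt_eqF u0) implybT.
  by congr powR; ring.
rewrite ler_wpM2l ?sqr_ge0// !powRN lef_pV2 ?posrE ?powR_gt0//.
  by rewrite ge0_ler_powR ?nnegrE ?(ltW t2) ?le_max ?(ltW u0) ?(ltW d0)// lexx orbT.
by rewrite lt_max d0.
Qed.

Lemma Int_powRe A (p : R) : 0 <= p -> Int (fun th => `|complex.Re A.[circ th]| `^ p).
Proof.
move=> p0; have /LpP[_ h] := LL_horner A p0; apply: Int_le h _.
  by apply: meas_pow; apply: measurableT_comp => //; exact: meas_Re.
move=> th _; rewrite ger0_norm ?powR_ge0// ge0_ler_powR ?nnegrE ?cmod_ge0//.
exact: Re_cmod.
Qed.

Lemma Int_powIm A (p : R) : 0 <= p -> Int (fun th => `|complex.Im A.[circ th]| `^ p).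
Proof.
move=> p0; have /LpP[_ h] := LL_horner A p0; apply: Int_le h _.
  by apply: meas_pow; apply: measurableT_comp => //; exact: meas_Im.
move=> th _; rewrite ger0_norm ?powR_ge0// ge0_ler_powR ?nnegrE ?cmod_ge0//.
exact: Im_cmod.
Qed.

(** Integrating [dyadic_layer] bounds the left side by a sum of [(2 s)^p] times the measure of
    [|v| > s]. One factor [s] is spent on [weak_estimate], and the remaining [s^(p-1)] is summed by
    [dyadic_kernel]. *)
Lemma riesz_pos A (p : R) : 1 < p -> p < 2 -> complex.Im A.[0] = 0 ->
  (forall th, 0 <= complex.Re A.[circ th]) ->
  intg (fun th => `|complex.Im A.[circ th]| `^ p) <=
  25 * 2 `^ p * kriesz p * intg (fun th => `|complex.Re A.[circ th]| `^ p).
Proof.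
move=> p1 p2 A0 pos; have p0 : 0 < p by exact: lt_trans p1.
have [M M0 hM] := TP_bounded (TP_horner A).
pose v th := `|complex.Im A.[circ th]|; pose u th := complex.Re A.[circ th].
have iv := Int_powIm A (ltW p0); have iu := Int_powRe A (ltW p0).
have main d : 0 < d -> intg (fun th => v th `^ p) <=
    d `^ p * (2 * pi) + 25 * 2 `^ p * kriesz p * intg (fun th => `|u th| `^ p).
  move=> d0; pose N := (Num.truncn (M / d)).+1.
  have MN : M <= d * 2 ^+ N.
    rewrite mulrC -ler_pdivrMr//; apply: le_trans (ltW (truncnS_gt (M / d))) _.
    by rewrite -natrX ler_nat ltnW// ltn_expl.
  have s0 j : 0 < d * 2 ^+ j by rewrite mulr_gt0 ?exprn_gt0.
  pose K (j : 'I_N) : R := (2 * (d * 2 ^+ j)) `^ p.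
  pose ind (j : 'I_N) th : R := (d * 2 ^+ j < v th)%R%:R.
  have ii j : Int (ind j) by exact: Int_ltIm.
  have iS : Int (fun th => \sum_(j < N) K j * ind j th).
    by apply: (@Int_sum _ _ _ (fun j th => K j * ind j th)) => j; exact: IntZ.
  apply: le_trans (le_intg iv (IntD (Int_cst (d `^ p)) iS) _) _.
    move=> th _; apply: dyadic_layer => //; first exact: ltW.
    by apply: le_trans MN; apply: le_trans (hM th); exact: Im_cmod.
  rewrite intgD//; last exact: Int_cst.
  rewrite intg_cst lerD2l.
  rewrite (@intg_sum _ _ _ (fun j th => K j * ind j th)); last by move=> j; exact: IntZ.
  pose m (j : 'I_N) th := Num.min (u th) (u th ^+ 2 / (d * 2 ^+ j)).
  have im j : Int (m j) by exact: Int_min.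
  apply: (@le_trans _ _ (\sum_(j < N) 2 `^ p * (25 * ((d * 2 ^+ j) `^ (p - 1) * intg (m j))))).
    apply: ler_sum => j _; rewrite intgZ// /K powRM ?(ltW (s0 _))//.
    rewrite -mulrA ler_wpM2l ?powR_ge0//.
    rewrite -(mulr_powRB1 (ltW (s0 j)))//; set c := _ `^ (p - 1).
    have -> : d * 2 ^+ j * c * intg (ind j) = c * (d * 2 ^+ j * intg (ind j)) by ring.
    have -> : 25 * (c * intg (m j)) = c * (25 * intg (m j)) by ring.
    by rewrite ler_wpM2l ?powR_ge0//; exact: weak_estimate.
  rewrite -mulr_sumr -mulr_sumr.
  have -> : \sum_(j < N) (d * 2 ^+ j) `^ (p - 1) * intg (m j) =
      intg (fun th => \sum_(j < N) (d * 2 ^+ j) `^ (p - 1) * m j th).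
    rewrite (@intg_sum _ _ _ (fun (j : 'I_N) th => (d * 2 ^+ j) `^ (p - 1) * m j th)).
      by apply: eq_bigr => j _; rewrite intgZ.
    by move=> j; exact: IntZ.
  rewrite -!mulrA mulrCA ler_wpM2l// ler_wpM2l ?powR_ge0//.
  rewrite -intgZ//; apply: le_intg.
  - by apply: (@Int_sum _ _ _ (fun (j : 'I_N) th => (d * 2 ^+ j) `^ (p - 1) * m j th)) => j; exact: IntZ.
  - exact: IntZ.
  - by move=> th _; rewrite (ger0_norm (pos th)); apply: dyadic_kernel => //; exact: pos.
apply/ler_addgt0Pr => e e0.
(* Makes the error term [d^p 2 pi] of [main] equal to [e]. *)
pose d := (e / (2 * pi)) `^ p^-1.
have d0 : 0 < d by rewrite powR_gt0// divr_gt0// pi2_gt0.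
apply: le_trans (main d d0) _; rewrite addrC lerD2l.
rewrite -powRrM mulVf ?gt_eqF// powRr1 ?divr_ge0 ?(ltW e0) ?(ltW pi2_gt0)//.
by rewrite divfK// gt_eqF// pi2_gt0.
Qed.

End riesz_positive.

(** * Bounding an analytic polynomial by its real part *)

Section riesz_real.
Context {R : realType}.
Local Notation D := (@I02 R).
Local Notation C := R[i].
Implicit Types (A B : {poly C}) (f g : fn R).

Definition rep A : fn R := fun z => (complex.Re A.[z])%:C%C.

Lemma Linf_rep A : Linf (rep A).
Proof.
have [M M0 hM] := TP_bounded (TP_horner A).
apply: (@Linf_cmod _ _ M).
  by rewrite measCE; split; [exact: meas_Re|exact: measurable_cst].
by apply: aeD_all => th _; rewrite cmod_real (le_trans (Re_cmod _)).
Qed.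

Lemma LL_rep p A : 0 <= p -> LL p (rep A).
Proof. by move=> p0; apply: Linf_Lp => //; exact: Linf_rep. Qed.

Lemma nrm_le_of_intg p f g k : 0 < p -> 0 <= k ->
  intg (fun th => cmod (f (circ th)) `^ p) <= k * intg (fun th => cmod (g (circ th)) `^ p) ->
  nrm p f <= k `^ p^-1 * nrm p g.
Proof.
move=> p0 k0 h; rewrite !nrmE -powRM//; last by apply: intg_ge0 => th _; exact: powR_ge0.
rewrite ge0_ler_powR ?nnegrE ?invr_ge0 ?(ltW p0)//.
- by apply: intg_ge0 => th _; exact: powR_ge0.
- by rewrite mulr_ge0//; apply: intg_ge0 => th _; exact: powR_ge0.
Qed.

Lemma powR_le1D (p r x : R) : 0 <= p -> p <= r -> 0 <= x -> x `^ p <= 1 + x `^ r.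
Proof.
move=> p0 pr x0; have [x1|x1] := leP x 1.
  apply: (@le_trans _ _ 1); last by rewrite lerDl powR_ge0.
  have e1 : 1 `^ p = 1 :> R by rewrite powR1.
  by rewrite -[leRHS]e1 ge0_ler_powR ?nnegrE.
rewrite (@le_trans _ _ (x `^ r))//; last by rewrite lerDr.
by rewrite ler_powR// ltW.
Qed.

(** As in [intg_le_nrm]: the inequality [x^p <= 1 + x^r] at [x = |f| / nrm r f] is integrated over a
    set of measure [2 pi]. *)
Lemma nrm_le_nrm (p r : R) f : 1 <= p -> p <= r -> LL r f ->
  LL p f /\ nrm p f <= (2 * pi + 1) `^ p^-1 * nrm r f.
Proof.
move=> p1 pr Lf; have p0 : 0 < p by exact: lt_le_trans p1.
have r0 : 0 < r by exact: lt_le_trans pr.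
have /LpP[mf jf] := Lf.
have jp : Int (fun th => cmod (f (circ th)) `^ p).
  apply: Int_le (IntD (Int_cst 1) jf) _; first exact: meas_powcmod.
  by move=> th _; rewrite ger0_norm ?powR_ge0// powR_le1D ?cmod_ge0// ltW.
have Lp_f : LL p f by apply/LpP.
split=> //.
have [n0|n0] := eqVneq (nrm r f) 0.
  rewrite n0 mulr0 (nrm_aeeq p mf (measC_cst 0) (nrm_eq0 r0 Lf n0)).
  by rewrite nrm_cst0.
have t0 : 0 < nrm r f by rewrite lt_def n0 nrm_ge0.
have tr := nrm_pow f r0; move: (nrm r f) n0 t0 tr => t n0 t0 tr.
have -> : t = (t `^ p) `^ p^-1 by rewrite -powRrM mulfV ?gt_eqF// powRr1// ltW.
have k0 : 0 <= 2 * pi + 1 :> R by rewrite addr_ge0// ltW// pi2_gt0.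
rewrite nrmE -powRM ?powR_ge0// ge0_ler_powR ?nnegrE ?invr_ge0 ?(ltW p0)//.
- by apply: intg_ge0 => th _; exact: powR_ge0.
- by rewrite mulr_ge0 ?powR_ge0.
have i2 := IntD (Int_cst (t `^ p)) (IntZ (t `^ p * t `^ (- r)) jf).
apply: le_trans (le_intg jp i2 _) _ => [th _|].
  have := @powR_le1D p r (cmod (f (circ th)) / t) (ltW p0) pr.
  rewrite divr_ge0 ?cmod_ge0 ?(ltW t0)// => /(_ isT).
  rewrite !powRM ?cmod_ge0 ?invr_ge0 ?(ltW t0)//.
  rewrite -(powR_inv1 (ltW t0)) -!powRrM !mulN1r !powRN.
  rewrite ler_pdivrMr ?powR_gt0// => /le_trans; apply.
  by rewrite le_eqVlt; apply/orP; left; apply/eqP; ring.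
rewrite intgD; [|exact: Int_cst|exact: IntZ].
rewrite intg_cst intgZ// -tr -mulrA -powRD; last by rewrite n0 implybT.
by rewrite addNr powRr0 le_eqVlt; apply/orP; left; apply/eqP; ring.
Qed.

(** The condition at 0 removes imaginary constants, which have real part 0 and could not be bounded
    by it. *)
Definition riesz_real (p : R) : Prop := exists2 K, 0 <= K &
  forall A, complex.Im A.[0] = 0 -> nrm p (horner A) <= K * nrm p (rep A).

Lemma riesz_real_pos p : 1 < p -> p < 2 -> exists2 K, 0 <= K &
  forall A, complex.Im A.[0] = 0 -> (forall th, 0 <= complex.Re A.[circ th]) ->
    nrm p (horner A) <= K * nrm p (rep A).
Proof.
move=> p1 p2; have p0 : 0 < p by exact: lt_trans p1.
pose k := 2 `^ p * (1 + 25 * 2 `^ p * kriesz p).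
have k0 : 0 <= k.
  by rewrite mulr_ge0 ?powR_ge0// addr_ge0// !mulr_ge0 ?powR_ge0// kriesz_ge0.
exists (k `^ p^-1); first exact: powR_ge0.
move=> A A0 pos; apply: nrm_le_of_intg => //.
have iu := Int_powRe A (ltW p0); have iv := Int_powIm A (ltW p0).
have /LpP[_ iA] := LL_horner A (ltW p0).
apply: le_trans (le_intg iA (IntZ (2 `^ p) (IntD iu iv)) _) _.
  move=> th _; apply: le_trans (powR_addle (ltW p0) _ _) => //.
  by rewrite ge0_ler_powR ?nnegrE ?addr_ge0 ?cmod_ge0 ?(ltW p0)// cmod_ReIm.
rewrite intgZ; last exact: IntD.
rewrite intgD// /k -[leRHS]mulrA ler_wpM2l ?powR_ge0// mulrDl mul1r.
have -> : intg (fun th => cmod (rep A (circ th)) `^ p) = intg (fun th => `|complex.Re A.[circ th]| `^ p).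
  by apply: eq_intg => th _; rewrite cmod_real.
by rewrite lerD2l riesz_pos.
Qed.

(** The mean of [A^2] is [A(0)^2 >= 0], and its real part is the mean of [u^2 - v^2]; hence [v] is
    no larger than [u] in [L^2]. *)
Lemma riesz_real2 : riesz_real 2.
Proof.
exists (2 `^ 2^-1); first exact: powR_ge0.
move=> A A0; apply: nrm_le_of_intg => //.
have e1 : intg (fun th => cmod A.[circ th] `^ 2) = intg (fun th => complex.Re A.[circ th] ^+ 2 +
    complex.Im A.[circ th] ^+ 2).
  by apply: eq_intg => th _; rewrite powR_mulrn ?cmod_ge0// sqr_cmod.
have e2 : intg (fun th => cmod (rep A (circ th)) `^ 2) = intg (fun th => complex.Re A.[circ th] ^+ 2).
  by apply: eq_intg => th _; rewrite powR_mulrn ?cmod_ge0// cmod_real real_normK// num_real.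
have [M M0 hM] := TP_bounded (TP_horner A).
have i1 : Int (fun th => complex.Re A.[circ th] ^+ 2).
  apply: (@Int_bounded _ _ (M ^+ 2)); first by apply: measurable_funX; exact: meas_Re.
  move=> th _; rewrite normrX ler_sqr ?nnegrE//.
  by rewrite (le_trans (Re_cmod _)).
have i2 : Int (fun th => complex.Im A.[circ th] ^+ 2).
  apply: (@Int_bounded _ _ (M ^+ 2)); first by apply: measurable_funX; exact: meas_Im.
  move=> th _; rewrite normrX ler_sqr ?nnegrE//.
  by rewrite (le_trans (Im_cmod _)).
have h : 0 <= intg (fun th => complex.Re A.[circ th] ^+ 2 - complex.Im A.[circ th] ^+ 2).
  have := Re_cmean (horner (A ^+ 2)); rewrite cmean_horner horner_exp (real_Im0 A0) -rmorphXn /= => e.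
  have : 0 <= (2 * pi)^-1 * intg (fun th : R => complex.Re (A ^+ 2).[circ th]) by rewrite -e sqr_ge0.
  rewrite pmulr_rge0 ?invr_gt0 ?pi2_gt0// => /le_trans; apply.
  rewrite le_eqVlt; apply/orP; left; apply/eqP; apply: eq_intg => th _.
  by rewrite horner_exp !expr2 cReM.
rewrite e1 e2 intgD//; move: h; rewrite intgB//; lra.
Qed.

(** On the circle [c z^-n] and [conjc c z^n] are conjugate, hence have the same real part:
    reflecting negative exponents yields an analytic polynomial with unchanged real part. The
    construction is linear over the reals only. *)
Definition Fpoly (s : seq (C * int)) : {poly C} :=
  \sum_(x <- s) (if 0 <= x.2 then x.1 else conjc x.1) *: 'X^(`|x.2|%N).

Lemma Re_conj (z : C) : complex.Re (conjc z) = complex.Re z.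
Proof. by case: z. Qed.

Lemma Re_Fpoly s (th : R) : complex.Re (Fpoly s).[circ th] = complex.Re (tpoly s (circ th)).
Proof.
rewrite /Fpoly /tpoly horner_sum.
elim: s => [|x s IH]; first by rewrite !big_nil.
rewrite !big_cons !cReD IH; congr (_ + _); rewrite hornerZ hornerXn.
case: x => c [n|n] //=; rewrite NegzE -exprnN -exprVn -conj_circ.
by rewrite -Re_conj rmorphM /= rmorphXn /= !conjcK.
Qed.

Lemma cmean_sum (I : Type) (s : seq I) (f_ : I -> fn R) : (forall i, LL 1 (f_ i)) ->
  LL 1 (fun z => \sum_(i <- s) f_ i z) /\
  cmean (fun z => \sum_(i <- s) f_ i z) = \sum_(i <- s) cmean (f_ i).
Proof.
move=> Lf; elim: s => [|i s [L IH]].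
  split.
    by apply: Linf_Lp => //; apply: TP_Linf; exists [::] => th; rewrite /tpoly !big_nil.
  by rewrite big_nil -[RHS](@cmean_cst R 0); apply: cmean_eq => th; rewrite big_nil.
have -> : (fun z => \sum_(j <- i :: s) f_ j z) = fadd (f_ i) (fun z => \sum_(j <- s) f_ j z).
  by apply/funext => z; rewrite big_cons.
by split; [exact: Lp_add|rewrite cmeanD// IH big_cons].
Qed.

Lemma cmean_tpoly s : cmean (tpoly s) = \sum_(x <- s) x.1 * (x.2 == 0)%:R :> C.
Proof.
have Lt n : LL 1 (@tpow R n) by apply: Linf_Lp => //; exact: Linf_tpow.
have [_ ->] := @cmean_sum _ s (fun x => fscal x.1 (tpow x.2)) (fun x => Lp_scal _ (Lt _)).
by apply: eq_bigr => x _; rewrite cmeanZ// cmean_tpow.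
Qed.

Lemma Fpoly0 s : (Fpoly s).[0] = cmean (tpoly s).
Proof.
rewrite cmean_tpoly /Fpoly horner_sum; apply: eq_bigr => -[c n] _ /=.
rewrite hornerZ hornerXn expr0n absz_eq0; have [->|n0] := eqVneq n 0; first by rewrite lexx.
by rewrite !mulr0.
Qed.

(** An imaginary constant is subtracted so that the value at 0 is real, as [riesz_real] requires. *)
Definition Fcpoly s : {poly C} := Fpoly s - ('i%C * (complex.Im (Fpoly s).[0])%:C%C)%:P.

Lemma Fcpoly_horner s z : (Fcpoly s).[z] = (Fpoly s).[z] - 'i%C * (complex.Im (cmean (tpoly s)))%:C%C.
Proof. by rewrite /Fcpoly hornerD hornerN hornerC Fpoly0. Qed.

Lemma Fcpoly_Im0 s : complex.Im (Fcpoly s).[0] = 0.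
Proof.
rewrite Fcpoly_horner Fpoly0; case: (cmean _) => a b /=.
by rewrite mulr0 mul1r add0r subrr.
Qed.

Lemma Re_Fcpoly s (th : R) : complex.Re (Fcpoly s).[circ th] = complex.Re (tpoly s (circ th)).
Proof.
rewrite Fcpoly_horner cReD Re_Fpoly cReN cReM /= mul0r mulr0 subr0 oppr0 addr0 //.
Qed.

Lemma completion f : TP f -> exists A, complex.Im A.[0] = 0 /\
  forall th : R, complex.Re A.[circ th] = complex.Re (f (circ th)).
Proof.
move=> [s hs]; exists (Fcpoly s); split; first exact: Fcpoly_Im0.
by move=> th; rewrite Re_Fcpoly hs.
Qed.

End riesz_real.

(** * From nonnegative to arbitrary real parts, and to the projection of polynomials *)

Section riesz_projection.
Context {R : realType}.
Local Notation D := (@I02 R).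
Local Notation C := R[i].
Implicit Types (A B : {poly C}) (f g : fn R).

Definition sqf f : fn R := fun z => (cmod (f z) ^+ 2)%:C%C.

Lemma TP_sqf f : TP f -> TP (sqf f).
Proof.
move=> hf; apply: TP_eq (TP_mul hf (TP_conj hf)) => th.
by rewrite /fmul /sqf -sqr_normc -cmodE rmorphXn.
Qed.

(** Approximants of [|g|^2] have to stay nonnegative, so [g] itself is approximated, in [L^4]. With
    [d = |g - psi|] the error is at most [d (d + 2 m)], its square at most [2 d^4 + 8 m^2 d^2], and
    [d^2 <= eta + d^4 / eta]. The choice of [eta] and [k] gives each of the two resulting terms the
    share [e^2 / 2]. *)
Lemma approx_sqr g (m e : R) : measC g -> 0 < m -> (forall th, cmod (g (circ th)) <= m) ->
  0 < e -> exists psi, TP psi /\ nrm 2 (fminus (sqf psi) (sqf g)) <= e.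
Proof.
move=> mg m0 gm e0.
have pi20 := @pi2_gt0 R.
pose eta := e ^+ 2 / (2 * (8 * m ^+ 2 * (2 * pi))).
have m20 : 0 < m ^+ 2 by rewrite exprn_gt0.
have e20 : 0 < e ^+ 2 by rewrite exprn_gt0.
have eta0 : 0 < eta by rewrite divr_gt0// !mulr_gt0// ?pi_gt0.
pose k := 2 + 8 * m ^+ 2 / eta.
have k0 : 0 < k by rewrite addr_gt0// divr_gt0// mulr_gt0.
have e'0 : 0 < e ^+ 2 / (2 * k) by rewrite divr_gt0// mulr_gt0.
have Lg : LL 4 g.
  apply: Linf_Lp => //; apply: (@Linf_cmod _ _ m) => //.
  by apply: aeD_all => th _; exact: gm.
have [psi [Tp hp]] := @TP_dense _ 4 g _ (ltr0n _ 4) Lg e'0.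
exists psi; split=> //.
have p4 (x : R) : 0 <= x -> x `^ 4 = x ^+ 4 by move=> x0; exact: powR_mulrn.
pose d th := cmod (g (circ th) - psi (circ th)).
have d0 th : 0 <= d th by exact: cmod_ge0.
have id : Int (fun th => d th ^+ 4).
  have Ld : LL 4 (fminus g psi) by apply: Lp_minus => //; exact: TP_Lp.
  by have /LpP[_] := Ld; apply: eq_Int => th _; rewrite p4 ?cmod_ge0.
have hd : intg (fun th => d th ^+ 4) < e ^+ 2 / (2 * k).
  by move: hp; congr (_ < _); apply: eq_intg => th _; rewrite p4 ?cmod_ge0.
have msq f : measC f -> measC (sqf f).
  move=> mf; rewrite measCE; split; last exact: measurable_cst.
  by apply: measurable_funX; exact: meas_cmod.
have ms : measC (fminus (sqf psi) (sqf g)).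
  by apply: measC_minus; apply: msq => //; exact: TP_meas.
pose h th := cmod (fminus (sqf psi) (sqf g) (circ th)).
have bd th : h th `^ 2 <= k * d th ^+ 4 + 8 * m ^+ 2 * eta.
  have hE : h th <= d th * (d th + 2 * m).
    rewrite /h /fminus /sqf -rmorphB cmod_real /=.
    have -> : cmod (psi (circ th)) ^+ 2 - cmod (g (circ th)) ^+ 2 =
      (cmod (psi (circ th)) - cmod (g (circ th))) * (cmod (psi (circ th)) + cmod (g (circ th))) by ring.
    rewrite normrM [X in _ * X]ger0_norm ?addr_ge0 ?cmod_ge0//.
    have t1 : cmod (psi (circ th)) <= d th + cmod (g (circ th)).
      rewrite /d -[X in _ <= X + _]cmodN opprB -{1}(subrK (g (circ th)) (psi (circ th))); exact: cmodD.
    have t2 : cmod (g (circ th)) <= d th + cmod (psi (circ th)).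
      rewrite /d -{1}(subrK (psi (circ th)) (g (circ th))); exact: cmodD.
    have gmt := gm th; apply: ler_pM.
    - by rewrite normr_ge0.
    - by rewrite addr_ge0// cmod_ge0.
    - by rewrite ler_norml; apply/andP; split; lra.
    - lra.
  have h0 : 0 <= h th by exact: cmod_ge0.
  rewrite powR_mulrn//.
  apply: (@le_trans _ _ ((d th * (d th + 2 * m)) ^+ 2)).
    by rewrite ler_sqr ?nnegrE// mulr_ge0// addr_ge0// mulr_ge0// ltW.
  have dx := d0 th; move: (d th) dx => x x0.
  have am : x ^+ 2 <= eta + x ^+ 4 / eta.
    rewrite -(ler_pM2r eta0) mulrDl divfK ?gt_eqF//.
    have := sqr_ge0 (x ^+ 2 - eta); have := mulr_ge0 (ltW eta0) (sqr_ge0 x).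
    have -> : x ^+ 4 = x ^+ 2 * x ^+ 2 by ring.
    rewrite -!expr2; nra.
  have am2 := ler_wpM2l (ltW m20) am.
  have -> : k * x ^+ 4 = 2 * x ^+ 4 + 8 * (m ^+ 2 * (x ^+ 4 / eta)).
    by rewrite /k; field; rewrite gt_eqF.
  have := sqr_ge0 (x ^+ 2 - 2 * m * x).
  move: am2; rewrite mulrDr; set y := _ / eta; nra.
have ib : Int (fun th => k * d th ^+ 4 + 8 * m ^+ 2 * eta).
  by apply: IntD; [exact: IntZ|exact: Int_cst].
have ih : Int (fun th => h th `^ 2).
  apply: Int_le ib _; first exact: (meas_powcmod 2 ms).
  by move=> th _; rewrite ger0_norm ?powR_ge0.
have Ih : intg (fun th => h th `^ 2) <= e ^+ 2.
  apply: le_trans (le_intg ih ib (fun th _ => bd th)) _.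
  rewrite intgD; [|exact: IntZ|exact: Int_cst].
  rewrite intgZ// intg_cst.
  have -> : e ^+ 2 = k * (e ^+ 2 / (2 * k)) + 8 * m ^+ 2 * eta * (2 * pi).
    have h1 (x : R) : 0 < x -> x * (e ^+ 2 / (2 * x)) = e ^+ 2 / 2.
      by move=> x0; field; rewrite gt_eqF.
    have h2 (x y : R) : 0 < x -> 0 < y -> 8 * x * (e ^+ 2 / (2 * (8 * x * (2 * y)))) * (2 * y) = e ^+ 2 / 2.
      by move=> x0 y0; field; rewrite !gt_eqF.
    by rewrite h1// /eta h2 ?pi_gt0//; field.
  by rewrite lerD2r ler_pM2l// ltW.
rewrite !nrmE -/h.
have eE : e = (e ^+ 2) `^ 2^-1.
  by rewrite -(powR_mulrn 2 (ltW e0)) -powRrM mulfV ?pnatr_eq0// powRr1// ltW.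
rewrite [leRHS]eE ge0_ler_powR ?nnegrE ?invr_ge0 ?exprn_ge0 ?(ltW e0)//.
by apply: intg_ge0 => th _; exact: powR_ge0.
Qed.

Lemma max_subN (u : R) : Num.max u 0 - Num.max (- u) 0 = u.
Proof.
have [h|h] := leP u 0.
  by rewrite (max_idPl _) ?oppr_ge0// opprK add0r.
by rewrite (max_idPr _) ?subr0// oppr_le0 ltW.
Qed.

(** The positive and negative parts of [Re A] are replaced by squared moduli with completions [B1]
    and [B2], to which the nonnegative case applies. The error [E = A - B1 + B2] has a real part
    without sign, but small in [L^2], where [riesz_real2] asks for no sign; the [L^2] norm then
    controls the [L^p] norm since [p < 2]. *)
Lemma riesz_real_lt2 p : 1 < p -> p < 2 -> @riesz_real R p.
Proof.
move=> p1 p2; have p0 : 0 < p by exact: lt_trans p1.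
have [K K0 hK] := riesz_real_pos p1 p2.
have [L L0 hL] := @riesz_real2 R.
pose k2 : R := (2 * pi + 1) `^ p^-1.
have k20 : 0 <= k2 by exact: powR_ge0.
exists (2 * K); first by rewrite mulr_ge0.
move=> A A0; apply/ler_addgt0Pr => eps eps0.
(* The total coefficient of [e] in the final estimate, plus 1 to make it positive. *)
pose c := 2 * K * k2 + k2 * L * 2 + 1.
have c0 : 0 < c by rewrite ltr_wpDl// addr_ge0// !mulr_ge0.
pose e := eps / c; have e0 : 0 < e by rewrite divr_gt0.
have [M M0 hM] := TP_bounded (TP_horner A).
pose gg (sg : R) : fn R := fun z => (Num.sqrt (Num.max (sg * complex.Re A.[z]) 0))%:C%C.
have key (sg : R) : `|sg| = 1 -> exists B, [/\ complex.Im B.[0] = 0,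
    nrm p (horner B) <= K * (nrm p (rep A) + k2 * e) &
    nrm 2 (fminus (rep B) (sqf (gg sg))) <= e].
  move=> sg1.
  have mr : measurable_fun D (fun th => Num.max (sg * complex.Re A.[circ th]) 0).
    apply: measurable_maxr; last exact: measurable_cst.
    by apply: measurable_funM; [exact: measurable_cst|exact: meas_Re].
  have mgg : measC (gg sg).
    rewrite measCE; split; last exact: measurable_cst.
    apply: (@measurableT_comp _ _ _ _ _ _ (@Num.sqrt R)) => //.
    by apply: continuous_measurable_fun; exact: sqrt_continuous.
  have sgu th : Num.max (sg * complex.Re A.[circ th]) 0 <= `|complex.Re A.[circ th]|.
    rewrite ge_max normr_ge0 andbT (le_trans (ler_norm _))// normrM sg1 mul1r//.
  have g0 th : 0 <= Num.max (sg * complex.Re A.[circ th]) 0 by rewrite le_max lexx orbT.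
  have sqE th : sqf (gg sg) (circ th) = (Num.max (sg * complex.Re A.[circ th]) 0)%:C%C.
    by rewrite /sqf cmod_real real_normK ?num_real// sqr_sqrtr.
  have gb th : cmod (gg sg (circ th)) <= M + 1.
    rewrite cmod_real ger0_norm ?sqrtr_ge0//.
    apply: (@le_trans _ _ (Num.sqrt ((M + 1) ^+ 2))).
      rewrite ler_wsqrtr// (le_trans (sgu _))// (le_trans (Re_cmod _))// (le_trans (hM _))//.
      nra.
    by rewrite sqrtr_sqr ger0_norm// addr_ge0.
  have [|psi [Tp hp]] := approx_sqr mgg _ gb e0; first by rewrite ltr_wpDl.
  have [B [B0 hB]] := completion (TP_sqf Tp).
  have rB th : rep B (circ th) = sqf psi (circ th) by rewrite /rep hB.
  have h2 : nrm 2 (fminus (rep B) (sqf (gg sg))) <= e.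
    apply: le_trans hp; rewrite le_eqVlt; apply/orP; left; apply/eqP.
    by apply: nrm_eq => th _; rewrite /fminus rB.
  have Lsq r : 0 <= r -> LL r (sqf (gg sg)).
    move=> r0; apply: Linf_Lp => //; apply: (@Linf_cmod _ _ M).
      rewrite measCE; split; last exact: measurable_cst.
      by apply: measurable_funX; exact: meas_cmod.
    apply: aeD_all => th _; rewrite sqE cmod_real ger0_norm// (le_trans (sgu _))//.
    by rewrite (le_trans (Re_cmod _)).
  have Ld r : 0 <= r -> LL r (fminus (rep B) (sqf (gg sg))).
    by move=> r0; apply: Lp_minus => //; [exact: LL_rep|exact: Lsq].
  exists B; split=> //.
  apply: le_trans (hK B B0 _) _ => [th|]; first by rewrite hB /= exprn_ge0// cmod_ge0.
  rewrite ler_wpM2l//.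
  have -> : nrm p (rep B) = nrm p (fadd (sqf (gg sg)) (fminus (rep B) (sqf (gg sg)))).
    by apply: nrm_eq => th _; rewrite /fadd /fminus addrC subrK.
  apply: le_trans (nrm_add (ltW p1) (Lsq _ (ltW p0)) (Ld _ (ltW p0))) _.
  rewrite lerD//.
    apply: nrm_mono => //; [exact: Lsq (ltW p0)|exact: LL_rep (ltW p0)|].
    apply: aeD_all => th _; rewrite sqE !cmod_real ger0_norm// sgu//.
  have [_ h] := nrm_le_nrm (ltW p1) (ltW p2) (Ld 2 (ler0n _ 2)).
  by apply: le_trans h _; rewrite ler_wpM2l.
have [B1 [B10 nB1 dB1]] := key 1 (normr1 _).
have [B2 [B20 nB2 dB2]] := key (-1) (normrN1 _).
pose E := A - B1 + B2.
have E0 : complex.Im E.[0] = 0.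
  by rewrite /E hornerD hornerD hornerN !cImD cImN A0 B10 B20 oppr0 !addr0.
have rE th : rep E (circ th) = fminus (fminus (rep B2) (sqf (gg (-1)))) (fminus (rep B1) (sqf (gg 1))) (circ th).
  rewrite /fminus /sqf /gg /rep !cmod_real -!rmorphB /=; congr (_%:C)%C.
  rewrite !real_normK ?num_real// !sqr_sqrtr ?le_max ?lexx ?orbT//.
  rewrite /E !hornerD hornerN !cReD cReN mul1r mulN1r.
  set u := complex.Re A.[circ th]; set b1 := complex.Re _; set b2 := complex.Re _.
  rewrite -{1}(max_subN u); ring.
have Lsq sg : LL 2 (sqf (gg sg)).
  apply: Linf_Lp => //; apply: (@Linf_cmod _ _ (`|sg| * M)).
    rewrite measCE; split; last exact: measurable_cst.
    apply: measurable_funX; apply: meas_cmod; rewrite measCE; split; last exact: measurable_cst.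
    apply: (@measurableT_comp _ _ _ _ _ _ (@Num.sqrt R)) => //.
      by apply: continuous_measurable_fun; exact: sqrt_continuous.
    apply: measurable_maxr; last exact: measurable_cst.
    by apply: measurable_funM; [exact: measurable_cst|exact: meas_Re].
  apply: aeD_all => th _; rewrite /sqf /gg !cmod_real real_normK ?num_real//.
  rewrite sqr_sqrtr ?le_max ?lexx ?orbT// ger0_norm ?le_max ?lexx ?orbT//.
  rewrite ge_max mulr_ge0// andbT (le_trans (ler_norm _))// normrM ler_wpM2l//.
  by rewrite (le_trans (Re_cmod _)).
have Ld B sg : LL 2 (fminus (rep B) (sqf (gg sg))) by apply: Lp_minus => //; exact: LL_rep.
have nE : nrm p (horner E) <= k2 * (L * (2 * e)).
  have [_ h] := nrm_le_nrm (ltW p1) (ltW p2) (LL_horner E (ler0n _ 2)).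
  apply: le_trans h _; rewrite ler_wpM2l//; apply: le_trans (hL E E0) _; rewrite ler_wpM2l//.
  have -> : nrm 2 (rep E) = nrm 2 (fminus (fminus (rep B2) (sqf (gg (-1)))) (fminus (rep B1) (sqf (gg 1)))).
    by apply: nrm_eq => th _; exact: rE.
  apply: le_trans (nrmB (ler1n _ 2) (Ld _ _) (Ld _ _)) _.
  by rewrite mulr_natl mulr2n lerD.
have -> : nrm p (horner A) = nrm p (fadd (fminus (horner B1) (horner B2)) (horner E)).
  apply: nrm_eq => th _; rewrite /fadd /fminus /E !hornerD hornerN; ring.
have Lh A' : LL p (horner A') := LL_horner A' (ltW p0).
apply: le_trans (nrm_add (ltW p1) (Lp_minus (ltW p0) (Lh _) (Lh _)) (Lh _)) _.
apply: le_trans (lerD (nrmB (ltW p1) (Lh B1) (Lh B2)) (lexx _)) _.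
apply: le_trans (lerD (lerD nB1 nB2) nE) _.
have -> : eps = c * e by rewrite /e mulrC divfK// gt_eqF.
rewrite /c; have := nrm_ge0 p (rep A); move: (nrm p (rep A)) => x x0; nra.
Qed.

Definition PT (s : seq (C * int)) : fn R := tpoly [seq x <- s | 0 <= x.2].

Definition riesz_bound (p : R) : Prop := exists2 K, 0 <= K &
  forall s, nrm p (PT s) <= K * nrm p (tpoly s).

Lemma TP_tpoly s : TP (@tpoly R s).
Proof. by exists s. Qed.

(** Complexification of the real-linear [Fpoly]: passing to [-i f] and multiplying the result by [i]
    leaves the terms with nonnegative exponents unchanged and reverses the sign of the conjugated
    ones, so the average is the projection. *)
Lemma PT_Fpoly s (th : R) : PT s (circ th) =
  2^-1 * ((Fpoly s).[circ th] + 'i%C * (Fpoly [seq (- 'i%C * x.1, x.2) | x <- s]).[circ th]).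
Proof.
rewrite /PT /tpoly big_filter /Fpoly !horner_sum big_map mulr_sumr -big_split /= mulr_sumr.
rewrite big_mkcond /=; apply: eq_bigr => -[c n] _ /=; rewrite !hornerZ !hornerXn.
have ii : 'i%C * 'i%C = -1 :> C by rewrite -expr2 sqr_i.
case: n => n /=.
  rewrite -exprnP; set X := _ ^+ n.
  transitivity (2^-1 * (c * X - 'i%C * 'i%C * (c * X))); last by congr (_ * _); ring.
  by rewrite ii; field.
rewrite rmorphM rmorphN /=.
have -> : (0 -i* 1)%C = - 'i%C :> C by apply: complex_eq; rewrite /= ?oppr0.
set X := _ ^+ _; rewrite opprK.
transitivity (2^-1 * (conjc c * X + 'i%C * 'i%C * (conjc c * X))); last by congr (_ * _); ring.
by rewrite ii mulN1r subrr mulr0.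
Qed.

(** [Fpoly] differs from [Fcpoly] by the imaginary part of the mean, which [coef_nrm] bounds; this
    accounts for the summand [k * n1] of the constant. *)
Lemma riesz_real_bound p : 1 < p -> @riesz_real R p -> riesz_bound p.
Proof.
move=> p1 [K K0 hK]; have p0 : 0 < p by exact: lt_trans p1.
pose k := pi^-1 * (2 * pi + 1) : R.
pose n1 := nrm p (@fcst R 1).
have k0 : 0 <= k by rewrite mulr_ge0 ?invr_ge0 ?pi_ge0// addr_ge0// ltW// pi2_gt0.
have n10 : 0 <= n1 by exact: nrm_ge0.
have L1 : LL p (@fcst R 1) by apply: TP_Lp; [exact: ltW|exact: TP_cst].
exists (K + k * n1); first by rewrite addr_ge0// mulr_ge0.
move=> s; pose s' := [seq (- 'i%C * x.1, x.2) | x <- s].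
have s'E th : tpoly s' (circ th) = - 'i%C * tpoly s (circ th).
  by rewrite /tpoly big_map mulr_sumr; apply: eq_bigr => x _; rewrite /= mulrA.
have Lt t : LL p (@tpoly R t) by apply: TP_Lp; [exact: ltW|exact: TP_tpoly].
have ci : cmod ('i%C : C) = 1 by rewrite /cmod /= expr0n /= add0r expr1n sqrtr1.
have ns' : nrm p (tpoly s') = nrm p (tpoly s).
  rewrite (@nrm_eq _ p _ (fscal (- 'i%C) (tpoly s))); first by rewrite nrmZ// cmodN ci mul1r.
  by move=> th _; rewrite s'E.
have one t : nrm p (horner (Fpoly t)) <= (K + k * n1) * nrm p (tpoly t).
  rewrite (@nrm_eq _ p _ (fadd (horner (Fcpoly t)) (fscal ('i%C * (complex.Im (cmean (tpoly t)))%:C%C) (fcst 1)))); last first.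
    by move=> th _; rewrite /fadd /fscal /fcst mulr1 Fcpoly_horner subrK.
  apply: le_trans (nrm_add (ltW p1) (LL_horner _ (ltW p0)) (Lp_scal _ L1)) _.
  rewrite nrmZ// cmodM ci mul1r mulrDl lerD//.
    apply: le_trans (hK _ (Fcpoly_Im0 t)) _; rewrite ler_wpM2l//.
    apply: nrm_mono => //; [exact: LL_rep (ltW p0)|].
    by apply: aeD_all => th _; rewrite cmod_real Re_Fcpoly Re_cmod.
  rewrite mulrAC ler_wpM2r// cmod_real (le_trans (Im_cmod _))//.
  have := coef_nrm 0 (ltW p1) (Lt t); congr (_ <= _); congr cmod; apply: cmean_eq => th.
  by rewrite /fmul /tpow oppr0 expr0z mulr1.
rewrite (@nrm_eq _ p _ (fscal 2^-1 (fadd (horner (Fpoly s)) (fscal 'i%C (horner (Fpoly s')))))); last first.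
  by move=> th _; rewrite PT_Fpoly.
have Lh A' : LL p (horner A') := LL_horner A' (ltW p0).
have Li := Lp_scal 'i%C (Lh (Fpoly s')).
rewrite nrmZ//; last by apply: Lp_add => //; exact: ltW.
have -> : cmod (2^-1 : C) = 2^-1.
  have -> : (2^-1 : C) = (2^-1)%:C%C by rewrite fmorphV rmorph_nat.
  by rewrite cmod_real ger0_norm// invr_ge0.
rewrite -ler_pdivlMl ?invr_gt0// invrK.
apply: le_trans (nrm_add (ltW p1) (Lh _) Li) _.
rewrite nrmZ// ci mul1r mulr_natl mulr2n lerD// -?ns'; exact: one.
Qed.

End riesz_projection.

(** * Exponents above 2 by duality *)

Section riesz_duality.
Context {R : realType}.
Local Notation D := (@I02 R).
Local Notation C := R[i].
Implicit Types (f g : fn R) (s t : seq (C * int)).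

(** The transpose of [PT] for the bilinear pairing given by the mean of [f g], in which exponents
    must sum to 0. *)
Definition PTm t : fn R := tpoly [seq y <- t | y.2 <= 0].

Lemma cmean_mul_tpoly s t : cmean (fmul (tpoly s) (tpoly t)) =
  \sum_(x <- s) \sum_(y <- t) x.1 * y.1 * (x.2 + y.2 == 0)%:R :> C.
Proof.
transitivity (cmean (@tpoly R [seq (x.1 * y.1, x.2 + y.2) | x <- s, y <- t])); last first.
  by rewrite cmean_tpoly big_allpairs_dep.
apply: cmean_eq => th; rewrite /fmul /tpoly big_allpairs_dep /= mulr_suml.
apply: eq_bigr => x _; rewrite mulr_sumr; apply: eq_bigr => y _ /=.
by rewrite expfzDr ?circ_neq0// mulrACA.
Qed.

Lemma cmean_dual s t : cmean (fmul (PT s) (tpoly t)) = cmean (fmul (tpoly s) (PTm t)).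
Proof.
rewrite /PT /PTm !cmean_mul_tpoly big_filter big_mkcond /=.
apply: eq_bigr => x _; rewrite [RHS]big_filter [RHS]big_mkcond /=.
case: ifPn => x0; first apply: eq_bigr => y _.
  case: ifPn => // y0; rewrite (_ : _ + _ == 0 = false) ?mulr0//.
  by apply/negbTE/negP => /eqP; move: x0 y0; lia.
rewrite big1// => y _; case: ifPn => // y0.
rewrite (_ : _ + _ == 0 = false) ?mulr0//.
by apply/negbTE/negP => /eqP; move: x0 y0; lia.
Qed.

Lemma nrm_PTm p K t : 0 < p -> (forall s, nrm p (PT s) <= K * nrm p (tpoly s)) ->
  nrm p (PTm t) <= K * nrm p (tpoly t).
Proof.
move=> p0 hK; pose t' := [seq (y.1, - y.2) | y <- t].
have e1 th : PTm t (circ th) = tilde (PT t') (circ th).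
  rewrite /PTm /tilde /PT /tpoly !big_filter big_map.
  rewrite (eq_bigl (fun y : C * int => 0 <= - y.2)); last by move=> y; rewrite oppr_ge0.
  by apply: eq_bigr => y _ /=; rewrite exprz_inv opprK.
have e2 th : tpoly t' (circ th) = tilde (tpoly t) (circ th).
  rewrite /tilde /tpoly big_map; apply: eq_bigr => y _ /=.
  by rewrite exprz_inv.
have Lt s : LL p (@tpoly R s) by apply: TP_Lp; [exact: ltW|exact: TP_tpoly].
rewrite (nrm_eq p (fun th _ => e1 th)) nrm_tilde; last exact: Lt.
by apply: le_trans (hK t') _; rewrite (nrm_eq p (fun th _ => e2 th)) nrm_tilde.
Qed.

Lemma cmean_hoelder p q f g : 1 < p -> 1 < q -> p^-1 + q^-1 = 1 -> LL p f -> LL q g ->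
  LL 1 (fmul f g) /\ cmod (cmean (fmul f g)) <= pi^-1 * (nrm p f * nrm q g).
Proof.
move=> p1 q1 pq /LpP[mf jf] /LpP[mg jg].
have p0 : 0 < p by exact: lt_trans p1.
have q0 : 0 < q by exact: lt_trans q1.
have [i h] := hoelder_D p0 q0 pq (meas_cmod mf) (meas_cmod mg) (fun th => cmod_ge0 _)
  (fun th => cmod_ge0 _) jf jg.
have L : LL 1 (fmul f g).
  apply: cmod_L1; first exact: measC_mul.
  by apply: eq_Int i => th _; rewrite /fmul cmodM.
split=> //; apply: le_trans (cmean_norm L) _.
rewrite ler_wpM2l ?invr_ge0 ?pi_ge0// !nrmE; apply: le_trans h.
by rewrite le_eqVlt; apply/orP; left; apply/eqP; apply: eq_intg => th _; rewrite /fmul cmodM.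
Qed.

Lemma nrm_lt_of_intg p f e : 0 < p -> 0 < e ->
  intg (fun th => cmod (f (circ th)) `^ p) < e `^ p -> nrm p f < e.
Proof.
move=> p0 e0 h; rewrite nrmE.
have eE : e = (e `^ p) `^ p^-1 by rewrite -powRrM mulfV ?gt_eqF// powRr1// ltW.
rewrite [ltRHS]eE gt0_ltr_powR ?nnegrE ?invr_gt0 ?powR_ge0//.
by apply: intg_ge0 => th _; exact: powR_ge0.
Qed.

Lemma TP_dense_nrm p f e : 0 < p -> LL p f -> 0 < e ->
  exists s, nrm p (fminus f (tpoly s)) < e.
Proof.
move=> p0 Lf e0; have [phi [[s hs] h]] := TP_dense p0 Lf (powR_gt0 p e0).
exists s; apply: nrm_lt_of_intg => //; apply: le_lt_trans h.
by rewrite le_eqVlt; apply/orP; left; apply/eqP; apply: eq_intg => th _; rewrite /fminus hs.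
Qed.

Lemma riesz_bound_dual p q : 2 < p -> 1 < q -> p^-1 + q^-1 = 1 ->
  @riesz_bound R q -> @riesz_bound R p.
Proof.
move=> p2 q1 pq [K K0 hK].
have p0 : 0 < p by exact: lt_trans p2.
have p1 : 1 < p by apply: lt_trans p2; rewrite ltr1n.
have q0 : 0 < q by exact: lt_trans q1.
have pqE : (p - 1) * q = p.
  have e : q^-1 = 1 - p^-1 by rewrite -pq addrAC subrr add0r.
  have -> : p - 1 = p * q^-1 by rewrite e mulrBr mulr1 mulfV// gt_eqF.
  by rewrite divfK// gt_eqF.
exists (2 * K); first by rewrite mulr_ge0.
move=> s; pose h := PT s.
have Th : TP h by exact: TP_tpoly.
have [M M0 hM] := TP_bounded Th.
have Lh : LL p h by apply: TP_Lp => //; exact: ltW.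
have Lt r t : 0 <= r -> LL r (@tpoly R t) by move=> r0; apply: TP_Lp => //; exact: TP_tpoly.
(* The extremal function of Hölder's inequality for [h]: [h G = |h|^p], and the [q]-norm of [G] is
   [X^(p-1)]. It is replaced by a polynomial [t] so that the projection can be moved onto [t]. *)
pose G : fn R := fun z => (cmod (h z) `^ (p - 2))%:C%C * conjc (h z).
have mh : measC h by exact: TP_meas.
have mG : measC G.
  apply: (@measC_mul _ (fun z => (cmod (h z) `^ (p - 2))%:C%C) (fun z => conjc (h z))).
    by rewrite measCE; split; [exact: meas_powcmod|exact: measurable_cst].
  by apply: TP_meas; exact: TP_conj.
have cG z : cmod (G z) = cmod (h z) `^ (p - 1).
  rewrite /G cmodM cmod_real cmod_conj ger0_norm ?powR_ge0//.
  have -> : p - 2 = (p - 1) - 1 by ring.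
  by rewrite mulrC mulr_powRB1 ?cmod_ge0// subr_gt0.
have hG z : fmul h G z = (cmod (h z) `^ p)%:C%C.
  rewrite /fmul /G mulrCA -sqr_normc -cmodE -rmorphXn -rmorphM /=; congr (_%:C)%C.
  rewrite -powR_mulrn ?cmod_ge0// -powRD; last first.
    by apply/implyP; rewrite subrK gt_eqF.
  by rewrite subrK.
have LG : LL q G.
  apply/LpP; split=> //; have /LpP[_] := Lh; apply: eq_Int => th _.
  by rewrite cG -powRrM pqE.
pose X := nrm p h; have X0 : 0 <= X by exact: nrm_ge0.
have nG : nrm q G = X `^ (p - 1).
  rewrite nrmE (@eq_intg _ _ (fun th => cmod (h (circ th)) `^ p)); last first.
    by move=> th _; rewrite cG -powRrM pqE.
  rewrite -nrm_pow// -powRrM -/X; congr powR.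
  by rewrite -{1}pqE mulfK// gt_eqF.
have main e : 0 < e -> (2 * pi)^-1 * X `^ p <=
    pi^-1 * (nrm p (tpoly s) * (K * (X `^ (p - 1) + e))) + pi^-1 * (X * e).
  move=> e0; have [t ht] := TP_dense_nrm q0 LG e0.
  have LGt : LL q (fminus G (tpoly t)) by apply: Lp_minus; rewrite ?(ltW q0)//; apply: Lt; exact: ltW.
  have [L1 b1] := cmean_hoelder p1 q1 pq Lh LGt.
  have [L2 b2] := cmean_hoelder p1 q1 pq (Lt p s (ltW p0)) (Lt q [seq y <- t | y.2 <= 0] (ltW q0)).
  have L3 : LL 1 (fmul h (tpoly t)).
    by apply: TP_Lp => //; apply: TP_mul => //; exact: TP_tpoly.
  have eX : (2 * pi)^-1 * X `^ p = complex.Re (cmean (fmul h G)).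
    rewrite Re_cmean /X nrm_pow//; congr (_ * _); apply: eq_intg => th _.
    by rewrite hG.
  have split_ : cmean (fmul h G) = cmean (fmul h (tpoly t)) + cmean (fmul h (fminus G (tpoly t))).
    rewrite -cmeanD//; apply: cmean_eq => th; rewrite /fadd /fmul /fminus; ring.
  rewrite eX split_ cReD lerD//.
    apply: le_trans (ler_norm _) _; apply: le_trans (Re_cmod _) _.
    rewrite cmean_dual; apply: le_trans b2 _.
    rewrite ler_wpM2l ?invr_ge0 ?pi_ge0// ler_wpM2l ?nrm_ge0//.
    apply: le_trans (nrm_PTm t q0 hK) _; rewrite ler_wpM2l// -nG.
    have -> : nrm q (tpoly t) = nrm q (fminus G (fminus G (tpoly t))).
      by apply: nrm_eq => th _; rewrite /fminus opprB addrC subrK.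
    by apply: le_trans (nrmB (ltW q1) LG LGt) _; rewrite lerD2l ltW.
  apply: le_trans (ler_norm _) _; apply: le_trans (Re_cmod _) _.
  apply: le_trans b1 _; rewrite ler_wpM2l ?invr_ge0 ?pi_ge0// ler_wpM2l//.
  exact: ltW.
have [X00|Xn0] := eqVneq X 0; first by rewrite -/h -/X X00 !mulr_ge0 ?nrm_ge0.
have Xp : 0 < X by rewrite lt_def Xn0 X0.
have lim : (2 * pi)^-1 * X `^ p <= pi^-1 * (nrm p (tpoly s) * (K * X `^ (p - 1))).
  apply/ler_addgt0Pr => eps eps0.
  pose c := pi^-1 * (nrm p (tpoly s) * K) + pi^-1 * X + 1.
  have c0 : 0 < c by rewrite ltr_wpDl// addr_ge0// !mulr_ge0 ?invr_ge0 ?pi_ge0 ?nrm_ge0.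
  apply: le_trans (main _ (divr_gt0 eps0 c0)) _.
  set e := eps / c; have -> : eps = c * e by rewrite /e mulrC divfK// gt_eqF.
  have e0 : 0 <= e by rewrite divr_ge0// ltW.
  rewrite /c; move: (nrm _ _) (pi^-1) (X `^ (p - 1)) => a b y.
  by rewrite -subr_ge0 (_ : _ - _ = e) //; ring.
move: lim; rewrite -/h -/X -(mulr_powRB1 X0 p0) invfM.
set y := X `^ (p - 1); have y0 : 0 < y by exact: powR_gt0.
have pi0 : 0 < pi^-1 :> R by rewrite invr_gt0 pi_gt0.
move: (nrm _ _) (pi^-1 : R) pi0 => a b b0 H.
(* Division by [pi^-1 X^(p-1)]. The factor [2^-1] is the ratio of [(2 * pi)^-1] in the mean to the
   [pi^-1] of [cmean_hoelder], and leads to the constant [2 * K]. *)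
have : 2^-1 * X <= a * K.
  rewrite -(ler_pM2r (mulr_gt0 b0 y0)); apply: le_trans (le_trans _ H) _.
    by rewrite le_eqVlt; apply/orP; left; apply/eqP; ring.
  by rewrite le_eqVlt; apply/orP; left; apply/eqP; ring.
by rewrite ler_pdivrMl// => /le_trans; apply; rewrite le_eqVlt; apply/orP; left; apply/eqP; ring.
Qed.

Lemma riesz_bound_all p : 1 < p -> @riesz_bound R p.
Proof.
move=> p1; have p0 : 0 < p by exact: lt_trans p1.
have [p2|p2|->] := ltgtP p 2.
- by apply: riesz_real_bound => //; exact: riesz_real_lt2.
- pose q := p / (p - 1).
  have d0 : 0 < p - 1 by rewrite subr_gt0.
  have q1 : 1 < q by rewrite /q ltr_pdivlMr// mul1r gtrBl.
  have q2 : q < 2 by rewrite /q ltr_pdivrMr//; lra.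
  have pq : p^-1 + q^-1 = 1.
    by rewrite /q invf_div; field; rewrite gt_eqF.
  apply: (riesz_bound_dual p2 q1 pq).
  by apply: riesz_real_bound => //; exact: riesz_real_lt2.
- by apply: riesz_real_bound; [rewrite ltr1n|exact: riesz_real2].
Qed.

End riesz_duality.

(** * The Riesz projection on [L^p] *)

Section projection.
Context {R : realType}.
Local Notation D := (@I02 R).
Local Notation C := R[i].
Implicit Types (f g : fn R) (s t : seq (C * int)).

Lemma PT_cat s t z : PT (s ++ t) z = PT s z + PT t z :> C.
Proof. by rewrite /PT /tpoly filter_cat big_cat. Qed.

Definition tneg s : seq (C * int) := [seq (- x.1, x.2) | x <- s].

Lemma tpoly_neg s z : tpoly (tneg s) z = - tpoly s z :> C.
Proof.
by rewrite /tpoly big_map -sumrN; apply: eq_bigr => x _; rewrite mulNr.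
Qed.

Lemma PT_neg s z : PT (tneg s) z = - PT s z :> C.
Proof.
rewrite /PT /tpoly !big_filter big_map -sumrN; apply: eq_bigr => x _.
by rewrite mulNr.
Qed.

Lemma coef_tpoly s n : coef (tpoly s) n = \sum_(x <- s) x.1 * (x.2 == n)%:R :> C.
Proof.
rewrite /coef (_ : fmul _ _ = fmul (tpoly s) (tpoly [:: (1, - n)])); last first.
  by apply/funext => z; rewrite /fmul /tpoly big_seq1 mul1r.
rewrite cmean_mul_tpoly; apply: eq_bigr => x _.
by rewrite big_seq1 mulr1 subr_eq0.
Qed.

Lemma coef_PT s n : coef (PT s) n = if 0 <= n then coef (tpoly s) n else 0 :> C.
Proof.
rewrite !coef_tpoly big_filter big_mkcond /=; case: ifPn => n0.
  apply: eq_bigr => x _; case: ifPn => // x0.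
  by rewrite (_ : x.2 == n = false) ?mulr0//; apply/negbTE/negP => /eqP e; rewrite e n0 in x0.
rewrite big1// => x _; case: ifPn => // x0.
by rewrite (_ : x.2 == n = false) ?mulr0//; apply/negbTE/negP => /eqP e; rewrite e (negbTE n0) in x0.
Qed.

Lemma le_eps (x k : R) : 0 <= k -> (forall e, 0 < e -> x <= k * e) -> x <= 0.
Proof.
move=> k0 H; apply/ler_addgt0Pr => e e0; rewrite add0r.
have k1 : 0 < k + 1 by rewrite ltr_wpDl.
apply: le_trans (H (e / (k + 1)) (divr_gt0 e0 k1)) _.
by rewrite mulrA ler_pdivrMr// mulrC ler_wpM2l ?(ltW e0)// lerDl.
Qed.

Lemma LL_sub_eq0 p f : 1 <= p -> LL p f -> nrm p f <= 0 -> aeeq f (fcst 0).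
Proof.
move=> p1 Lf h; apply: (@nrm_eq0 _ p) => //; first exact: lt_le_trans p1.
by apply/eqP; rewrite eq_le h nrm_ge0.
Qed.

(** Extension by continuity: polynomials [s n] tend to [f] so fast that the projections of their
    differences form a series to which [LL_complete0] applies. Coefficients and norm bound pass to
    the limit. *)
Lemma riesz_ext p : 1 < p -> exists2 K, 0 <= K & forall f, LL p f -> exists g,
  [/\ LL p g, forall n, coef g n = if 0 <= n then coef f n else 0 & nrm p g <= K * nrm p f].
Proof.
move=> p1; have p0 : 0 < p by exact: lt_trans p1.
have [K K0 hK] := riesz_bound_all p1.
exists K => // f Lf.
have p1' := ltW p1; have p0' := ltW p0.
have k10 : 0 < 2 * (K + 1) by rewrite mulr_gt0// ltr_wpDl.
(* Consecutive polynomials differ by at most [2 e n] in norm, and [K] times this is at most [2^-n];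
   [K + 1] avoids dividing by 0. *)
pose e n : R := 2^-1 ^+ n / (2 * (K + 1)).
have e0 n : 0 < e n by rewrite divr_gt0// exprn_gt0.
have /choice[s hs] n := TP_dense_nrm p0 Lf (e0 n).
have Lt t : LL p (@tpoly R t) by apply: TP_Lp => //; exact: TP_tpoly.
pose dd n := s n.+1 ++ tneg (s n).
have nd n : nrm p (PT (dd n)) <= 2^-1 ^+ n.
  apply: le_trans (hK _) _.
  have -> : nrm p (tpoly (dd n)) = nrm p (fminus (fminus f (tpoly (s n))) (fminus f (tpoly (s n.+1)))).
    apply: nrm_eq => th _; rewrite /dd {1}/tpoly big_cat -!/(tpoly _ _) /= tpoly_neg /fminus; ring.
  have h : nrm p (fminus (fminus f (tpoly (s n))) (fminus f (tpoly (s n.+1)))) <= e n + e n.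
    apply: le_trans (nrmB p1' (Lp_minus p0' Lf (Lt _)) (Lp_minus p0' Lf (Lt _))) _.
    rewrite lerD ?(ltW (hs n))// (le_trans (ltW (hs n.+1)))// /e exprS.
    rewrite ler_wpM2r ?invr_ge0 ?(ltW k10)// ler_piMl ?exprn_ge0//; lra.
  apply: le_trans (ler_wpM2l K0 h) _; rewrite /e.
  have x0 : 0 <= 2^-1 ^+ n :> R by rewrite exprn_ge0.
  move: (2^-1 ^+ n) x0 => x x0.
  have -> : K * (x / (2 * (K + 1)) + x / (2 * (K + 1))) = x * (K / (K + 1)).
    by field; rewrite gt_eqF// ltr_wpDl.
  by rewrite ler_piMr// ler_pdivrMr ?ltr_wpDl// mul1r lerDl.
have [g0 [Lg0 cg0]] := LL_complete0 p1' (fun n => Lt _) nd.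
pose g := fadd g0 (PT (s 0%N)).
have Lg : LL p g := Lp_add p0' Lg0 (Lt _).
have psum n th : \sum_(i < n) PT (dd i) (circ th) = PT (s n) (circ th) - PT (s 0%N) (circ th).
  elim: n => [|n IH]; first by rewrite big_ord0 subrr.
  by rewrite big_ord_recr /= IH /dd PT_cat PT_neg; ring.
have cg : nrm p (fminus g (PT (s n))) @[n --> \oo] --> (0 : R).
  apply: cvg_trans cg0; apply: near_eq_cvg; apply: nearW => n.
  by apply: nrm_eq => th _; rewrite /fminus /g /fadd psum; ring.
have ce : e n @[n --> \oo] --> (0 : R).
  rewrite -[X in _ --> X](mul0r (2 * (K + 1))^-1); apply: cvgM; last exact: cvg_cst.
  by apply: cvg_expr; rewrite ger0_norm; lra.
have near eps : 0 < eps -> exists n, nrm p (fminus g (PT (s n))) <= eps /\ nrm p (fminus f (tpoly (s n))) <= eps.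
  move=> eps0; have /cvgr0_norm_lt/(_ _ eps0)[N1 _ h1] := cg.
  have /cvgr0_norm_lt/(_ _ eps0)[N2 _ h2] := ce.
  exists (maxn N1 N2); split.
    have := h1 (maxn N1 N2) (leq_maxl _ _); rewrite /= ger0_norm ?nrm_ge0//; exact: ltW.
  have := h2 (maxn N1 N2) (leq_maxr _ _); rewrite /= ger0_norm ?(ltW (e0 _))// => h.
  by rewrite ltW// (lt_trans (hs _)).
exists g; split=> //.
- move=> n; pose c := pi^-1 * (2 * pi + 1) : R.
  have c0 : 0 <= c by rewrite mulr_ge0 ?invr_ge0 ?pi_ge0// addr_ge0// ltW// pi2_gt0.
  have L1 h : LL p h -> LL 1 h by exact: Lp_Lp1.
  have cB h1 h2 : LL p h1 -> LL p h2 -> cmod (coef h1 n - coef h2 n) <= c * nrm p (fminus h1 h2).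
    move=> l1 l2; rewrite -fcoefB; [|exact: L1..].
    by apply: coef_nrm => //; exact: Lp_minus.
  apply/eqP; rewrite -subr_eq0 -cmod_eq0 eq_le cmod_ge0 andbT.
  apply: (@le_eps _ (c * 2)); first by rewrite mulr_ge0.
  move=> eps eps0; have [m [h1 h2]] := near _ eps0.
  have -> : coef g n - (if 0 <= n then coef f n else 0) = (coef g n - coef (PT (s m)) n) +
     (coef (PT (s m)) n - (if 0 <= n then coef f n else 0)) by rewrite addrA subrK.
  apply: le_trans (cmodD _ _) _.
  have b1 : cmod (coef g n - coef (PT (s m)) n) <= c * eps.
    by apply: le_trans (cB _ _ Lg (Lt _)) _; rewrite ler_wpM2l.
  have b2 : cmod (coef (PT (s m)) n - (if 0 <= n then coef f n else 0)) <= c * eps.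
    rewrite coef_PT; case: ifP => _; last by rewrite subrr cmod0 mulr_ge0// ltW.
    rewrite -cmodN opprB; apply: le_trans (cB _ _ Lf (Lt _)) _; rewrite ler_wpM2l//.
  by rewrite -mulrA mulr_natl mulr2n mulrDr lerD.
- rewrite -subr_le0; apply: (@le_eps _ (1 + K)); first by rewrite addr_ge0.
  move=> eps eps0; have [m [h1 h2]] := near _ eps0.
  rewrite lerBlDr.
  have -> : nrm p g = nrm p (fadd (fminus g (PT (s m))) (PT (s m))).
    by apply: nrm_eq => th _; rewrite /fadd /fminus subrK.
  apply: le_trans (nrm_add p1' (Lp_minus p0' Lg (Lt _)) (Lt _)) _.
  rewrite mulrDl mul1r -addrA lerD//; apply: le_trans (hK _) _; rewrite -mulrDr ler_wpM2l//.
  have -> : nrm p (tpoly (s m)) = nrm p (fminus f (fminus f (tpoly (s m)))).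
    by apply: nrm_eq => th _; rewrite /fminus opprB addrC subrK.
  apply: le_trans (nrmB p1' Lf (Lp_minus p0' Lf (Lt _))) _.
  by rewrite addrC lerD2r.
Qed.

(** [riesz_ext] shows that the property defining [Proj] can be met, and uniqueness of coefficients
    identifies the chosen function almost everywhere with the one of [riesz_ext], whose bound it
    inherits. *)
Lemma Proj_spec p : 1 < p -> exists2 K, 0 <= K & forall f, LL p f ->
  [/\ LL p (Proj f), forall n, coef (Proj f) n = if 0 <= n then coef f n else 0 &
      nrm p (Proj f) <= K * nrm p f].
Proof.
move=> p1; have [K K0 hK] := riesz_ext p1; exists K => // f Lf.
have [g [Lg cg ng]] := hK _ Lf.
have L1g := Lp_Lp1 (ltW p1) Lg.
have ex : exists g, Lp 1 g /\ forall n : int, fc g n = if 0 <= n then fc f n else 0.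
  by exists g; split=> [|n]; rewrite -?LLE// !fcE cg.
have [L1 c1] := epsilon_spec (inhabits (fcst 0)) _ ex.
rewrite -/(Proj f) in L1 c1; rewrite -LLE in L1.
have c1' n : coef (Proj f) n = if 0 <= n then coef f n else 0.
  by rewrite -fcE c1 fcE.
have e : aeeq g (Proj f) by apply: coef_inj => // n; rewrite cg c1'.
have /LpP[mg _] := Lg; have /LpP[mP _] := L1.
split=> //.
- exact: aeeq_Lp e Lg.
- by rewrite -(nrm_aeeq p mg mP e).
Qed.

Lemma HpE p f : Hp p f <-> LL p f /\ forall n : int, n < 0 -> coef f n = 0.
Proof.
rewrite /Hp -LLE; split=> -[L h]; split=> // n n0; first by rewrite -fcE h.
by rewrite fcE h.
Qed.

End projection.

(** * An open mapping theorem for relations, using differences and halving only *)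

Section open_mapping.
Context {R : realType} (X Y : zmodType).
Variables (G : X -> Y -> Prop) (NX : X -> R) (NY : Y -> R) (hX : X -> X) (hY : Y -> Y).
Variable DY : Y -> Prop.
Hypothesis GD : forall x y, G x y -> DY y.
Hypothesis GB : forall x y x' y', G x y -> G x' y' -> G (x - x') (y - y').
Hypothesis Gh : forall x y, G x y -> G (hX x) (hY y).
Hypothesis NXB : forall x y x' y', G x y -> G x' y' -> NX (x - x') <= NX x + NX x'.
Hypothesis NXh : forall x y, G x y -> NX (hX x) = NX x / 2.
Hypothesis D0 : DY 0.
Hypothesis DB : forall y y', DY y -> DY y' -> DY (y - y').
Hypothesis NY0 : NY 0 = 0.
Hypothesis NYB : forall y y', DY y -> DY y' -> NY (y - y') <= NY y + NY y'.
Hypothesis NYh : forall y, DY y -> NY (hY y) = NY y / 2.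
Hypothesis NYge0 : forall y, 0 <= NY y.
Hypothesis hYD : forall y, DY y -> hY (y + y) = y.
Hypothesis hYB : forall y y', DY y -> DY y' -> hY (y - y') = hY y - hY y'.
Hypothesis complete : forall d_ : nat -> Y, (forall n, DY (d_ n)) ->
  (forall n, NY (d_ n) <= 2^-1 ^+ n) ->
  exists y, DY y /\ NY (y - \sum_(i < n) d_ i) @[n --> \oo] --> (0 : R).
Hypothesis Glim : forall (K : R) (x_ : nat -> X) (y_ : nat -> Y) y, 0 <= K ->
  (forall n, G (x_ n) (y_ n)) -> (forall n, NX (x_ n) <= K * 2^-1 ^+ n) -> DY y ->
  NY (y - \sum_(i < n) y_ i) @[n --> \oo] --> (0 : R) -> exists x, G x y /\ NX x <= 2 * K.
Hypothesis surj : forall y, DY y -> exists x, G x y.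

Let DN y : DY y -> DY (- y).
Proof. by move=> dy; rewrite -sub0r; exact: DB. Qed.

Let DD y y' : DY y -> DY y' -> DY (y + y').
Proof. by move=> dy dy'; rewrite -(opprK y'); apply: DB => //; exact: DN. Qed.

Let NYN y : DY y -> NY (- y) <= NY y.
Proof. by move=> dy; rewrite -[- y]sub0r (le_trans (NYB D0 dy))// NY0 add0r. Qed.

Let NYD y y' : DY y -> DY y' -> NY (y + y') <= NY y + NY y'.
Proof.
move=> dy dy'; rewrite -{1}(opprK y') (le_trans (NYB dy (DN dy')))// lerD2l.
exact: NYN.
Qed.

Let F (n : nat) (y : Y) : Prop := exists x, G x y /\ NX x <= n%:R.

(** [F n] consists of the values attained with norm at most [n]. If no [F n] were dense in a ball,
    one could choose shrinking balls with the [n]-th one away from [F n]. Their centres converge to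
    some [y], which lies in an [F n] by surjectivity, a contradiction. *)
Lemma baire_ball : exists n y0 r, [/\ DY y0, 0 < r & forall y, DY y -> NY (y - y0) <= r ->
  forall e, 0 < e -> exists y', F n y' /\ NY (y - y') <= e].
Proof.
apply: contrapT => /forallNP H.
have step (n : nat) (w : Y * R) : exists w' : Y * R, DY w.1 -> 0 < w.2 ->
    [/\ DY w'.1, 0 < w'.2, w'.2 <= w.2 / 2, NY (w'.1 - w.1) <= w.2 / 4 &
     forall y', F n y' -> w'.2 < NY (w'.1 - y')].
  have [[d1 d2]|nd] := pselect (DY w.1 /\ 0 < w.2); last first.
    by exists w => d1 d2; exfalso; apply: nd.
  have := H n => /forallNP/(_ w.1)/forallNP/(_ (w.2 / 4)) => nex.
  have [y [dy ny [e [e0 he]]]] : exists y, [/\ DY y, NY (y - w.1) <= w.2 / 4 &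
      exists e, 0 < e /\ forall y', F n y' -> e < NY (y - y')].
    apply: contrapT => K; apply: nex; split=> //; first by rewrite divr_gt0.
    move=> y dy ny e e0; apply: contrapT => K'; apply: K; exists y; split=> //.
    exists e; split=> // y' Fy'; rewrite ltNge; apply/negP => h; apply: K'.
    by exists y'.
  exists (y, Num.min e (w.2 / 2)) => _ _ /=; split=> //.
  - by rewrite lt_min e0 divr_gt0.
  - by rewrite ge_min lexx orbT.
  - by move=> y' Fy'; rewrite gt_min he.
have /choice[f hf] : forall nw : nat * (Y * R), exists w' : Y * R, DY nw.2.1 -> 0 < nw.2.2 ->
    [/\ DY w'.1, 0 < w'.2, w'.2 <= nw.2.2 / 2, NY (w'.1 - nw.2.1) <= nw.2.2 / 4 &
     forall y', F nw.1 y' -> w'.2 < NY (w'.1 - y')].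
  by case=> n w; exact: step.
pose w := fix w (n : nat) : Y * R := if n is n'.+1 then f (n', w n') else (0, 1).
have wS n : w n.+1 = f (n, w n) by [].
have wP n : DY (w n).1 /\ 0 < (w n).2.
  elim: n => [|n [d p]]; first by split=> //=; exact: ltr01.
  by rewrite wS; have [] := hf (n, w n) d p.
have wH n := hf (n, w n) (wP n).1 (wP n).2.
have rn n : (w n).2 <= 2^-1 ^+ n.
  elim: n => [|n IH]; first by rewrite expr0.
  have [_ _ h _ _] := wH n; rewrite wS exprS; apply: le_trans h _ => /=; lra.
pose d n := (w n.+1).1 - (w n).1.
have dD n : DY (d n) by apply: DB; [case: (wP n.+1)|case: (wP n)].
have nd n : NY (d n) <= (w n).2 / 4 by have [_ _ _ + _] := wH n.
have [y [dy cy]] : exists y, DY y /\ NY (y - \sum_(i < n) d i) @[n --> \oo] --> (0 : R).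
  apply: complete => // n; apply: le_trans (nd n) _; have := rn n; have [_] := wP n.
  by move=> ? ?; lra.
have sumd n : \sum_(i < n) d i = (w n).1.
  elim: n => [|n IH]; first by rewrite big_ord0.
  by rewrite big_ord_recr /= IH /d addrC subrK.
(* A centre moves by at most a quarter of the radius while the radius at least halves, so each step
   is paid for by half the decrease of the radius. The limit thus stays within half a radius of
   every centre. *)
have tail m k : NY ((w (m + k)%N).1 - (w m).1) <= (w m).2 / 2 - (w (m + k)%N).2 / 2.
  elim: k => [|k IH]; first by rewrite addn0 !subrr NY0.
  have -> : (w (m + k.+1)%N).1 - (w m).1 = d (m + k)%N + ((w (m + k)%N).1 - (w m).1).
    by rewrite addnS /d addrA subrK.
  apply: le_trans (NYD (dD _) (DB (wP _).1 (wP _).1)) _.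
  have h1 := nd (m + k)%N; have [_ _ h2 _ _] := wH (m + k)%N; rewrite -wS -addnS /= in h2.
  move: h2; rewrite addnS => h2; lra.
have lim m : NY (y - (w m).1) <= (w m).2 / 2.
  apply/ler_addgt0Pr => e e0; have /cvgr0_norm_lt/(_ _ e0)[N _ hN] := cy.
  have := hN (m + N)%N (leq_addl _ _); rewrite /= sumd ger0_norm// => h.
  have -> : y - (w m).1 = (y - (w (m + N)%N).1) + ((w (m + N)%N).1 - (w m).1) by rewrite addrA subrK.
  apply: le_trans (NYD (DB dy (wP _).1) (DB (wP _).1 (wP _).1)) _.
  have := tail m N; have [_] := wP (m + N)%N; lra.
have [x Gx] := surj dy.
pose n := (Num.truncn (NX x)).+1.
have Fy : F n y by exists x; split=> //; rewrite ltW// truncnS_gt.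
have [_ _ _ _ /(_ _ Fy)] := wH n; rewrite -wS => h.
have := lim n.+1; have [_ r0] := wP n.+1.
have : NY ((w n.+1).1 - y) <= NY (y - (w n.+1).1).
  by rewrite -opprB; apply: NYN; exact: DB (wP _).1.
lra.
Qed.

(** A small [y] is the difference of [y0 + y] and [y0], both approximable from [F n]; hence the
    bound [n + n]. Smaller scales follow by doubling [y] and halving the solution. *)
Lemma approx_solve : exists K r : R, [/\ 0 <= K, 0 < r & forall k y, DY y -> NY y <= r * 2^-1 ^+ k ->
  forall e, 0 < e -> exists x y', [/\ G x y', NX x <= K * 2^-1 ^+ k & NY (y - y') <= e]].
Proof.
have [n [y0 [r [dy0 r0 H]]]] := baire_ball.
exists (n%:R + n%:R), r; split=> //.
elim=> [|k IH] y dy ny e e0.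
  rewrite expr0 mulr1 in ny *.
  have e2 : 0 < e / 2 by rewrite divr_gt0.
  have [|y1 [[x1 [G1 n1]] h1]] := H (y0 + y) (DD dy0 dy) _ _ e2; first by rewrite addrAC subrr add0r.
  have [|y2 [[x2 [G2 n2]] h2]] := H y0 dy0 _ _ e2; first by rewrite subrr NY0 ltW.
  exists (x1 - x2), (y1 - y2); split.
  - exact: GB.
  - by rewrite ?expr0 ?mulr1; apply: le_trans (NXB G1 G2) (lerD n1 n2).
  - have -> : y - (y1 - y2) = (y0 + y - y1) - (y0 - y2).
      rewrite !opprB [y0 + y]addrC -!addrA; congr (_ + _).
      by rewrite [y0 + _]addrA [y0 - y1]addrC -addrA [y0 + _]addrC subrK addrC.
    apply: le_trans (NYB (DB (DD dy0 dy) (GD G1)) (DB dy0 (GD G2))) _; lra.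
have [||x [y' [Gx nx h]]] := IH (y + y) (DD dy dy) _ (e + e).
- rewrite -[NY _](@divfK _ 2)// -NYh; last exact: DD.
  by rewrite hYD//; move: ny; rewrite exprS; lra.
- by rewrite addr_gt0.
exists (hX x), (hY y'); split; first exact: Gh.
- by rewrite (NXh Gx) exprS; lra.
- have -> : y - hY y' = hY (y + y - y') by rewrite hYB ?hYD//; [exact: DD|exact: GD Gx].
  by rewrite NYh; [lra|apply: DB; [exact: DD|exact: GD Gx]].
Qed.

(** Successive correction: the [n]-th residual [z n] is solved up to half the admissible size, and
    [Glim] sums the corrections, whose norms decay like [K 2^-n]. *)
Theorem open_mapping : exists K r : R, [/\ 0 <= K, 0 < r & forall k y, DY y -> NY y <= r * 2^-1 ^+ k ->
  exists x, G x y /\ NX x <= K * 2^-1 ^+ k].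
Proof.
have [K [r [K0 r0 H]]] := approx_solve.
exists (2 * K), r; split=> //; first by rewrite mulr_ge0.
elim=> [|k IH] y dy ny; last first.
  have [|x [Gx nx]] := IH (y + y) (DD dy dy).
    rewrite -[NY _](@divfK _ 2)// -NYh; last exact: DD.
    by rewrite hYD//; move: ny; rewrite exprS; lra.
  exists (hX x); split; first by rewrite -(hYD dy); exact: Gh.
  by rewrite (NXh Gx) exprS; lra.
rewrite expr0 !mulr1 in ny *.
have /choice[f hf] : forall nz : nat * Y, exists w : X * Y, DY nz.2 -> NY nz.2 <= r * 2^-1 ^+ nz.1 ->
    [/\ G w.1 w.2, NX w.1 <= K * 2^-1 ^+ nz.1 & NY (nz.2 - w.2) <= r * 2^-1 ^+ nz.1.+1].
  move=> [n z] /=; have [[d1 d2]|nd] := pselect (DY z /\ NY z <= r * 2^-1 ^+ n); last first.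
    by exists (0, 0) => d1 d2; exfalso; apply: nd.
  have e0 : 0 < r * 2^-1 ^+ n.+1 by rewrite mulr_gt0 ?exprn_gt0.
  by have [x [y' [h1 h2 h3]]] := H n z d1 d2 _ e0; exists (x, y').
pose z := fix z (n : nat) : Y := if n is n'.+1 then z n' - (f (n', z n')).2 else y.
have zP n : DY (z n) /\ NY (z n) <= r * 2^-1 ^+ n.
  elim: n => [|n [d p]]; first by rewrite expr0 mulr1.
  have [h1 h2 h3] := hf (n, z n) d p; split=> //=.
  by apply: DB => //; exact: GD h1.
have zH n := hf (n, z n) (zP n).1 (zP n).2.
pose x_ n := (f (n, z n)).1; pose y_ n := (f (n, z n)).2.
have sumy n : y - \sum_(i < n) y_ i = z n.
  elim: n => [|n IH]; first by rewrite big_ord0 subr0.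
  by rewrite big_ord_recr /= opprD addrA IH.
apply: (@Glim K x_ y_) => //.
- by move=> n; have [] := zH n.
- by move=> n; have [] := zH n.
- apply: (@cvg_dist0 _ _ (fun n => r * 2^-1 ^+ n)).
    by move=> n; rewrite sumy sub0r normrN ger0_norm//; case: (zP n).
  rewrite -[X in _ --> X](mulr0 r); apply: cvgM; first exact: cvg_cst.
  by apply: cvg_expr; rewrite ger0_norm; lra.
Qed.

End open_mapping.

(** * Finite linear algebra modulo a subspace of functions *)

Section linear_sets.
Context {R : realType}.
Local Notation C := R[i].
Implicit Types (f g : fn R) (V : fn R -> Prop).

Definition lin_closed V : Prop :=
  V (fcst 0) /\ forall k f g, V f -> V g -> V (fadd f (fscal k g)).

Lemma lin_add V f g : lin_closed V -> V f -> V g -> V (fadd f g).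
Proof.
move=> [_ H] Vf Vg; rewrite (_ : fadd f g = fadd f (fscal 1 g)); first exact: H.
by apply/funext => z; rewrite /fadd /fscal mul1r.
Qed.

Lemma lin_minus V f g : lin_closed V -> V f -> V g -> V (fminus f g).
Proof.
move=> [_ H] Vf Vg; rewrite (_ : fminus f g = fadd f (fscal (-1) g)); first exact: H.
by apply/funext => z; rewrite /fminus /fadd /fscal mulN1r.
Qed.

Lemma lin_scal V k f : lin_closed V -> V f -> V (fscal k f).
Proof.
move=> [H0 H] Vf; rewrite (_ : fscal k f = fadd (fcst 0) (fscal k f)); first exact: H.
by apply/funext => z; rewrite /fadd /fcst add0r.
Qed.

Lemma lincombS n (l : 'I_n.+1 -> C) (g : 'I_n.+1 -> fn R) :
  lincomb l g = fadd (lincomb (fun i => l (widen_ord (leqnSn n) i)) (fun i => g (widen_ord (leqnSn n) i)))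
    (fscal (l ord_max) (g ord_max)).
Proof. by apply/funext => z; rewrite /lincomb big_ord_recr. Qed.

Lemma lincomb0 (l : 'I_0 -> C) (g : 'I_0 -> fn R) : lincomb l g = fcst 0.
Proof. by apply/funext => z; rewrite /lincomb big_ord0. Qed.

Lemma lin_lincomb V n (l : 'I_n -> C) (g : 'I_n -> fn R) : lin_closed V ->
  (forall i, V (g i)) -> V (lincomb l g).
Proof.
move=> lV; elim: n l g => [|n IH] l g Vg; first by rewrite lincomb0; case: lV.
by rewrite lincombS; apply: lin_add => //; [exact: IH|exact: lin_scal].
Qed.

Lemma lincombDZ n k (l l' : 'I_n -> C) (g : 'I_n -> fn R) z :
  lincomb (fun i => l i + k * l' i) g z = lincomb l g z + k * lincomb l' g z.
Proof.
rewrite /lincomb mulr_sumr -big_split /=; apply: eq_bigr => i _.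
by rewrite mulrDl mulrA.
Qed.

Lemma lincomb_mx m n (v : 'I_m -> C) (M : 'M[C]_(m, n)) (g : 'I_n -> fn R) z :
  \sum_j v j * lincomb (M j) g z = \sum_i (\sum_j v j * M j i) * g i z.
Proof.
rewrite /lincomb; under eq_bigr do rewrite mulr_sumr.
rewrite exchange_big /=; apply: eq_bigr => i _; rewrite mulr_suml.
by apply: eq_bigr => j _; rewrite mulrA.
Qed.

Lemma lincomb_delta n (g : 'I_n -> fn R) i : lincomb (fun j => (j == i)%:R) g = g i.
Proof.
apply/funext => z; rewrite /lincomb (bigD1 i)//= eqxx mul1r big1 ?addr0// => j /negbTE->.
by rewrite mul0r.
Qed.

Lemma lin_unitmx V n (M : 'M[C]_n) (g : 'I_n -> fn R) : lin_closed V -> M \in unitmx ->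
  (forall i, V (lincomb (M i) g)) -> forall i, V (g i).
Proof.
move=> lV uM H i.
rewrite (_ : g i = lincomb (invmx M i) (fun j => lincomb (M j) g)); first exact: lin_lincomb.
apply/funext => z; rewrite {1}/lincomb lincomb_mx -{1}(lincomb_delta g i) /lincomb.
apply: eq_bigr => j _; congr (_ * _).
by have := congr1 (fun A : 'M[C]_n => A i j) (mulVmx uM); rewrite !mxE eq_sym => ->.
Qed.

Definition spanmod V n (h : 'I_n -> fn R) f : Prop := exists l, V (fminus f (lincomb l h)).

Lemma lin_spanmod V n (h : 'I_n -> fn R) : lin_closed V -> lin_closed (spanmod V h).
Proof.
move=> lV; split.
  exists (fun=> 0); rewrite (_ : fminus _ _ = fcst 0); first by case: lV.
  by apply/funext => z; rewrite /fminus /lincomb big1 ?subr0// => i _; rewrite mul0r.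
move=> k f g [l hl] [l' hl']; exists (fun i => l i + k * l' i).
rewrite (_ : fminus _ _ = fadd (fminus f (lincomb l h)) (fscal k (fminus g (lincomb l' h)))).
  by case: lV => _; apply.
by apply/funext => z; rewrite /fminus /fadd /fscal lincombDZ; ring.
Qed.

Lemma sub_spanmod V n (h : 'I_n -> fn R) f : V f -> spanmod V h f.
Proof.
move=> Vf; exists (fun=> 0); rewrite (_ : fminus _ _ = f)//.
by apply/funext => z; rewrite /fminus /lincomb big1 ?subr0// => i _; rewrite mul0r.
Qed.

Lemma gen_spanmod V n (h : 'I_n -> fn R) i : lin_closed V -> spanmod V h (h i).
Proof.
move=> [V0 _]; exists (fun j => (j == i)%:R); rewrite lincomb_delta (_ : fminus _ _ = fcst 0)//.
by apply/funext => z; rewrite /fminus subrr.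
Qed.

(** A row vector killed by [M] makes the terms in [e] cancel, so the corresponding combination of
    the [h j] lies in [V] and independence makes it trivial. *)
Lemma row_free_spanmod V m n (h : 'I_m -> fn R) (e : 'I_n -> fn R) (M : 'M[C]_(m, n)) :
  lin_closed V -> indep_mod h V -> (forall j, V (fminus (h j) (lincomb (M j) e))) -> row_free M.
Proof.
move=> lV ih H; apply/inj_row_free => v vM; apply/rowP => j; rewrite mxE.
apply: (ih (v 0)); exists (lincomb (v 0) (fun j => fminus (h j) (lincomb (M j) e))).
split; first exact: lin_lincomb.
rewrite (_ : lincomb _ h = lincomb (v 0) (fun j => fminus (h j) (lincomb (M j) e))).
  exact: aeeq_refl.
apply/funext => z; rewrite /lincomb; under [RHS]eq_bigr do rewrite /fminus mulrBr.
rewrite sumrB -[LHS]subr0; congr (_ - _); rewrite lincomb_mx big1// => i _.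
by have := congr1 (fun A : 'rV_n => A 0 i) vM; rewrite !mxE => ->; rewrite mul0r.
Qed.

Lemma spanmod_size V m n (h : 'I_m -> fn R) (e : 'I_n -> fn R) : lin_closed V -> indep_mod h V ->
  (forall j, spanmod V e (h j)) -> (m <= n)%N.
Proof.
move=> lV ih /choice[M hM].
have /eqP <- : row_free (\matrix_(j, i) M j i).
  apply: row_free_spanmod lV ih _ => j; rewrite (_ : _ j = M j)//.
  by apply/funext => i; rewrite mxE.
exact: rank_leq_col.
Qed.

(** Equal lengths make the row-free coefficient matrix square, hence invertible, and the relations
    can be solved for [e]. *)
Lemma spanmod_exchange V n (h e : 'I_n -> fn R) : lin_closed V -> indep_mod h V ->
  (forall j, spanmod V e (h j)) -> forall i, spanmod V h (e i).
Proof.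
move=> lV ih /choice[M hM]; pose A := (\matrix_(j, i) M j i).
have AM j : A j = M j by apply/funext => i; rewrite mxE.
have uA : A \in unitmx.
  rewrite -row_free_unit; apply: row_free_spanmod lV ih _ => j; rewrite AM; exact: hM.
apply: (lin_unitmx (lin_spanmod h lV) uA) => j; rewrite AM.
rewrite (_ : lincomb _ _ = fminus (h j) (fminus (h j) (lincomb (M j) e))).
  apply: lin_minus (lin_spanmod h lV) _ _; first exact: gen_spanmod.
  exact: sub_spanmod.
by apply/funext => z; rewrite /fminus opprB addrC subrK.
Qed.

(** If [v = v L], summing the moduli of the entries gives [S <= n e S], so [S = 0]. *)
Lemma small_unitmx n (L : 'M[C]_n) (e : R) : 0 <= e -> n%:R * e < 1 ->
  (forall i j, cmod (L i j) <= e) -> 1%:M - L \in unitmx.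
Proof.
move=> e0 ne H; rewrite -row_free_unit; apply/inj_row_free => v.
rewrite mulmxBr mulmx1 => /eqP; rewrite subr_eq0 => /eqP vL.
pose S := \sum_j cmod (v 0 j).
have S0 : 0 <= S by apply: sumr_ge0 => j _; exact: cmod_ge0.
have : S <= (n%:R * e) * S.
  rewrite {1}/S (eq_bigr (fun j => cmod (\sum_i v 0 i * L i j))); last first.
    by move=> j _; rewrite {1}vL mxE.
  apply: (@le_trans _ _ (\sum_(j < n) e * S)); last by rewrite sumr_const card_ord -[X in X <= _]mulr_natl mulrA.
  apply: ler_sum => j _; apply: le_trans (cmod_sum _ _) _; rewrite mulr_sumr.
  by apply: ler_sum => i _; rewrite cmodM mulrC ler_wpM2r ?cmod_ge0.
move=> h; have {}h : S = 0.
  by apply/eqP; rewrite eq_le S0 andbT -(@pmulr_rle0 _ (1 - n%:R * e)) ?subr_gt0// mulrBl mul1r subr_le0.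
apply/rowP => j; rewrite mxE; apply/eqP; rewrite -cmod_eq0.
by move/eqP: h; rewrite psumr_eq0 => [/allP/(_ j)|i _]; [rewrite mem_index_enum => /(_ isT)|exact: cmod_ge0].
Qed.

End linear_sets.

(** * [H^p] and Toeplitz operators in terms of coefficients *)

Section hardy.
Context {R : realType}.
Local Notation C := R[i].
Implicit Types (a f g : fn R) (p : R).

Lemma fminusE f g : fminus f g = fadd f (fscal (-1) g).
Proof. by apply/funext => z; rewrite /fminus /fadd /fscal mulN1r. Qed.

Lemma coefDZ p k f g n : 1 <= p -> LL p f -> LL p g ->
  coef (fadd f (fscal k g)) n = coef f n + k * coef g n.
Proof.
move=> p1 Lf Lg; have L1 h : LL p h -> LL 1 h by exact: Lp_Lp1.
by rewrite fcoefD ?fcoefZ//; [exact: L1..|apply: L1; exact: Lp_scal].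
Qed.

Lemma LL_coef_inj p f g : 1 <= p -> LL p f -> LL p g ->
  (forall n, coef f n = coef g n) -> aeeq f g.
Proof. by move=> p1 Lf Lg; apply: coef_inj; apply: Lp_Lp1 p1 _. Qed.

Lemma LL_measC p f : LL p f -> measC f.
Proof. by move=> /LpP[]. Qed.

Lemma coef_cst k n : coef (@fcst R k) n = k * (0 == n)%:R.
Proof.
rewrite (@coef_eq _ _ (fscal k (tpow 0))) ?fcoefZ ?coef_tpow//.
  by apply: TP_Lp => //; exact: TP_tpow.
by move=> th; rewrite /fscal /tpow expr0z mulr1.
Qed.

Lemma Hp_LL p f : Hp p f -> LL p f.
Proof. by move=> /HpE[]. Qed.

Lemma Hp_coef p f n : Hp p f -> n < 0 -> coef f n = 0.
Proof. by move=> /HpE[_]; apply. Qed.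

Lemma Hp_lin p : 1 <= p -> lin_closed (@Hp R p).
Proof.
move=> p1; have p0 : 0 <= p by exact: le_trans p1.
split.
  apply/HpE; split; first by apply: TP_Lp => //; exact: TP_cst.
  by move=> n _; rewrite coef_cst mul0r.
move=> k f g /HpE[Lf hf] /HpE[Lg hg]; apply/HpE; split.
  by apply: Lp_add => //; exact: Lp_scal.
by move=> n n0; rewrite (coefDZ _ _ p1)// hf// hg// mulr0 addr0.
Qed.

Lemma Hp_tpow p n : 1 <= p -> 0 <= n -> Hp p (@tpow R n).
Proof.
move=> p1 n0; apply/HpE; split.
  by apply: TP_Lp; [exact: le_trans p1|exact: TP_tpow].
by move=> k k0; rewrite coef_tpow; case: eqP => // e; move: k0; rewrite -e ltNge n0.
Qed.

Lemma Hp_shift p n f : 1 <= p -> 0 <= n -> Hp p f -> Hp p (fmul (tpow n) f).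
Proof.
move=> p1 n0 /HpE[Lf hf]; apply/HpE; split.
  by apply: Lp_mulinf => //; [exact: le_trans p1|exact: Linf_tpow].
by move=> k k0; rewrite coef_shift hf// ltrBlDr (lt_le_trans k0)// add0r.
Qed.

Lemma Proj_LL p f : 1 < p -> LL p f -> LL p (Proj f).
Proof. by move=> p1 Lf; have [K _ /(_ _ Lf)[]] := Proj_spec p1. Qed.

Lemma coef_Proj p f n : 1 < p -> LL p f -> coef (Proj f) n = if 0 <= n then coef f n else 0.
Proof. by move=> p1 Lf; have [K _ /(_ _ Lf)[_ ->]] := Proj_spec p1. Qed.

Lemma Proj_Hp p f : 1 < p -> LL p f -> Hp p (Proj f).
Proof.
move=> p1 Lf; apply/HpE; split; first exact: Proj_LL.
by move=> n; rewrite ltNge => /negbTE n0; rewrite (coef_Proj _ p1)// n0.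
Qed.

Lemma Toep_LL p a f : 1 <= p -> Linf a -> LL p f -> LL p (fmul a f).
Proof. by move=> p1; apply: Lp_mulinf; exact: le_trans p1. Qed.

Lemma Toep_Hp p a f : 1 < p -> Linf a -> LL p f -> Hp p (Toep a f).
Proof. by move=> p1 La Lf; apply: Proj_Hp => //; apply: Toep_LL => //; exact: ltW. Qed.

Lemma coef_Toep p a f n : 1 < p -> Linf a -> LL p f ->
  coef (Toep a f) n = if 0 <= n then coef (fmul a f) n else 0.
Proof. by move=> p1 La Lf; apply: (@coef_Proj p) => //; apply: Toep_LL => //; exact: ltW. Qed.

(** Both sides have vanishing negative coefficients, so the nonnegative ones decide. Most identities
    between Toeplitz images below are checked in this way. *)
Lemma Toep_eqP p a f g : 1 < p -> Linf a -> LL p f -> Hp p g ->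
  (forall n, 0 <= n -> coef (fmul a f) n = coef g n) -> aeeq (Toep a f) g.
Proof.
move=> p1 La Lf Hg H; apply: (@LL_coef_inj p); [exact: ltW|exact/Hp_LL/Toep_Hp|exact: Hp_LL|].
move=> n; rewrite (coef_Toep _ p1)//; case: (leP 0 n) => n0; first exact: H.
by rewrite (Hp_coef Hg).
Qed.

Lemma Toep_lin p a k f g : 1 < p -> Linf a -> LL p f -> LL p g ->
  aeeq (Toep a (fadd f (fscal k g))) (fadd (Toep a f) (fscal k (Toep a g))).
Proof.
move=> p1 La Lf Lg; have p1' := ltW p1; have p0 : 0 <= p by exact: le_trans p1'.
apply: (Toep_eqP p1 La); first by apply: Lp_add => //; exact: Lp_scal.
  by case: (Hp_lin p1') => _; apply; exact: Toep_Hp.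
move=> n n0; rewrite (coefDZ _ _ p1') ?(coef_Toep _ p1)// ?n0; [|exact/Hp_LL/Toep_Hp..].
rewrite -(coefDZ _ _ p1'); [|exact: Toep_LL..].
by apply: coef_eq => th; rewrite /fadd /fscal /fmul; ring.
Qed.

Lemma Toep_bound p a : 1 < p -> Linf a -> exists2 M, 0 <= M &
  forall f, LL p f -> nrm p (Toep a f) <= M * nrm p f.
Proof.
move=> p1 La; have [K K0 hK] := Proj_spec p1; have [M M0 hM] := nrm_mulinf (ltW p1) La.
exists (K * M); first exact: mulr_ge0.
move=> f Lf; have [_ _ h] := hK _ (Toep_LL (ltW p1) La Lf).
by rewrite -mulrA; apply: le_trans h _; rewrite ler_wpM2l// hM.
Qed.

End hardy.

(** * The open mapping theorem for operators from [L^p] onto [H^p] *)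

Section open_mapping_LL.
Context {R : realType}.
Local Notation C := R[i].
Local Notation psum f_ n := (fun z => \sum_(i < n) (f_ : nat -> fn R) i z).
Variables (p : R) (E : fn R -> fn R).
Hypothesis p1 : 1 < p.
Hypothesis EH : forall f, LL p f -> Hp p (E f).
Hypothesis Elin : forall k f g, LL p f -> LL p g ->
  aeeq (E (fadd f (fscal k g))) (fadd (E f) (fscal k (E g))).
Variable M : R.
Hypothesis M0 : 0 <= M.
Hypothesis Ebound : forall f, LL p f -> nrm p (E f) <= M * nrm p f.
Hypothesis Esurj : forall y, Hp p y -> exists f, LL p f /\ aeeq (E f) y.

Let p1' : 1 <= p. Proof. exact: ltW. Qed.
Let p0 : 0 < p. Proof. exact: lt_trans p1. Qed.
Let p0' : 0 <= p. Proof. exact: ltW. Qed.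

Lemma LL_complete (K : R) (f_ : nat -> fn R) : 0 <= K -> (forall n, LL p (f_ n)) ->
  (forall n, nrm p (f_ n) <= K * 2^-1 ^+ n) ->
  exists f, LL p f /\ nrm p (fminus f (psum f_ n)) @[n --> \oo] --> (0 : R).
Proof.
move=> K0 Lf nf; have k10 : 0 < K + 1 by rewrite ltr_wpDl.
pose k : C := (K + 1)%:C%C.
have k0 : k != 0 by rewrite -cmod_eq0 cmod_real gtr0_norm// gt_eqF.
have kk : cmod k = K + 1 by rewrite cmod_real gtr0_norm.
have [||f [L c]] := @LL_complete0 _ p (fun n => fscal k^-1 (f_ n)) p1'.
- by move=> n; exact: Lp_scal.
- move=> n; rewrite nrmZ// cmodV kk mulrC ler_pdivrMr//.
  apply: le_trans (nf n) _; rewrite mulrC ler_wpM2l ?exprn_ge0// lerDl//.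
exists (fscal k f); split; first exact: Lp_scal.
have -> : (fun n => nrm p (fminus (fscal k f) (psum f_ n))) =
    (fun n => (K + 1) * nrm p (fminus f (psum (fun n => fscal k^-1 (f_ n)) n))).
  apply/funext => n; rewrite -kk -nrmZ//; last first.
    by apply: Lp_minus => //; apply: (@LL_psum _ p (fun n => fscal k^-1 (f_ n))) => // i; exact: Lp_scal.
  apply: nrm_eq => th _; rewrite /fminus /fscal mulrBr; congr (_ - _).
  by rewrite mulr_sumr; apply: eq_bigr => i _; rewrite mulrA mulfV// mul1r.
by rewrite -[X in _ --> X](mulr0 (K + 1)); apply: cvgM => //; exact: cvg_cst.
Qed.

Lemma Hp_closed (f : fn R) : LL p f -> (forall e, 0 < e -> exists g, Hp p g /\ nrm p (fminus f g) <= e) ->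
  Hp p f.
Proof.
move=> Lf H; apply/HpE; split=> // n n0.
apply/eqP; rewrite -cmod_eq0 eq_le cmod_ge0 andbT.
apply: (@le_eps _ _ (pi^-1 * (2 * pi + 1))).
  by rewrite mulr_ge0 ?invr_ge0 ?pi_ge0// addr_ge0// mulr_ge0 ?pi_ge0.
move=> e e0; have [g [Hg ng]] := H e e0.
have -> : coef f n = coef (fminus f g) n.
  by rewrite fcoefB ?(Hp_coef Hg)// ?subr0//; apply: Lp_Lp1 p1' _ => //; exact: Hp_LL.
apply: le_trans (coef_nrm _ p1' (Lp_minus p0' Lf (Hp_LL Hg))) _.
rewrite ler_wpM2l// mulr_ge0 ?invr_ge0 ?pi_ge0// addr_ge0// mulr_ge0 ?pi_ge0//.
Qed.

Let G (f y : C -> C) : Prop := [/\ LL p f, Hp p y & aeeq (E f) y].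

Let HpB (f g : fn R) : Hp p f -> Hp p g -> Hp p (fminus f g).
Proof. exact: (lin_minus (Hp_lin p1')). Qed.

Let subE (f g : C -> C) : f - g = fminus f g.
Proof. by []. Qed.

Let sumE (f_ : nat -> C -> C) n : \sum_(i < n) f_ i = psum f_ n.
Proof. by apply/funext => z; rewrite fct_sumE. Qed.

Let EB (f g : fn R) : LL p f -> LL p g -> aeeq (E (fminus f g)) (fminus (E f) (E g)).
Proof. by move=> Lf Lg; rewrite !fminusE; exact: Elin. Qed.

Let E_psum (f_ : nat -> fn R) n : (forall i, LL p (f_ i)) ->
  aeeq (E (psum f_ n)) (psum (fun i => E (f_ i)) n).
Proof.
move=> Lf; elim: n => [|n IH].
  have -> : psum f_ 0 = fminus (f_ 0%N) (f_ 0%N).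
    by apply/funext => z; rewrite /fminus big_ord0 subrr.
  apply: aeeq_trans (EB _ _) _ => //.
  have -> : fminus (E (f_ 0%N)) (E (f_ 0%N)) = psum (fun i => E (f_ i)) 0.
    by apply/funext => z; rewrite /fminus big_ord0 subrr.
  exact: aeeq_refl.
have -> : psum f_ n.+1 = fadd (psum f_ n) (fscal 1 (f_ n)).
  by apply/funext => z; rewrite big_ord_recr /fadd /fscal mul1r.
apply: aeeq_trans (Elin _ _ _) _ => //; first exact: LL_psum.
apply/aeeqP; move/aeeqP: IH; apply: AEW => z _ e.
by rewrite /fadd /fscal mul1r big_ord_recr e.
Qed.

(** The relation is a.e. equality of [E f] and [y]. It is closed under the limits required by
    [open_mapping] because [E] is bounded, and [H^p] is complete because coefficients are continuous
    for the norm. *)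
Theorem open_mapping_LL : exists K r : R, [/\ 0 <= K, 0 < r & forall k y, Hp p y ->
  nrm p y <= r * 2^-1 ^+ k -> exists f, [/\ LL p f, aeeq (E f) y & nrm p f <= K * 2^-1 ^+ k]].
Proof.
have c2 : cmod (2^-1 : C) = 2^-1.
  by rewrite cmodV (_ : 2 = (2 : R)%:C%C :> C) ?cmod_real ?normr_nat// rmorph_nat.
have [K [r [K0 r0 H]]] : exists K r : R, [/\ 0 <= K, 0 < r & forall k y, Hp p y ->
    nrm p y <= r * 2^-1 ^+ k -> exists x, G x y /\ nrm p x <= K * 2^-1 ^+ k].
  apply: (@open_mapping R (C -> C) (C -> C) G (nrm p) (nrm p) (fscal 2^-1) (fscal 2^-1) (Hp p)).
  - by move=> x y [].
  - move=> x y x' y' [Lx Hy e] [Lx' Hy' e']; rewrite !subE; split; [exact: Lp_minus|exact: HpB|].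
    apply: aeeq_trans (EB Lx Lx') _; apply/aeeqP; move/aeeqP: e => e; move/aeeqP: e' => e'.
    by move: (AE_and e e'); apply: AEW => z _ [e1 e2]; rewrite /fminus e1 e2.
  - move=> x y [Lx Hy e]; split; [exact: Lp_scal|exact: lin_scal (Hp_lin p1') Hy|].
    (* [Elin] speaks of sums [f + k g]; homogeneity is extracted from it by writing [x / 2] as
       [x - x / 2]. *)
    have -> : fscal 2^-1 x = fminus x (fscal 2^-1 x) by apply/funext => z; rewrite /fminus /fscal; field.
    rewrite fminusE.
    have -> : fscal (-1) (fscal 2^-1 x) = fscal (- 2^-1) x by apply/funext => z; rewrite /fscal; ring.
    apply: aeeq_trans (Elin _ Lx Lx) _; apply/aeeqP; move/aeeqP: e; apply: AEW => z _ e.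
    by rewrite /fadd /fscal e; field.
  - by move=> x y x' y' [Lx _ _] [Lx' _ _]; exact: nrmB.
  - by move=> x y [Lx _ _]; rewrite nrmZ// c2 mulrC.
  - by case: (Hp_lin p1').
  - by move=> y y'; exact: HpB.
  - exact: nrm_cst0.
  - by move=> y y' Hy Hy'; apply: nrmB p1' _ _; exact: Hp_LL.
  - by move=> y Hy; rewrite nrmZ// ?c2 1?mulrC//; exact: Hp_LL.
  - by move=> y; exact: nrm_ge0.
  - by move=> y _; apply/funext => z; rewrite /fscal /=; rewrite -[(y + y) z]/(y z + y z); field.
  - by move=> y y' _ _; apply/funext => z; rewrite /fscal; rewrite -[(y - y') z]/(y z - y' z) mulrBr.
  - move=> d Hd nd; have Ld n := Hp_LL (Hd n).
    have [y [Ly cy]] := LL_complete0 p1' Ld nd.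
    exists y; split; last first.
      by apply: cvg_trans cy; apply: near_eq_cvg; apply: nearW => n; rewrite sumE.
    apply: Hp_closed => // e e0; have /cvgr0_norm_lt/(_ _ e0)[N _ hN] := cy.
    exists (psum d N); split; last by have := hN N (leqnn N); rewrite /= ger0_norm ?nrm_ge0//; exact: ltW.
    rewrite (_ : psum d N = lincomb (fun=> 1) (fun i : 'I_N => d i)).
      exact: lin_lincomb (Hp_lin p1') _.
    by apply/funext => z; rewrite /lincomb; apply: eq_bigr => i _; rewrite mul1r.
  - move=> K x_ y_ y K0 Gn nx Hy cy; have Lx n : LL p (x_ n) by case: (Gn n).
    have Hyn n : Hp p (y_ n) by case: (Gn n).
    have [x [L c]] := LL_complete K0 Lx nx.
    have Lps n : LL p (psum x_ n) by exact: LL_psum.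
    have Lpy n : LL p (psum y_ n) by apply: LL_psum => // i; exact: Hp_LL.
    exists x; split.
      split=> //; have Ly := Hp_LL Hy; have LE := Hp_LL (EH L).
      suff : aeeq (fminus (E x) y) (fcst 0).
        move=> /aeeqP h; apply/aeeqP; move: h; apply: AEW => z _; rewrite /fminus /fcst => /eqP.
        by rewrite subr_eq0 => /eqP.
      apply: (LL_sub_eq0 p1' (Lp_minus p0' LE Ly)).
      apply: (@le_eps _ _ (M + 1)); first by rewrite addr_ge0.
      move=> e e0; have /cvgr0_norm_lt/(_ _ e0)[N _ hN] := c.
      have /cvgr0_norm_lt/(_ _ e0)[N' _ hN'] := cy.
      pose m := maxn N N'.
      have := hN m (leq_maxl _ _); rewrite /= ger0_norm ?nrm_ge0// => h1.
      have := hN' m (leq_maxr _ _); rewrite /= ger0_norm ?nrm_ge0// sumE => h2.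
      have LB := Lp_minus p0' L (Lps m).
      have -> : nrm p (fminus (E x) y) = nrm p (fminus (E (fminus x (psum x_ m))) (fminus y (psum y_ m))).
        apply: nrm_aeeq; [exact: LL_measC (Lp_minus p0' LE Ly)| |].
          by apply: (@LL_measC _ p); apply: Lp_minus => //; [exact/Hp_LL/EH|exact: Lp_minus].
        have /aeeqP a1 := EB L (Lps m); have /aeeqP a2 := E_psum m Lx.
        have a3 n : AE (fun z => forall i : 'I_n, E (x_ i) z = y_ i z).
          elim: n => [|k IH]; first by apply: AE_all => z _ [].
          have /aeeqP a4 : aeeq (E (x_ k)) (y_ k) by case: (Gn k).
          move: (AE_and IH a4); apply: AEW => z _ [b1 b2] i.
          case: (ltnP i k) => ik; first exact: (b1 (Ordinal ik)).
          have -> : nat_of_ord i = k by apply/eqP; rewrite eqn_leq ik -ltnS ltn_ord.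
          by [].
        apply/aeeqP; move: (AE_and a1 (AE_and a2 (a3 m))); apply: AEW => z _ [b1 [b2 b3]].
        rewrite {2}/fminus [E (fminus x _) z]b1 /fminus b2; under eq_bigr do rewrite b3.
        by rewrite opprB addrA subrK.
      apply: le_trans (nrmB p1' (Hp_LL (EH LB)) (Lp_minus p0' Ly (Lpy m))) _.
      rewrite mulrDl mul1r lerD ?(ltW h2)//; apply: le_trans (Ebound LB) _.
      by rewrite ler_wpM2l// ltW.
    rewrite -subr_le0; apply: (@le_eps _ _ 1) => // e e0; rewrite mul1r.
    have /cvgr0_norm_lt/(_ _ e0)[N _ hN] := c.
    have := hN N (leqnn N); rewrite /= ger0_norm ?nrm_ge0// => h1.
    have -> : nrm p x = nrm p (fadd (fminus x (psum x_ N)) (psum x_ N)).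
      by apply: nrm_eq => th _; rewrite /fadd /fminus subrK.
    rewrite lerBlDr; apply: le_trans (nrm_add p1' (Lp_minus p0' L (Lps N)) (Lps N)) _.
    apply: lerD (ltW h1) _; apply: le_trans (nrm_psum _ p1' Lx) _.
    apply: (@le_trans _ _ (\sum_(i < N) K * 2^-1 ^+ i)); first by apply: ler_sum => i _.
    by rewrite -mulr_sumr mulrC ler_wpM2r// sum_half.
  - by move=> y Hy; have [f [Lf e]] := Esurj Hy; exists f.
by exists K, r; split=> // k y Hy ny; have [f [[Lf _ e] nf]] := H k y Hy ny; exists f.
Qed.

End open_mapping_LL.

(** * Ranges of finite codimension of Toeplitz operators *)

Section toeplitz_range.
Context {R : realType}.
Local Notation C := R[i].
Implicit Types (f g u v : fn R) (V : fn R -> Prop).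

(** As many elements as an independent family which they span modulo [V] are themselves independent:
    the change of coordinates [A] is invertible, so a relation among the [e i] becomes one among the
    [h j]. *)
Lemma indep_exchange V n (h e : 'I_n -> fn R) : lin_closed V ->
  (forall f g, aeeq f g -> V f -> V g) -> indep_mod h V ->
  (forall j, spanmod V e (h j)) -> indep_mod e V.
Proof.
move=> lV aV ih /choice[M hM] l [v [Vv lv]]; pose A : 'M[C]_n := (\matrix_(j, i) M j i).
have AM j : A j = M j by apply/funext => i; rewrite mxE.
have uA : A \in unitmx.
  by rewrite -row_free_unit; apply: row_free_spanmod lV ih _ => j; rewrite AM; exact: hM.
pose w : 'rV[C]_n := (\row_i l i) *m invmx A.
have wA : w *m A = \row_i l i by rewrite mulmxKV.
suff w0 : w = 0 by move=> i; move: wA; rewrite w0 mul0mx => /rowP/(_ i); rewrite !mxE.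
apply/rowP => j; rewrite [RHS]mxE; apply: (ih (w 0)).
exists (lincomb (w 0) h); split; last exact: aeeq_refl.
have Vl : V (lincomb l e) by apply: aV Vv; exact: aeeq_sym.
rewrite (_ : lincomb _ h = fadd (lincomb (w 0) (fun j => fminus (h j) (lincomb (M j) e))) (lincomb l e)).
  by apply: lin_add => //; exact: lin_lincomb.
apply/funext => z; rewrite /fadd /lincomb; under [X in _ = X + _]eq_bigr do rewrite /fminus mulrBr.
rewrite sumrB -[LHS]subr0 -[RHS]addrA; congr (_ + _); apply/eqP; rewrite oppr0 eq_sym addrC subr_eq0.
apply/eqP; transitivity (\sum_j w 0 j * lincomb (A j) e z).
  rewrite lincomb_mx; apply: eq_bigr => i _; congr (_ * _).
  by move/rowP/(_ i) : wA; rewrite !mxE => <-.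
by apply: eq_bigr => i _; rewrite AM.
Qed.

Variable p : R.
Hypothesis p1 : 1 < p.
Let p1' : 1 <= p. Proof. exact: ltW. Qed.
Let p0 : 0 < p. Proof. exact: lt_trans p1. Qed.
Let p0' : 0 <= p. Proof. exact: ltW. Qed.

Lemma LL_lin : lin_closed (@LL R p).
Proof.
split; first by apply: TP_Lp => //; exact: TP_cst.
by move=> k f g Lf Lg; apply: Lp_add => //; exact: Lp_scal.
Qed.

Lemma coef_lincomb n (l : 'I_n -> C) (g : 'I_n -> fn R) k : (forall i, LL p (g i)) ->
  coef (lincomb l g) k = \sum_i l i * coef (g i) k.
Proof.
elim: n l g => [|n IH] l g Lg; first by rewrite lincomb0 big_ord0 coef_cst mul0r.
rewrite lincombS (coefDZ _ _ p1') ?IH ?big_ord_recr//.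
exact: lin_lincomb LL_lin _.
Qed.

Lemma nrm_lincomb n (l : 'I_n -> C) (g : 'I_n -> fn R) : (forall i, LL p (g i)) ->
  nrm p (lincomb l g) <= \sum_i cmod (l i) * nrm p (g i).
Proof.
elim: n l g => [|n IH] l g Lg; first by rewrite lincomb0 big_ord0 nrm_cst0.
rewrite lincombS big_ord_recr /=; apply: le_trans (nrm_add p1' _ _) _.
- exact: lin_lincomb LL_lin _.
- exact: Lp_scal.
- by apply: lerD; [exact: IH|rewrite nrmZ].
Qed.

Lemma Proj_lin k f g : LL p f -> LL p g ->
  aeeq (Proj (fadd f (fscal k g))) (fadd (Proj f) (fscal k (Proj g))).
Proof.
move=> Lf Lg; have E h : Proj h = Toep (fcst 1) h.
  by rewrite /Toep; congr Proj; apply/funext => z; rewrite /fmul /fcst mul1r.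
by rewrite !E; apply: (Toep_lin _ p1) => //; apply: TP_Linf; exact: TP_cst.
Qed.

Lemma Toep_aeeq a f g : Linf a -> LL p f -> LL p g -> aeeq f g -> aeeq (Toep a f) (Toep a g).
Proof.
move=> La Lf Lg fg; apply: (Toep_eqP p1 La Lf); first exact: Toep_Hp.
move=> n n0; rewrite (coef_Toep _ p1)// n0; apply: coef_aeeq; [exact/LL_measC/(Toep_LL p1')..|].
by apply/aeeqP; move/aeeqP: fg; apply: AEW => z _ e; rewrite /fmul e.
Qed.

(** The bounded projection fixes [u] and sends its polynomial approximants to analytic ones. *)
Lemma Hp_PT_dense u (e : R) : Hp p u -> 0 < e -> exists s, nrm p (fminus u (PT s)) <= e.
Proof.
move=> Hu e0; have Lu := Hp_LL Hu; have [K K0 hK] := Proj_spec p1.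
have k0 : 0 < K + 1 by rewrite ltr_wpDl.
have [s hs] := TP_dense_nrm p0 Lu (divr_gt0 e0 k0); exists s.
have Lt t : LL p (@tpoly R t) by apply: TP_Lp => //; exact: TP_tpoly.
have Lus := Lp_minus p0' Lu (Lt s).
have -> : nrm p (fminus u (PT s)) = nrm p (Proj (fminus u (tpoly s))).
  have [LP cP _] := hK _ Lus; have LB := Lp_minus p0' Lu (Lt _ : LL p (PT s)).
  apply: nrm_aeeq; [exact: LL_measC LB|exact: LL_measC LP|].
  apply: (LL_coef_inj p1' LB LP) => n; rewrite cP.
  rewrite !fcoefB; [|by apply: Lp_Lp1 p1' _ => //; exact: Lt..]; rewrite coef_PT.
  by case: (leP 0 n) => n0; rewrite ?(Hp_coef Hu n0) ?subr0.
have [_ _ h] := hK _ Lus; apply: le_trans h _; apply: le_trans (ler_wpM2l K0 (ltW hs)) _.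
by rewrite mulrA ler_pdivrMr// mulrC ler_wpM2l ?(ltW e0)// lerDl.
Qed.

Variable c : fn R.
Hypothesis Lc : Linf c.

Definition ranT v : Prop := exists f, Hp p f /\ aeeq (Toep c f) v.

Lemma ranT_aeeq f g : aeeq f g -> ranT f -> ranT g.
Proof. by move=> fg [h [Hh e]]; exists h; split=> //; exact: aeeq_trans fg. Qed.

Lemma ranT_lin : lin_closed ranT.
Proof.
split.
  have H0 : Hp p (@fcst R 0) by case: (Hp_lin p1').
  exists (fcst 0); split=> //; apply: (Toep_eqP p1 Lc) => //; first exact: Hp_LL.
  by move=> n _; apply: coef_eq => th; rewrite /fmul /fcst mulr0.
move=> k f g [x [Hx ex]] [y [Hy ey]]; exists (fadd x (fscal k y)); split.
  by case: (Hp_lin p1') => _; apply.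
apply: aeeq_trans (Toep_lin _ p1 Lc (Hp_LL Hx) (Hp_LL Hy)) _.
apply/aeeqP; move/aeeqP: ex => ex; move/aeeqP: ey => ey; move: (AE_and ex ey).
by apply: AEW => z _ [e1 e2]; rewrite /fadd /fscal e1 e2.
Qed.

(* The open mapping theorem, for [f, l |-> T(c) f + lincomb l h] with [l] encoded in the
   negative Fourier coefficients of [F] and [f = P F], approximates each [h i] by a
   polynomial modulo the range up to [lincomb (L i) h], with [L] as small as desired;
   then [1 - L] is invertible. *)
Lemma spanmod_full m k (h : 'I_m -> fn R) (e : 'I_k -> fn R) :
  (forall j, Hp p (h j)) -> (forall u, Hp p u -> spanmod ranT h u) ->
  (forall n : nat, spanmod ranT e (tpow n)) -> forall u, Hp p u -> spanmod ranT e u.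
Proof.
move=> Hh sh se; have Lh j := Hp_LL (Hh j).
pose W := spanmod ranT e; have lW : lin_closed W by exact: lin_spanmod ranT_lin.
(* The negative frequencies that carry the coordinates [l j]; [Proj] does not see them. *)
pose idx (j : 'I_m) : int := -1 - (j : nat)%:Z.
pose E (F : fn R) := fadd (Toep c (Proj F)) (lincomb (fun j => coef F (idx j)) h).
have Llc l : LL p (lincomb l h) by exact: lin_lincomb LL_lin _.
have LT F : LL p F -> LL p (Toep c (Proj F)).
  by move=> LF; apply/Hp_LL/(Toep_Hp p1)/(Proj_LL p1).
have [K [r [K0 r0 H]]] : exists K r : R, [/\ 0 <= K, 0 < r & forall k y, Hp p y ->
    nrm p y <= r * 2^-1 ^+ k -> exists f, [/\ LL p f, aeeq (E f) y & nrm p f <= K * 2^-1 ^+ k]].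
  have [Mc Mc0 hMc] := Toep_bound p1 Lc; have [MP MP0 hMP] := Proj_spec p1.
  pose cc : R := pi^-1 * (2 * pi + 1).
  have cc0 : 0 <= cc by rewrite mulr_ge0 ?invr_ge0 ?pi_ge0// addr_ge0// mulr_ge0 ?pi_ge0.
  pose M := Mc * MP + \sum_j cc * nrm p (h j).
  apply: (@open_mapping_LL _ p E p1 _ _ M).
  - move=> f Lf; apply: lin_add (Hp_lin p1') _ _; first exact/(Toep_Hp p1)/(Proj_LL p1).
    exact: lin_lincomb (Hp_lin p1') _.
  - move=> l f g Lf Lg; have Pf := Proj_LL p1 Lf; have Pg := Proj_LL p1 Lg.
    have Pfg : LL p (Proj (fadd f (fscal l g))) by apply/(Proj_LL p1)/Lp_add => //; exact: Lp_scal.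
    have Lpfg : LL p (fadd (Proj f) (fscal l (Proj g))) by apply: Lp_add => //; exact: Lp_scal.
    have /aeeqP a1 := Toep_aeeq Lc Pfg Lpfg (Proj_lin l Lf Lg).
    have /aeeqP a2 := Toep_lin l p1 Lc Pf Pg.
    apply/aeeqP; move: (AE_and a1 a2); apply: AEW => z _ [e1 e2].
    rewrite /E {1}/fadd e1 e2 (_ : lincomb _ _ z = lincomb (fun j => coef f (idx j)) h z +
      l * lincomb (fun j => coef g (idx j)) h z).
      by rewrite /fadd /fscal mulrDr addrACA.
    by rewrite -lincombDZ /lincomb; apply: eq_bigr => j _; rewrite (coefDZ _ _ p1').
  - by rewrite addr_ge0 ?mulr_ge0// sumr_ge0// => j _; rewrite mulr_ge0 ?nrm_ge0.
  - move=> f Lf; rewrite /E; apply: le_trans (nrm_add p1' (LT _ Lf) (Llc _)) _.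
    rewrite /M mulrDl; apply: lerD.
      apply: le_trans (hMc _ (Proj_LL p1 Lf)) _; rewrite -mulrA ler_wpM2l//.
      by have [_ _] := hMP _ Lf.
    apply: le_trans (nrm_lincomb _ Lh) _; rewrite mulr_suml; apply: ler_sum => j _.
    by rewrite mulrAC ler_wpM2r ?nrm_ge0//; exact: coef_nrm.
  - move=> y Hy; have [l [f [Hf e1]]] := sh y Hy; have Lf := Hp_LL Hf.
    (* For [y = T(c) f + lincomb l h] the preimage under [E] is [f + q]: the projection returns [f],
       and the coefficients at [idx j] return [l]. *)
    pose q := lincomb l (fun j => tpow (idx j)).
    have Lt j : LL p (@tpow R (idx j)) by apply: TP_Lp => //; exact: TP_tpow.
    have Lq : LL p q by exact: lin_lincomb LL_lin _.
    have Lfq := Lp_add p0' Lf Lq.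
    have idx0 j : (0 <= idx j) = false by rewrite /idx; apply/negbTE; lia.
    exists (fadd f q); split=> //.
    have PF : aeeq (Proj (fadd f q)) f.
      apply: (LL_coef_inj p1' (Proj_LL p1 Lfq) Lf) => n; rewrite (coef_Proj _ p1)//.
      rewrite fcoefD; [|by apply: Lp_Lp1 p1' _..].
      case: (leP 0 n) => n0; last by rewrite (Hp_coef Hf).
      rewrite coef_lincomb// big1 ?addr0// => j _; rewrite coef_tpow.
      by case: eqP => [ee|]; rewrite ?mulr0//; move: (idx0 j); rewrite ee n0.
    have /aeeqP a1 := Toep_aeeq Lc (Proj_LL p1 Lfq) Lf PF; move/aeeqP: e1 => e1.
    apply/aeeqP; move: (AE_and a1 e1); apply: AEW => z _ [b1 b2].
    rewrite /E {1}/fadd b1 b2 /fminus (_ : lincomb _ h z = lincomb l h z) ?subrK//.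
    rewrite /lincomb; apply: eq_bigr => j _; congr (_ * _).
    rewrite fcoefD; [|by apply: Lp_Lp1 p1' _..]; rewrite (Hp_coef Hf) ?add0r ?ltNge ?idx0//.
    rewrite coef_lincomb// (bigD1 j)//= coef_tpow eqxx mulr1 big1 ?addr0// => i ij.
    rewrite coef_tpow; case: eqP => [ee|]; rewrite ?mulr0//.
    case/eqP: ij; apply/val_inj => /=; move: ee; rewrite /idx; lia.
have WPT s : W (PT s).
  rewrite /PT; elim: s => [|x s IH].
    rewrite (_ : tpoly _ = fcst 0); first by case: lW.
    by apply/funext => z; rewrite /tpoly big_nil.
  rewrite /=; case: ifP => // x0.
  rewrite (_ : tpoly _ = fadd (fscal x.1 (tpow x.2)) (tpoly [seq x <- s | 0 <= x.2])).
    apply: (lin_add lW _ IH); apply: (lin_scal _ lW).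
    by have -> : x.2 = (`|x.2|%N)%:Z; [rewrite gez0_abs|exact: se].
  by apply/funext => z; rewrite /tpoly big_cons.
have Wh j : W (h j).
  pose cc : R := pi^-1 * (2 * pi + 1).
  have cc0 : 0 <= cc by rewrite mulr_ge0 ?invr_ge0 ?pi_ge0// addr_ge0// mulr_ge0 ?pi_ge0.
  (* Chosen so that [m * eps < 1], as [small_unitmx] requires; [N] below is taken so large that the
     coefficients of a solution at scale [2^-N] are at most [eps]. *)
  pose eps : R := (m%:R + 1)^-1.
  have m10 : 0 < m%:R + 1 :> R by rewrite ltr_wpDl.
  have eps0 : 0 < eps by rewrite invr_gt0.
  have [N hN] : exists N : nat, cc * (K * 2^-1 ^+ N) <= eps.
    have : cc * (K * 2^-1 ^+ n) @[n --> \oo] --> (0 : R).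
      rewrite -[X in _ --> X](mulr0 cc) -[X in _ * X](mulr0 K).
      apply: cvgM; first exact: cvg_cst.
      apply: cvgM; first exact: cvg_cst.
      by apply: cvg_expr; rewrite ger0_norm; lra.
    move=> /cvgr0_norm_lt/(_ _ eps0)[N _ /(_ N (leqnn N))/= hN]; exists N.
    by apply: le_trans (ler_norm _) _; exact: ltW.
  have d0 : 0 < r * 2^-1 ^+ N by rewrite mulr_gt0// exprn_gt0.
  have /choice[L hL] i : exists l : 'I_m -> C, (forall j, cmod (l j) <= eps) /\ W (fminus (h i) (lincomb l h)).
    have [s hs] := Hp_PT_dense (Hh i) d0.
    have HB : Hp p (fminus (h i) (PT s)).
      apply: lin_minus (Hp_lin p1') (Hh i) _; apply/HpE; split.
        by apply: TP_Lp => //; exact: TP_tpoly.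
      by move=> n; rewrite ltNge coef_PT => /negbTE->.
    have [f [Lf ef nf]] := H N _ HB hs.
    exists (fun j => coef f (idx j)); split.
      move=> j'; apply: le_trans (coef_nrm _ p1' Lf) _; apply: le_trans hN.
      by rewrite ler_wpM2l.
    rewrite (_ : fminus _ _ = fadd (PT s) (fminus (fminus (h i) (PT s)) (lincomb (fun j => coef f (idx j)) h))).
      apply: lin_add lW (WPT s) _; apply: sub_spanmod.
      exists (Proj f); split; first exact: Proj_Hp.
      apply/aeeqP; move/aeeqP: ef; apply: AEW => z _ e1.
      by rewrite {1}/fminus -e1 /E /fadd addrK.
    by apply/funext => z; rewrite /fadd /fminus; ring.
  pose A : 'M[C]_m := \matrix_(i, j) L i j.
  have AL i : A i = L i by apply/funext => i'; rewrite mxE.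
  have uA : 1%:M - A \in unitmx.
    apply: (@small_unitmx _ _ _ eps); first exact: ltW.
      by rewrite ltr_pdivrMr// mul1r ltrDl.
    by move=> i i'; rewrite mxE; case: (hL i).
  apply: (lin_unitmx lW uA) => i.
  rewrite (_ : lincomb _ h = fminus (h i) (lincomb (L i) h)); first by case: (hL i).
  rewrite -{1}(lincomb_delta h i); apply/funext => z; rewrite /fminus /lincomb -sumrB.
  by apply: eq_bigr => i' _; rewrite !mxE mulrBl eq_sym.
move=> u Hu; have [l hl] := sh u Hu.
rewrite (_ : u = fadd (fminus u (lincomb l h)) (lincomb l h)).
  by apply: (lin_add lW); [exact: sub_spanmod|exact: lin_lincomb lW _].
by apply/funext => z; rewrite /fadd /fminus subrK.
Qed.

End toeplitz_range.

(** * Invertibility of [T(c t^-2)] when [T(c)] has index -2 *)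

Section shifted_toeplitz.
Context {R : realType}.
Local Notation C := R[i].
Implicit Types (f g u v : fn R).
Variables (p : R) (c : fn R).
Hypothesis p1 : 1 < p.
Hypothesis Lc : Linf c.
Hypothesis c0 : AE (fun z => c z != 0).

Let p1' : 1 <= p. Proof. exact: ltW. Qed.
Let p0 : 0 < p. Proof. exact: lt_trans p1. Qed.
Let p0' : 0 <= p. Proof. exact: ltW. Qed.
Local Notation c2 := (fmul c (tpow (-2))).
Local Notation V := (ranT p c).
Let e (i : 'I_2) : fn R := tpow (i : nat)%:Z.

Let Lc2 : Linf c2. Proof. by apply: Linf_mul => //; exact: Linf_tpow. Qed.

Let coef_c2 f n : coef (fmul c2 f) n = coef (fmul c f) (n + 2).
Proof.
rewrite (@coef_eq _ _ (fmul (tpow (-2)) (fmul c f))) ?coef_shift ?opprK//.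
by move=> th; rewrite /fmul; ring.
Qed.

Let Ltp n : LL p (@tpow R n). Proof. by apply: TP_Lp => //; exact: TP_tpow. Qed.

Lemma coef_lincomb_tpow D (l : 'I_D -> C) (n : nat) :
  coef (lincomb l (fun i : 'I_D => tpow (i : nat)%:Z)) n%:Z = if insub n is Some i then l i else 0.
Proof.
rewrite (coef_lincomb p1)//; case: insubP => [i nD ni|nD].
  rewrite (bigD1 i)//= coef_tpow ni eqxx mulr1 big1 ?addr0// => j ji.
  rewrite coef_tpow eqz_nat -ni; case: eqP => [E|]; rewrite ?mulr0//.
  by case/eqP: ji; exact/val_inj.
rewrite big1// => i _; rewrite coef_tpow eqz_nat; case: eqP => [E|]; rewrite ?mulr0//.
by move: nD; rewrite -E ltn_ord.
Qed.

(** [c t^-2 f0] is antianalytic, and it is nonzero since [c] has no zeros up to a null set. Let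
    [-1 - j] be its highest index with nonzero coefficient. Multiplying [f0] by powers of [t] gives
    images under [T(c)] that are polynomials of every degree from 2 on, and these eliminate the
    powers of [t] one after the other. *)
Lemma ker_shift_polys f0 : Hp p f0 -> ~ aeeq f0 (fcst 0) ->
  (forall n, 0 <= n -> coef (fmul c2 f0) n = 0) -> forall D : nat, spanmod V e (tpow D%:Z).
Proof.
move=> H0 nz K0; have L0 := Hp_LL H0; pose fm := fmul c2 f0.
have Lfm : LL p fm by exact: Toep_LL.
have exj : exists j : nat, coef fm (-1 - j%:Z) != 0.
  apply: contrapT => /forallNP H; apply: nz.
  have : aeeq fm (fcst 0).
    apply: (LL_coef_inj p1' Lfm); first by apply: TP_Lp => //; exact: TP_cst.
    move=> n; rewrite coef_cst mul0r; case: (leP 0 n) => n0; first exact: K0.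
    have -> : n = -1 - (`|n|.-1)%:Z by lia.
    by apply/eqP; rewrite -[_ == _]negbK; apply/negP; exact: H.
  move=> /aeeqP h; apply/aeeqP; move: (AE_and h c0); apply: AEW => z z0 [].
  rewrite /fm /fmul /fcst /tpow => /eqP; rewrite !mulf_eq0 => /orP[/orP[/eqP->|]|/eqP//].
    by rewrite eqxx.
  by rewrite expfz_eq0 (negbTE z0) andbF.
have [j cj minj] : exists2 j : nat, coef fm (-1 - j%:Z) != 0 &
    forall n : int, -1 - j%:Z < n -> coef fm n = 0.
  case: (ex_minnP exj) => j cj mj; exists j => // n jn.
  case: (leP 0 n) => n0; first exact: K0.
  have nE : n = -1 - (`|n|.-1)%:Z by lia.
  rewrite nE; apply/eqP; rewrite -[_ == _]negbK; apply/negP => /mj; lia.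
have lV := ranT_lin p1 Lc; have lW := lin_spanmod e lV.
elim/ltn_ind => D IH.
have [D2|D2] := ltnP D 2; first exact: (gen_spanmod e (Ordinal D2) lV).
(* [c F] is [t^(k + 2)] times [c t^-2 f0], so its top index is [(k + 2) - 1 - j], which equals [D]
   for this [k]. *)
pose k := (D - 1 + j)%N; pose F := fmul (tpow k%:Z) f0.
have HF : Hp p F by exact: Hp_shift.
pose l (i : 'I_D.+1) := coef fm ((i : nat)%:Z - (k%:Z + 2)).
have VL : V (lincomb l (fun i : 'I_D.+1 => tpow (i : nat)%:Z)).
  exists F; split=> //; apply: (Toep_eqP p1 Lc (Hp_LL HF)).
    by apply: lin_lincomb (Hp_lin p1') _ => i; exact: Hp_tpow.
  case=> // n _; rewrite coef_lincomb_tpow.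
  have -> : coef (fmul c F) n%:Z = coef fm (n%:Z - (k%:Z + 2)).
    rewrite -coef_shift; apply: coef_eq => th; rewrite /F /fm /fmul /tpow.
    have ce := circ_neq0 th; rewrite expfzDr// -exprz_inv -!exprnP; field.
    by rewrite ce.
  case: insubP => [i _ <-//|]; rewrite -leqNgt => nD; apply: minj; rewrite /k; lia.
rewrite (_ : tpow D%:Z = fscal (l ord_max)^-1 (fminus (lincomb l (fun i : 'I_D.+1 => tpow (i : nat)%:Z))
   (lincomb (fun i => l (widen_ord (leqnSn D) i)) (fun i : 'I_D => tpow (i : nat)%:Z)))).
  apply: (lin_scal _ lW); apply: (lin_minus lW); first exact: sub_spanmod.
  by apply: lin_lincomb lW _ => i; apply: IH; exact: ltn_ord.
apply/funext => z; rewrite lincombS /fscal /fminus /fadd addrAC subrr add0r mulrA mulVf ?mul1r//.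
rewrite /l /= (_ : _ - _ = -1 - j%:Z)// /k; lia.
Qed.

Lemma Toep_shift_invertible : Fredholm_index p (Toep c) (-2) -> invertible_on p (Toep c2).
Proof.
move=> [_ [n [m [g [h [kg [ig [sg [Hh [ih [sh nm]]]]]]]]]]].
have lV := ranT_lin p1 Lc; have lW := lin_spanmod e lV.
have {}sh u : Hp p u -> spanmod V h u.
  move=> Hu; have [f [l [Hf E]]] := sh u Hu; exists l, f; split=> //.
  apply/aeeqP; move/aeeqP: E; apply: AEW => z _ E; by rewrite /fminus E /fadd addrK.
have He i : Hp p (e i) by exact: Hp_tpow.
have aV f1 f2 : aeeq f1 f2 -> V f1 -> V f2 by exact: ranT_aeeq.
(* The coefficients of [T(c t^-2) f] are those of [T(c) f] from index 2 on, and elements of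
   [span(1, t)] have none there. *)
have kerV f l : Hp p f -> aeeq (Toep c f) (lincomb l e) -> forall k : int, 0 <= k -> coef (fmul c2 f) k = 0.
  move=> Hf E [k|//] _; rewrite coef_c2 -[LHS](_ : coef (Toep c f) (k + 2)%N%:Z = _); last first.
    by rewrite (coef_Toep _ p1)//; exact: Hp_LL.
  rewrite (coef_aeeq _ _ _ E); [|exact: LL_measC (Hp_LL (Toep_Hp p1 Lc (Hp_LL Hf)))|].
    by rewrite coef_lincomb_tpow insubN// -leqNgt addn2.
  by apply/LL_measC/Hp_LL/(lin_lincomb _ (Hp_lin p1')).
have full u : Hp p u -> spanmod V e u.
  have [kz|] := pselect (forall f, Hp p f -> (forall k : int, 0 <= k -> coef (fmul c2 f) k = 0) -> aeeq f (fcst 0)); last first.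
    move=> /existsNP[f0 /not_implyP[H0 /not_implyP[K0 nz]]].
    exact: (spanmod_full p1 Lc Hh sh (ker_shift_polys H0 nz K0)).
  (* The case of trivial kernel: a kernel element of [T(c)] is also one of [T(c t^-2)], so [T(c)] is
     injective and the index gives [m = 2]. Moreover no nonzero element of [span(1, t)] is in the
     range, whence two independent vectors in a quotient of dimension 2. *)
  have n0 : n = 0%N.
    case: n g kg ig sg nm => // n g kg ig _ _; exfalso.
    have [H0 E0] := kg ord0.
    have := ig (fun i => (i == ord0)%:R); rewrite lincomb_delta => /(_ _ ord0).
    rewrite eqxx => h01; suff /h01/eqP : exists v, aeeq v (fcst 0) /\ aeeq (g ord0) v by rewrite oner_eq0.
    exists (fcst 0); split; first exact: aeeq_refl.
    apply: kz => // k k0; apply: (kerV (g ord0) (fun=> 0)) => //.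
    rewrite (_ : lincomb _ _ = fcst 0)//.
    by apply/funext => z; rewrite /lincomb big1// => i _; rewrite mul0r.
  have m2 : m = 2%N by move: nm; rewrite n0; lia.
  subst m; have ie : indep_mod e V.
    move=> l [v [[f [Hf E]] lv]].
    have fl : aeeq (Toep c f) (lincomb l e) by apply: aeeq_trans E _; exact: aeeq_sym.
    have f0 := kz f Hf (kerV _ _ Hf fl).
    move=> i; have := @coef_lincomb_tpow 2 l i; rewrite valK => <-.
    rewrite -(coef_aeeq _ _ _ fl); [|exact: LL_measC (Hp_LL (Toep_Hp p1 Lc (Hp_LL Hf)))|]; last first.
      by apply/LL_measC/Hp_LL/(lin_lincomb _ (Hp_lin p1')).
    rewrite (coef_Toep _ p1)//; last exact: Hp_LL.
    rewrite (@coef_aeeq _ _ (fcst 0)) ?coef_cst ?mul0r//; first exact/LL_measC/(Toep_LL p1')/Hp_LL.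
      exact: measC_cst.
    by apply/aeeqP; move/aeeqP: f0; apply: AEW => z _ E0; rewrite /fmul E0 /fcst mulr0.
  have sV := spanmod_exchange lV ie (fun j => sh _ (He j)).
  move=> Hu; have [l hl] := sh u Hu.
  rewrite (_ : u = fadd (fminus u (lincomb l h)) (lincomb l h)).
    by apply: (lin_add lW); [exact: sub_spanmod|exact: lin_lincomb lW _].
  by apply/funext => z; rewrite /fadd /fminus subrK.
(* Since [1, t] span modulo the range, [m <= 2]; with [n - m = -2] this forces [n = 0] and [m = 2],
   and [1, t] are independent modulo the range. *)
have m2 : (m <= 2)%N by exact: (spanmod_size lV ih (fun j => full _ (Hh j))).
have n0 : n = 0%N by move: nm m2; lia.
have {}m2 : m = 2%N by move: nm; rewrite n0; lia.
subst n m.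
have ie : indep_mod e V := indep_exchange lV aV ih (fun j => full _ (Hh j)).
split; first by move=> f Hf; apply: (Toep_Hp p1 Lc2); exact: Hp_LL.
split.
  (* Solving [t^2 u = T(c) f] modulo [span(1, t)] and reading off the indices from 2 on gives
     [T(c t^-2) f = u]. *)
  move=> u Hu; have [l [f [Hf E]]] := full _ (Hp_shift p1' (isT : 0 <= 2%:Z) Hu).
  exists f; split=> //; apply: (Toep_eqP p1 Lc2 (Hp_LL Hf) Hu) => -[k|//] _.
  rewrite coef_c2 -[LHS](_ : coef (Toep c f) (k + 2)%N%:Z = _); last first.
    by rewrite (coef_Toep _ p1)//; exact: Hp_LL.
  have Llc : LL p (lincomb l e) by apply/Hp_LL/(lin_lincomb _ (Hp_lin p1')).
  have Ls : LL p (fmul (tpow 2) u) by exact/Hp_LL/Hp_shift.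
  rewrite (coef_aeeq _ _ _ E); [|exact: LL_measC (Hp_LL (Toep_Hp p1 Lc (Hp_LL Hf)))|].
    rewrite fcoefB; [|by apply: Lp_Lp1 p1' _..].
    by rewrite coef_lincomb_tpow insubN -?leqNgt ?addn2// subr0 coef_shift; congr coef; lia.
  by apply: (@LL_measC _ p); exact: Lp_minus.
move=> f1 f2 H1 H2 /aeeqP E; have L1 := Hp_LL H1; have L2 := Hp_LL H2.
pose f := fminus f1 f2; have Hf : Hp p f by exact: lin_minus (Hp_lin p1') _ _.
have Lf := Hp_LL Hf.
have k0 (k : nat) : coef (fmul c2 f) k%:Z = 0.
  rewrite -[LHS](_ : coef (Toep c2 f) k%:Z = _); last by rewrite (coef_Toep _ p1).
  rewrite (@coef_aeeq _ _ (fcst 0)) ?coef_cst ?mul0r//; [exact: LL_measC (Hp_LL (Toep_Hp p1 Lc2 Lf))|exact: measC_cst|].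
  have /aeeqP := Toep_lin (-1) p1 Lc2 L1 L2; rewrite -fminusE => E'.
  apply/aeeqP; move: (AE_and E E'); apply: AEW => z _ [e1 e2].
  by rewrite e2 /fadd /fscal e1 mulN1r subrr.
(* If [T(c t^-2) f = 0], only the coefficients 0 and 1 of [T(c) f] can survive. Independence of
   [1, t] modulo the range kills them, and [T(c)] is injective because [n = 0]. *)
have TE : aeeq (Toep c f) (lincomb (fun i : 'I_2 => coef (fmul c f) (i : nat)%:Z) e).
  apply: (Toep_eqP p1 Lc Lf); first exact: lin_lincomb (Hp_lin p1') _.
  case=> // k _; rewrite coef_lincomb_tpow; case: insubP => [i _ <-//|]; rewrite -leqNgt => k2.
  by have := k0 (k - 2)%N; rewrite coef_c2 => <-; congr coef; lia.
have l0 : forall i : 'I_2, coef (fmul c f) (i : nat)%:Z = 0.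
  apply: ie; exists (Toep c f); split; last exact: aeeq_sym.
  by exists f; split=> //; exact: aeeq_refl.
have [|l El] := sg f Hf.
  apply: aeeq_trans TE _; rewrite (_ : lincomb _ _ = fcst 0); first exact: aeeq_refl.
  by apply/funext => z; rewrite /lincomb big1// => i _; rewrite l0 mul0r.
move: El; rewrite lincomb0 => /aeeqP El; apply/aeeqP; move: El; apply: AEW => z _ /eqP.
by rewrite subr_eq0 => /eqP.
Qed.

End shifted_toeplitz.

(** * Hankel operators, antianalytic functions and formal inverses *)

Section hankel.
Context {R : realType}.
Local Notation C := R[i].
Implicit Types (a b f g h u v : fn R).

Lemma tpow1E (z : C) : tpow 1 z = z.
Proof. by rewrite /tpow expr1z. Qed.

Lemma tpow2E (z : C) : tpow 2 z = z * z.
Proof. by rewrite /tpow -exprnP expr2. Qed.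

Lemma tpowN1E (z : C) : tpow (-1) z = z^-1.
Proof. by rewrite /tpow exprN1. Qed.

Lemma tpowN2E (z : C) : tpow (-2) z = z^-1 * z^-1.
Proof. by rewrite /tpow -exprnN expr2 invfM. Qed.

Variable p : R.
Hypothesis p1 : 1 < p.
Let p1' : 1 <= p. Proof. exact: ltW. Qed.
Let p0 : 0 < p. Proof. exact: lt_trans p1. Qed.
Let p0' : 0 <= p. Proof. exact: ltW. Qed.

(** The range of [Q] on [L^p]. [Jop] exchanges it with [H^p], because it sends index [n] to
    [-1 - n]; hence [Q J = J] on [H^p]. *)
Definition antianalytic h : Prop := LL p h /\ forall n, 0 <= n -> coef h n = 0.

Lemma J_antianalytic f : Hp p f -> antianalytic (Jop f).
Proof.
move=> Hf; have Lf := Hp_LL Hf; split; first exact: Lp_J.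
by move=> n n0; rewrite coef_J ?(Hp_coef Hf)//; [lia|exact: Lp_Lp1 Lf].
Qed.

Lemma antianalytic_J h : antianalytic h -> Hp p (Jop h).
Proof.
move=> [Lh hh]; apply/HpE; split; first exact: Lp_J.
by move=> n n0; rewrite coef_J ?hh//; [lia|exact: Lp_Lp1 Lh].
Qed.

Lemma Toep_antianalytic a f g : Linf a -> LL p f -> Hp p g ->
  aeeq (Toep a f) g -> antianalytic (fminus (fmul a f) g).
Proof.
move=> La Lf Hg E; have Lg := Hp_LL Hg; have Laf := Toep_LL p1' La Lf.
split; first exact: Lp_minus.
move=> n n0; rewrite fcoefB; [|by apply: Lp_Lp1 p1' _..].
rewrite -(coef_aeeq _ _ _ E); [|exact: LL_measC (Hp_LL (Toep_Hp p1 La Lf))|exact: LL_measC Lg].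
by rewrite (coef_Toep _ p1)// n0 subrr.
Qed.

Lemma Proj_antianalytic h : antianalytic h -> aeeq (Proj h) (fcst 0).
Proof.
move=> [Lh hh]; apply: (LL_coef_inj p1' (Proj_LL p1 Lh)); first by apply: TP_Lp => //; exact: TP_cst.
by move=> n; rewrite (coef_Proj _ p1)// coef_cst mul0r; case: ifP => // /hh.
Qed.

Lemma QJ_aeeq f : Hp p f -> aeeq (Qproj (Jop f)) (Jop f).
Proof.
move=> Hf; have /aeeqP E := Proj_antianalytic (J_antianalytic Hf).
by apply/aeeqP; move: E; apply: AEW => z _ E; rewrite /Qproj /fminus E /fcst subr0.
Qed.

Lemma Hank_LL a f : Linf a -> Hp p f -> LL p (fmul a (Qproj (Jop f))).
Proof.
move=> La Hf; apply: Toep_LL => //; have LJ := Lp_J p0' (Hp_LL Hf).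
by apply: Lp_minus => //; exact: Proj_LL.
Qed.

Lemma Hank_Hp a f : Linf a -> Hp p f -> Hp p (Hank a f).
Proof. by move=> La Hf; apply: (Proj_Hp p1); exact: Hank_LL. Qed.

Lemma coef_Hank a f n : Linf a -> Hp p f ->
  coef (Hank a f) n = if 0 <= n then coef (fmul a (Jop f)) n else 0.
Proof.
move=> La Hf; rewrite /Hank (coef_Proj _ p1 (Hank_LL La Hf)); case: ifP => // _.
apply: coef_aeeq; [exact/LL_measC/Hank_LL|exact/LL_measC/(Toep_LL p1' La)/Lp_J/Hp_LL|].
by apply/aeeqP; have /aeeqP := QJ_aeeq Hf; apply: AEW => z _ E; rewrite /fmul E.
Qed.

Lemma TH_Hp a b f : Linf a -> Linf b -> Hp p f -> Hp p (fadd (Toep a f) (Hank b f)).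
Proof.
move=> La Lb Hf; apply: (lin_add (Hp_lin p1')); last exact: Hank_Hp.
exact/(Toep_Hp p1)/Hp_LL.
Qed.

(** Applying [P] to a pointwise equation [a f + b J f = g + h] removes [h]. Solving with
    [T(a) + H(b)] is thereby reduced to pointwise algebra. *)
Lemma TH_eqP a b f g h : Linf a -> Linf b -> Hp p f -> Hp p g -> antianalytic h ->
  aeeq (fadd (fmul a f) (fmul b (Jop f))) (fadd g h) ->
  aeeq (fadd (Toep a f) (Hank b f)) g.
Proof.
move=> La Lb Hf Hg [Lh hh] E; have Lf := Hp_LL Hf; have Lg := Hp_LL Hg.
have Laf := Toep_LL p1' La Lf; have LbJ := Toep_LL p1' Lb (Lp_J p0' Lf).
have HT := Toep_Hp p1 La Lf; have HH := Hank_Hp Lb Hf.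
apply: (LL_coef_inj p1' (Hp_LL (TH_Hp La Lb Hf)) Lg) => n.
case: (leP 0 n) => n0; last by rewrite (Hp_coef (TH_Hp La Lb Hf))// (Hp_coef Hg).
rewrite fcoefD; [|by apply: Lp_Lp1 p1' _; exact: Hp_LL..].
rewrite (coef_Toep _ p1)// coef_Hank// n0 -fcoefD; [|by apply: Lp_Lp1 p1' _..].
rewrite (coef_aeeq _ _ _ E); [|exact: LL_measC (Lp_add p0' Laf LbJ)|exact: LL_measC (Lp_add p0' Lg Lh)].
by rewrite fcoefD ?hh ?addr0//; by apply: Lp_Lp1 p1' _.
Qed.

Lemma opinv_spec (A : fn R -> fn R) g : invertible_on p A -> Hp p g ->
  Hp p (opinv p A g) /\ aeeq (A (opinv p A g)) g.
Proof.
move=> [_ [sA _]] Hg; rewrite /opinv.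
exact: (epsilon_spec (inhabits (fcst 0)) (fun f => Hp p f /\ aeeq (A f) g) (sA g Hg)).
Qed.

Lemma opinv_unique (A : fn R -> fn R) f g : invertible_on p A -> Hp p f -> Hp p g ->
  aeeq (A f) g -> aeeq (opinv p A g) f.
Proof.
move=> iA Hf Hg E; have [Ho Eo] := opinv_spec iA Hg.
by case: iA => _ [_]; apply=> //; apply: aeeq_trans Eo _; exact: aeeq_sym.
Qed.

(** The only negative index that [t^-1 x] can have is -1, with the coefficient of [x] at 0. *)
Lemma Q_shift x : Hp p x -> aeeq (fmul (tpow 1) (Qproj (fmul (tpow (-1)) x))) (fcst (coef x 0)).
Proof.
move=> Hx; have Lx := Hp_LL Hx; have Ls : LL p (fmul (tpow (-1)) x).
  by apply: (Toep_LL p1') Lx; exact: Linf_tpow.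
have LP := Proj_LL p1 Ls.
have /aeeqP E : aeeq (Qproj (fmul (tpow (-1)) x)) (fscal (coef x 0) (tpow (-1))).
  have Lt : LL p (@tpow R (-1)) by apply: TP_Lp => //; exact: TP_tpow.
  apply: (LL_coef_inj p1'); [exact: Lp_minus|exact: Lp_scal|move=> n].
  rewrite fcoefB; [|by apply: Lp_Lp1 p1' _..]; rewrite fcoefZ; last exact: Lp_Lp1 Lt.
  rewrite (coef_Proj _ p1)// coef_shift opprK coef_tpow.
  case: (leP 0 n) => n0; first by rewrite subrr (_ : -1 == n = false) ?mulr0//; apply/eqP; lia.
  case: eqP => [<-|nn]; first by rewrite subr0 addNr mulr1.
  by rewrite mulr0 subr0 (Hp_coef Hx)//; lia.
apply/aeeqP; move: E; apply: AEW => z z0 E.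
by rewrite /fmul E /fscal tpow1E tpowN1E /fcst mulrCA mulfV// mulr1.
Qed.

End hankel.

(** * Pointwise identities of matching pairs *)

Section matching_identities.
Context {R : realType}.
Local Notation C := R[i].
Implicit Types (f g h u v x : fn R).
Local Opaque Toep Hank Proj Qproj.
Variables (p : R) (a b : fn R).
Hypothesis p1 : 1 < p.
Hypothesis Lai : Linf (frecip a).
Local Notation c := (sub_c a b).
Local Notation d := (sub_d a b).
Local Notation c2 := (fmul c (tpow (-2))).
Local Notation at1 := (fmul (frecip (tilde a)) (tpow (-1))).
Local Notation hc := (fmul (tpow 2) (tilde c)).
Local Notation ha := (fmul (frecip a) (tpow 1)).
Hypothesis Lc : Linf c.
Hypothesis nd : AE (fun z => [/\ a z != 0, b z != 0, a (z^-1) != 0, b (z^-1) != 0 &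
  a z * a (z^-1) = b z * b (z^-1)]).

Let p1' : 1 <= p. Proof. exact: ltW. Qed.
Let p0 : 0 < p. Proof. exact: lt_trans p1. Qed.
Let p0' : 0 <= p. Proof. exact: ltW. Qed.

Let Lc2 : Linf c2. Proof. by apply: Linf_mul => //; exact: Linf_tpow. Qed.
Let Lat1 : Linf at1.
Proof. by apply: Linf_mul; [exact: (Linf_tilde Lai)|exact: Linf_tpow]. Qed.
Let Lhc : Linf hc. Proof. by apply: Linf_mul; [exact: Linf_tpow|exact: Linf_tilde]. Qed.
Let Lha : Linf ha. Proof. by apply: Linf_mul => //; exact: Linf_tpow. Qed.

(** The hypothesis says that [h = c t^-2 v - ~a^-1 t^-1 u] is antianalytic. The Hankel terms are the
    projection of [J h], which is already in [H^p], so the projection disappears and an explicit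
    formula remains. *)
Lemma residual u v : Hp p u -> Hp p v -> aeeq (Toep c2 v) (Toep at1 u) ->
  Hp p (fminus (Hank hc v) (Hank ha u)) /\
  AE (fun z => fminus (Hank hc v) (Hank ha u) z =
     z * (c (z^-1) * v (z^-1)) - (a z)^-1 * u (z^-1)).
Proof.
move=> Hu Hv E; have Lu := Hp_LL Hu; have Lv := Hp_LL Hv.
have Lcv := Toep_LL p1' Lc2 Lv; have Lau := Toep_LL p1' Lat1 Lu.
pose h := fminus (fmul c2 v) (fmul at1 u).
have ah : antianalytic p h.
  split; first exact: Lp_minus.
  move=> n n0; rewrite fcoefB; [|by apply: Lp_Lp1 p1' _..].
  have HT := Toep_Hp p1 Lc2 Lv; have HA := Toep_Hp p1 Lat1 Lu.
  have := coef_aeeq n (LL_measC (Hp_LL HT)) (LL_measC (Hp_LL HA)) E.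
  by rewrite !(coef_Toep _ p1)// n0 => ->; rewrite subrr.
have HJ := antianalytic_J p1 ah.
have HH := Hank_Hp p1 Lhc Hv; have HK := Hank_Hp p1 Lha Hu.
have HS := lin_minus (Hp_lin p1') HH HK.
have L1 := Toep_LL p1' Lhc (Lp_J p0' Lv); have L2 := Toep_LL p1' Lha (Lp_J p0' Lu).
have /aeeqP ES : aeeq (fminus (Hank hc v) (Hank ha u)) (Jop h).
  apply: (LL_coef_inj p1' (Hp_LL HS) (Hp_LL HJ)) => n.
  case: (leP 0 n) => n0; last by rewrite (Hp_coef HS)// (Hp_coef HJ).
  rewrite fcoefB; [|by apply: Lp_Lp1 p1' _; exact: Hp_LL..].
  have e1 := coef_Hank p1 n Lhc Hv; have e2 := coef_Hank p1 n Lha Hu; rewrite n0 in e1 e2.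
  apply: (etrans (congr2 (fun x y : C => x - y) e1 e2)).
  apply: (etrans (esym (fcoefB n (Lp_Lp1 p1' L1) (Lp_Lp1 p1' L2)))).
  apply: coef_eq => th; have z0 := circ_neq0 th.
  rewrite /h /Jop /fminus /fmul /frecip /tilde tpow1E tpow2E tpowN1E tpowN2E invrK.
  move: (circ th) z0 (c _) (v _) (a _)^-1 (u _) => z z0 c' v' a0 u'.
  by field.
split=> //; move: ES; apply: AEW => z z0 ->.
rewrite /h /Jop /fminus /fmul /frecip /tilde tpowN1E tpowN2E invrK.
by move: (c _) (v _) (a _)^-1 (u _) => c' v' a0 u'; field.
Qed.

(** Suffix 0 stands for the value at [z] and suffix 1 for the value at [z^-1]. Eliminating [b0] by
    the matching relation makes the terms in [v] cancel. *)
Lemma lift_algebra (z a0 b0 a1 b1 u0 u1 v0 v1 : C) : z != 0 -> a0 != 0 -> b0 != 0 ->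
  a1 != 0 -> b1 != 0 -> a0 * a1 = b0 * b1 ->
  a0 * (z^-1 * (v0 - (z * (a1 / b1 * v1) - a0^-1 * u1))) +
  b0 * (v1 - (z^-1 * (a0 / b0 * v0) - a1^-1 * u0)) = a0 / b1 * u0 + z^-1 * u1.
Proof.
move=> z0 a00 b00 a10 b10 E; have -> : b0 = a0 * a1 / b1 by rewrite E mulfK.
by field; rewrite z0 a00 a10 b10.
Qed.

Lemma lift_identity u v s : AE (fun z => s z = z * (c (z^-1) * v (z^-1)) - (a z)^-1 * u (z^-1)) ->
  let f := fmul (tpow (-1)) (fminus v s) in
  aeeq (fadd (fmul a f) (fmul b (Jop f))) (fadd (fmul d u) (Jop u)).
Proof.
move=> Es f; apply/aeeqP; move: (AE_and nd (AE_and Es (AE_inv Es))).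
apply: AEW => z z0 [[a0 b0 a1 b1 ab] [e1 e2]].
rewrite /f /fadd /fmul /Jop /fminus !tpowN1E e1 e2 invrK [z^-1 * (z * _)]mulrA mulVf// mul1r.
exact: lift_algebra.
Qed.

(** Pointwise form of [c t^-2 (w + s) = J (w + s)], which uses [d k = J k]; its right-hand side is
    antianalytic for [w + s] in [H^p]. *)
Lemma kernel_algebra (z a0 b0 a1 b1 k0 k1 w0 w1 s0 s1 : C) : z != 0 -> a0 != 0 -> b0 != 0 ->
  a1 != 0 -> b1 != 0 -> a0 * a1 = b0 * b1 -> a0 / b1 * k0 = z^-1 * k1 ->
  s0 = z * (a1 / b1 * w1) - a0^-1 * k1 -> s1 = z^-1 * (a0 / b0 * w0) - a1^-1 * k0 ->
  a0 / b0 * (z^-1 * z^-1) * (w0 + s0) = z^-1 * (w1 + s1).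
Proof.
move=> z0 a00 b00 a10 b10 E Ek -> ->; have -> : b0 = a0 * a1 / b1 by rewrite E mulfK.
have -> : k1 = z * (a0 / b1 * k0) by rewrite Ek mulrA mulfV ?mul1r.
by field; rewrite z0 a00 a10 b10.
Qed.

Lemma omega_algebra (z a0 b0 a1 b1 k1 w0 w1 : C) : z != 0 -> a0 != 0 -> b0 != 0 ->
  a1 != 0 -> b1 != 0 -> a0 * a1 = b0 * b1 ->
  w0 + (z * (a1 / b1 * w1) - a0^-1 * k1) = 0 -> a0 * (z^-1 * w0) + b0 * w1 = z^-1 * k1.
Proof.
move=> z0 a00 b00 a10 b10 E Ew; have -> : b0 = a0 * a1 / b1 by rewrite E mulfK.
have -> : w0 = - (z * (a1 / b1 * w1) - a0^-1 * k1) by apply/eqP; rewrite -addr_eq0 Ew.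
by field; rewrite z0 a00 b10.
Qed.

(** By [kernel_algebra], [T(c t^-2)] kills [w + s], so injectivity gives [w = - s]. The formula of
    [residual] for [s] then turns into an equation for [w] alone, without a Hankel term. *)
Lemma omega_identity k w : invertible_on p (Toep c2) -> Hp p k -> aeeq (fmul d k) (Jop k) ->
  Hp p w -> aeeq (Toep c2 w) (Toep at1 k) ->
  let f := fmul (tpow (-1)) w in aeeq (fadd (fmul a f) (fmul b (Jop f))) (Jop k).
Proof.
move=> [_ [_ inj]] Hk /aeeqP Ek Hw E f.
have [Hs Es] := residual Hk Hw E; set s := fminus _ _ in Hs Es.
have Hws := lin_add (Hp_lin p1') Hw Hs.
have H0 : Hp p (@fcst R 0) by case: (Hp_lin p1').
have /aeeqP Ews : aeeq (fadd w s) (fcst 0).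
  apply: (inj _ _ Hws H0).
  have EJ : aeeq (fmul c2 (fadd w s)) (Jop (fadd w s)).
    apply/aeeqP; move: (AE_and nd (AE_and Ek (AE_and Es (AE_inv Es)))).
    apply: AEW => z z0 [[a0 b0 a1 b1 ab] [ek [e1 e2]]].
    rewrite /fmul /Jop /fadd tpowN2E; apply: kernel_algebra a0 b0 a1 b1 ab ek e1 _ => //.
    by rewrite e2 invrK.
  apply: (Toep_eqP p1 Lc2 (Hp_LL Hws)); first exact: Toep_Hp p1 Lc2 (Hp_LL H0).
  have [LJ aJ] := J_antianalytic p1 Hws.
  move=> n n0; rewrite (coef_aeeq _ _ _ EJ); [|exact/LL_measC/(Toep_LL p1' Lc2 (Hp_LL Hws))|exact: LL_measC LJ].
  rewrite aJ// (coef_Toep _ p1 Lc2 (Hp_LL H0)) n0.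
  rewrite (@coef_eq _ _ (fcst 0)) ?coef_cst ?mul0r//.
  by move=> th; rewrite /fmul /fcst mulr0.
apply/aeeqP; move: (AE_and nd (AE_and Es Ews)); apply: AEW => z z0 [[a0 b0 a1 b1 ab] [e1 e2]].
rewrite /f /fadd /fmul /Jop !tpowN1E invrK [z^-1 * (z * _)]mulrA mulVf// mul1r.
by apply: omega_algebra a0 b0 a1 b1 ab _ => //; rewrite -[_ - _]e1.
Qed.

End matching_identities.

(** * Boundedness of the subordinated pair and the kernel element from the factorization *)

Section matching_pairs.
Context {R : realType}.
Local Notation C := R[i].
Implicit Types (a b f : fn R).

(** Division by [b] is the delicate point: the matching relation shows that [b] has no zeros up to a
    null set, and it rewrites [c] as [~b / ~a] and [d] as [b / ~a], whose only denominator is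
    invertible in [L^inf]. *)
Lemma matching_facts a b : matching_pair a b -> [/\ Linf (frecip a), Linf (sub_c a b),
  Linf (sub_d a b) & AE (fun z => [/\ a z != 0, b z != 0, a (z^-1) != 0, b (z^-1) != 0 &
  a z * a (z^-1) = b z * b (z^-1)])].
Proof.
move=> [[La [a' [La' /aeeqP aa]]] [Lb /aeeqP ab]].
have ma : measC a by rewrite measCE; case: La.
have mb : measC b by rewrite measCE; case: Lb.
have E1 : AE (fun z => a z != 0 /\ a' z = (a z)^-1).
  move: aa; apply: AEW => z _; rewrite /fmul /fcst => e.
  have a0 : a z != 0 by apply/eqP => a0; move/eqP: e; rewrite a0 mul0r eq_sym oner_eq0.
  by split=> //; rewrite -[LHS]mul1r -(mulVf a0) -mulrA e mulr1.
have nd : AE (fun z => [/\ a z != 0, b z != 0, a (z^-1) != 0, b (z^-1) != 0 &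
    a z * a (z^-1) = b z * b (z^-1)]).
  move: (AE_and E1 (AE_and (AE_inv E1) ab)); apply: AEW => z _ [[a0 _] [[a1 _] e]].
  have : b z * b (z^-1) != 0 by rewrite -[_ * _]e mulf_neq0.
  by rewrite mulf_eq0 negb_or => /andP[b0 b1].
have Lta' := Linf_tilde La'.
split=> //.
- apply: (@Linf_aeeq _ a') => //; first exact: measC_frecip.
  by apply/aeeqP; move: E1; apply: AEW => z _ [].
- apply: (@Linf_aeeq _ (fmul (tilde b) (tilde a'))).
  + by apply: measC_mul => //; exact: measC_frecip.
  + apply/aeeqP; move: (AE_and nd (AE_inv E1)); apply: AEW => z _ [[a0 b0 a1 b1 e] [_ e1]].
    rewrite /fmul /tilde e1 /sub_c /fmul /frecip; apply/eqP; rewrite eq_sym.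
    by rewrite eqr_div// e mulrC.
  + by apply: Linf_mul => //; exact: Linf_tilde.
- apply: (@Linf_aeeq _ (fmul b (tilde a'))).
  + by apply: measC_mul => //; apply: measC_frecip; exact: measC_tilde.
  + apply/aeeqP; move: (AE_and nd (AE_inv E1)); apply: AEW => z _ [[a0 b0 a1 b1 e] [_ e1]].
    rewrite /fmul /tilde e1 /sub_d /fmul /frecip /tilde; apply/eqP; rewrite eq_sym.
    by rewrite eqr_div// e.
  + exact: Linf_mul.
Qed.

(** Inserting [d = sigma t^-2 d_+ / ~d_+] gives [d k = t^-2 (sigma + sigma^2 t) / ~d_+], which is
    [J k] because [sigma^2 = 1]. Moreover [k] is nonzero since [1 + sigma t] has constant
    coefficient 1. *)
Lemma kappa_facts p a b (sigma : C) dp : 1 < p -> matching_pair a b ->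
  normalized_WH p (sub_d a b) 2 sigma dp ->
  let k := fmul (frecip dp) (fun z => 1 + sigma * z) in
  [/\ Hp p k, aeeq (fmul (sub_d a b) k) (Jop k) & ~ aeeq k (fcst 0)].
Proof.
move=> p1 mab [[_ [_ [_ [Hr [/aeeqP ed _]]]]] [_ [_ sg]]] k.
have p1' := ltW p1; have [_ _ _ nd] := matching_facts mab.
have kE : k = fadd (frecip dp) (fscal sigma (fmul (tpow 1) (frecip dp))).
  by apply/funext => z; rewrite /k /fadd /fscal /fmul tpow1E; ring.
have Hk : Hp p k.
  by rewrite kE; apply: (Hp_lin p1').2 => //; exact: Hp_shift.
have sg2 : sigma * sigma = 1 by case: sg => ->; rewrite ?mulrNN mulr1.
have dp0 : AE (fun z => dp z != 0).
  move: (AE_and nd ed); apply: AEW => z _ [[a0 _ _ b1 _] e].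
  apply/eqP => d0; move/eqP: e; rewrite /sub_d /fmul /frecip /tilde d0 !mulr0 mulf_eq0 invr_eq0.
  by rewrite (negbTE a0) (negbTE b1).
split=> //.
- apply/aeeqP; move: (AE_and ed (AE_and dp0 (AE_inv dp0))); apply: AEW => z z0 [e [d0 d1]].
  rewrite {1}/fmul e /k /fmul /Jop /fscal /frecip /tilde tpowN2E.
  transitivity ((sigma + (sigma * sigma) * z) * (z^-1 * z^-1) / dp z^-1); first by field; rewrite d0 d1 z0.
  by rewrite sg2; field; rewrite d1 z0.
- move=> /aeeqP k0.
  have : aeeq (fadd (fcst 1) (fscal sigma (tpow 1))) (fcst 0).
    apply/aeeqP; move: (AE_and k0 dp0); apply: AEW => z _ [].
    rewrite /k /fmul /frecip /fcst => /eqP; rewrite mulf_eq0 invr_eq0 => /orP[->//|/eqP e _].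
    by rewrite /fadd /fscal tpow1E.
  have L1 : LL 1 (@fcst R 1) by apply: TP_Lp => //; exact: TP_cst.
  have Lt : LL 1 (@tpow R 1) by apply: TP_Lp => //; exact: TP_tpow.
  have Ls := Lp_scal sigma Lt.
  move=> /(coef_aeeq 0 (LL_measC (Lp_add ler01 L1 Ls)) (measC_cst _))/eqP.
  by rewrite fcoefD// fcoefZ// !coef_cst coef_tpow eqxx mulr0 mulr1 mul0r addr0 oner_eq0.
Qed.

End matching_pairs.

Local Opaque Toep Hank Proj Qproj.

Theorem theorem5p2 (R : realType) (p : R) (a b : fn R) (sigma : R[i]) (dp : fn R) :
  1 < p ->
  F_TH p a b (-2) 2 ->
  invertible_on p (fun f => fadd (Toep a f) (Hank b f)) ->
  normalized_WH p (sub_d a b) 2 sigma dp ->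
  let c := sub_c a b in
  let d := sub_d a b in
  let Tc2 := Toep (fmul c (tpow (-2))) in
  let Tat := Toep (fmul (frecip (tilde a)) (tpow (-1))) in
  let omega := opinv p Tc2
      (Tat (fmul (frecip dp) (fun z => 1 + sigma * z))) in
  invertible_on p Tc2 /\
  fc omega 0 <> 0 /\
  forall Tr : fn R -> fn R, right_inverse_on p (Toep d) Tr ->
  forall f : fn R, Hp p f ->
    aeeq (opinv p (fun g => fadd (Toep a g) (Hank b g)) f)
      (Toep (tpow (-1))
        (let u := Tr f in
         let v := opinv p Tc2 (Tat u) in
         let x := fadd (fminus v (Hank (fmul (tpow 2) (tilde c)) v))
                       (Hank (fmul (frecip a) (tpow 1)) u) in
         fminus x (fscal (fc omega 0)^-1
                   (fmul omega (fmul (tpow 1) (Qproj (fmul (tpow (-1)) x))))))).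
Proof.
move=> p1 [mab [Fc _]] iA WH c d Tc2 Tat omega.
have p1' := ltW p1; have p0' : 0 <= p by exact: le_trans p1'.
have [Lai Lc Ld nd] := matching_facts mab.
have [[La _] [Lb _]] := mab.
have [Hk ek nk] := kappa_facts p1 mab WH; rewrite -/d in ek.
set k := fmul (frecip dp) _ in Hk ek nk omega *.
have c0 : AE (fun z => c z != 0).
  by move: nd; apply: AEW => z _ [a0 b0 _ _ _]; rewrite mulf_neq0// invr_neq0.
have iT : invertible_on p Tc2 by exact: Toep_shift_invertible.
have Lat : Linf (fmul (frecip (tilde a)) (tpow (-1))).
  by apply: Linf_mul; [exact: (Linf_tilde Lai)|exact: Linf_tpow].
have HTat u : Hp p u -> Hp p (Tat u) by move=> Hu; apply: (Toep_Hp p1 Lat); exact: Hp_LL.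
have [Hw ew] : Hp p omega /\ aeeq (Tc2 omega) (Tat k) := opinv_spec iT (HTat _ Hk).
have Iw := omega_identity p1 Lai Lc nd iT Hk ek Hw ew.
have Lw := Hp_LL Hw; have Lt1 : Linf (@tpow R (-1)) by exact: Linf_tpow.
clearbody omega; clear ew.
(* Otherwise [t^-1 omega] is in [H^p] and, by [omega_identity], in the kernel of [T(a) + H(b)],
   hence 0. That identity then reads [J k = 0], against [k != 0]. *)
have w0 : coef omega 0 != 0.
  apply/eqP => w0; apply: nk.
  have Hf : Hp p (fmul (tpow (-1)) omega).
    apply/HpE; split; first exact: (Toep_LL p1').
    move=> n n0; rewrite coef_shift opprK.
    by have [->|n1] := eqVneq n (-1); [rewrite addNr|rewrite (Hp_coef Hw)//; lia].
  have H0 : Hp p (@fcst R 0) by case: (Hp_lin p1').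
  have a0 : antianalytic p (@fcst R 0) by split=> [|n _]; [exact: Hp_LL|rewrite coef_cst mul0r].
  have /aeeqP f0 : aeeq (fmul (tpow (-1)) omega) (fcst 0).
    case: iA => _ [_]; apply=> //; apply: (@aeeq_trans _ _ (fcst 0)).
      apply: (TH_eqP p1 La Lb Hf H0 (J_antianalytic p1 Hk)).
      apply: aeeq_trans Iw _; apply/aeeqP; apply: AE_all => z _; by rewrite /fadd /fcst add0r.
    apply: aeeq_sym; apply: (TH_eqP p1 La Lb H0 H0 a0); apply/aeeqP; apply: AE_all => z _.
    by rewrite /fadd /fmul /Jop /fcst !mulr0.
  apply/aeeqP; move/aeeqP: Iw => Iw; move: (AE_and (AE_inv Iw) (AE_and (AE_inv f0) f0)).
  apply: AEW => z z0 [e1 [e2 e3]]; move: e1.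
  rewrite /fadd {1}/fmul e2 [X in _ + X]/fmul /Jop invrK e3 /fcst !mulr0 addr0 => /eqP.
  by rewrite eq_sym mulf_eq0 (negbTE z0) => /eqP.
split=> //; rewrite fcE; split; first exact/eqP.
move=> Tr [rTr _] g Hg; have [Hu eu] := rTr g Hg; move: (Tr g) Hu eu => u Hu eu.
have [] := opinv_spec iT (HTat _ Hu); rewrite /=; move: (opinv p Tc2 (Tat u)) => v Hv ev.
have Lu := Hp_LL Hu; have Lv := Hp_LL Hv.
have [Hs Es] := residual p1 Lai Lc Hu Hv ev.
rewrite (_ : fadd (fminus v _) _ = fminus v (fminus (Hank (fmul (tpow 2) (tilde c)) v)
  (Hank (fmul (frecip a) (tpow 1)) u))); last first.
  by apply/funext => z; rewrite /fadd /fminus opprB addrAC addrA.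
have Ix := lift_identity nd Es.
move: (fminus (Hank _ v) _) Hs Es Ix => s Hs _ Ix.
have Hx : Hp p (fminus v s) := lin_minus (Hp_lin p1') Hv Hs.
move: (fminus v s) Hx Ix => x Hx Ix.
(* The multiple of [omega] that makes [y] vanish at the origin, so that [t^-1 y] stays in [H^p]. *)
pose lam := coef x 0 / coef omega 0.
pose y := fadd x (fscal (- lam) omega).
have Hy : Hp p y := (Hp_lin p1').2 _ _ _ Hx Hw.
have y0 : coef y 0 = 0.
  by rewrite (coefDZ _ _ p1' (Hp_LL Hx) Lw) mulNr divfK// subrr.
pose F := fmul (tpow (-1)) y.
have HF : Hp p F.
  apply/HpE; split; first exact: (Toep_LL p1' Lt1 (Hp_LL Hy)).
  move=> n n0; rewrite coef_shift opprK.
  by have [->|n1] := eqVneq n (-1); [rewrite addNr|rewrite (Hp_coef Hy)//; lia].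
have [La1 aa1] := Toep_antianalytic p1 Ld Lu Hg eu.
(* The full remainder: [a F + b J F = d u + J u - lam J k], where [d u - g] is antianalytic because
   [T(d) u = g]. *)
have aJ : antianalytic p (fadd (fminus (fmul d u) g) (Jop (fadd u (fscal (- lam) k)))).
  have [LJ hJ] := J_antianalytic p1 ((Hp_lin p1').2 (- lam) _ _ Hu Hk).
  split; first exact: Lp_add.
  move=> n n0; rewrite fcoefD; [|exact: Lp_Lp1 La1|exact: Lp_Lp1 LJ].
  by rewrite aa1// hJ// addr0.
have AF : aeeq (fadd (Toep a F) (Hank b F)) g.
  apply: (TH_eqP p1 La Lb HF Hg aJ); apply/aeeqP; move/aeeqP: Iw => Iw; move/aeeqP: Ix => Ix.
  move: (AE_and Ix Iw); apply: AEW => z _ [].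
  rewrite /F /y /fadd /fminus /fscal /fmul /Jop => e1 e2.
  rewrite (_ : _ + _ = a z * (tpow (-1) z * x z) + b z * (z^-1 * (tpow (-1) z^-1 * x z^-1)) -
     lam * (a z * (tpow (-1) z * omega z) + b z * (z^-1 * (tpow (-1) z^-1 * omega z^-1)))).
    by rewrite e1 e2 [g z + _]addrA [g z + _]addrC subrK mulrDr mulNr addrA mulrN mulrCA.
  move: (tpow _ _) (tpow _ _) (omega _) (omega _) (x _) (x _) => t1 t2 o1 o2 x1 x2; ring.
apply: aeeq_trans (opinv_unique iA HF Hg AF) _; apply: aeeq_sym.
set Y := fminus x _.
(* By [Q_shift] the factor [t Q t^-1 x] is the constant [coef x 0], so the stated correction of [x]
   is [lam omega]. *)
have EY : aeeq y Y.
  have /aeeqP := Q_shift p1 Hx => Q; apply/aeeqP; move: Q; apply: AEW => z _ e.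
  rewrite /Y /y /fminus /fadd /fscal [fmul omega _ z]/fmul e /fcst /lam mulNr; congr (_ - _).
  by rewrite [coef x 0 / _]mulrC -mulrA [coef x 0 * _]mulrC.
have LY : LL p Y.
  apply: aeeq_Lp EY (Hp_LL Hy); apply: measC_minus; first exact: LL_measC (Hp_LL Hx).
  apply: measC_scal; apply: measC_mul; first exact: LL_measC Lw.
  apply: measC_mul; first exact: measC_tpow.
  have Lx1 : LL p (fmul (tpow (-1)) x) := Toep_LL p1' Lt1 (Hp_LL Hx).
  by apply: measC_minus; [exact: LL_measC Lx1|exact: LL_measC (Proj_LL p1 Lx1)].
(* Since [t^-1 Y] agrees almost everywhere with [F] in [H^p], the outer [T(t^-1)] acts on [Y] as
   plain multiplication. *)
apply: (Toep_eqP p1 Lt1 LY HF) => n _; apply: coef_aeeq.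
- exact: LL_measC (Toep_LL p1' Lt1 LY).
- exact: LL_measC (Hp_LL HF).
- by apply/aeeqP; move/aeeqP: EY; apply: AEW => z _ e; rewrite /F /fmul e.
Qed.
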